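(* Let $B$ and $B'$ be braids on $n$ and $n-1$ strands, respectively. Then there is a loop $g_t:\mathbb{C}\to\mathbb{C}$, $t\in[0,2\pi]$, in $\widehat{X}_n$ such that (1) the roots $\{(u,t)\in\mathbb{C}\times[0,2\pi] : g_t(u)=0\}$ form the braid $B$; (2) the saddle point braid of $g_t$, given by $\{(u,t)\in\mathbb{C}\times[0,2\pi] : \frac{\partial g_t}{\partial u}(u)=0\}$, is $B'$.
   Context: $\widehat{X}_n$ denotes the space of monic complex polynomials in one variable $u$ of degree $n$ with distinct roots, distinct critical values (so that the $n-1$ critical points are also distinct), and constant term not equal to any of its critical values. A geometric braid on $n$ strands is a set of disjoint parametric curves $\bigcup_{t\in[0,2\pi]}\bigcup_{j=1}^n (z_j(t),t)\subset\mathbb{C}\times[0,2\pi]$, where $z_j:[0,2\pi]\to\mathbb{C}$ are smooth, $z_i(t)\ne z_j(t)$ for all $t$ and $i\neq j$, and for every $i$ there is a $j$ with $z_i(0)=z_j(2\pi)$. A braid isotopy is an isotopy through geometric braids fixing the endpoints at $t=0$ and $t=2\pi$; a braid is also understood to mean a braid isotopy class. The braid group $\mathbb{B}_n$ on $n$ strands is the group of isotopy classes with a fixed endpoint set. At a height $t$ at which the real parts of the strands are distinct, strands are numbered by increasing real part, and $\mathbb{B}_n$ is generated by the Artin generators $\sigma_i$, $i=1,\dots,n-1$, the positive half-twists between the $i$th and $(i+1)$st strands; using this ordering, a geometric braid (with endpoints of distinct real parts) is identified with an element of $\mathbb{B}_n$, and a geometric braid ''forms'' or ''is'' the braid $B$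 if it represents it. For a loop $g_t$ in $\widehat{X}_n$, the roots form a braid on $n$ strands and the critical points form a braid on $n-1$ strands; the latter is called the saddle point braid of $g_t$. *)

(* Defs.v *)
From HB Require Import structures.
From mathcomp Require Import all_boot all_order all_algebra.
From mathcomp Require Import complex.
From mathcomp Require Import all_classical all_reals all_analysis.

Set Implicit Arguments.
Unset Strict Implicit.
Unset Printing Implicit Defensive.

Import Order.TTheory GRing.Theory Num.Theory.
Import numFieldNormedType.Exports.

Local Open Scope classical_set_scope.
Local Open Scope ring_scope.

(* Smoothness on a compact interval: f is there the restriction of a C^oo
   function on the real line; values of f outside [a, b] play no role. *)
Definition smooth_on (R : realType) (a b : R) (f : R -> R) : Prop :=
  exists F : R -> R,
    (forall (k : nat) (t : R), derivable (derive1n k F) t 1) /\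
    (forall t, a <= t <= b -> f t = F t).

(* A parametrisation of a geometric braid by labelled strands. The braid itself
   is the unlabelled set [braid_set z]. Values of a strand outside [0, 2 pi] are
   irrelevant. *)
Record geometric_braid (R : realType) (n : nat) := GeometricBraid {
  strand :> 'I_n -> R -> R[i];
  strand_smooth : forall j,
    smooth_on 0 (2 * pi) (fun t => complex.Re (strand j t)) /\
    smooth_on 0 (2 * pi) (fun t => complex.Im (strand j t));
  strand_disjoint : forall t, 0 <= t <= 2 * pi ->
    forall i j, i <> j -> strand i t <> strand j t;
  strand_closed : forall i, exists j, strand i 0 = strand j (2 * pi)
}.

Definition braid_set (R : realType) (n : nat) (z : geometric_braid R n) :
    set (R[i] * R) :=
  [set ut | 0 <= ut.2 <= 2 * pi /\ exists j, ut.1 = z j ut.2].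

Definition distinct_real_parts (R : realType) (n : nat)
    (z : geometric_braid R n) (t : R) : Prop :=
  injective (fun j => complex.Re (z j t)).

(* Isotopy through geometric braids fixing the endpoints at t = 0 and t = 2 pi.
   Strand labels are carried along. *)
Definition braid_isotopic (R : realType) (n : nat)
    (z z' : geometric_braid R n) : Prop :=
  exists H : R -> geometric_braid R n,
    [/\ forall j,
          {within `[0, 1] `*` `[0, 2 * pi],
            continuous (fun st : R * R => complex.Re (H st.1 j st.2))} /\
          {within `[0, 1] `*` `[0, 2 * pi],
            continuous (fun st : R * R => complex.Im (H st.1 j st.2))},
        forall j t, 0 <= t <= 2 * pi -> H 0 j t = z j t,
        forall j t, 0 <= t <= 2 * pi -> H 1 j t = z' j t
      & forall s j, 0 <= s <= 1 ->
          H s j 0 = z j 0 /\ H s j (2 * pi) = z j (2 * pi)].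

(* Position (counted from 0) of strand j when the strands at height t are
   numbered by increasing real part. *)
Definition position (R : realType) (n : nat) (z : geometric_braid R n)
    (t : R) (j : 'I_n) : nat :=
  #|[pred k : 'I_n | complex.Re (z k t) < complex.Re (z j t)]|.

(* Between the heights s and s', z is a half-twist of the strands in positions
   i and i.+1, positive (counterclockwise) iff e: the only coincidence of real
   parts is between a and b at height c, where a moves from left to right, and
   it does so counterclockwise when it passes below b in the plane. *)
Definition half_twist (R : realType) (n : nat) (z : geometric_braid R n)
    (s s' : R) (i : nat) (e : bool) : Prop :=
  exists (a b : 'I_n) (c : R),
    [/\ s < c < s',
        forall t j k, s <= t <= s' -> complex.Re (z j t) = complex.Re (z k t) ->
          j = k \/ t = c /\ (j, k) \in [:: (a, b); (b, a)],
        position z s a = i /\ position z s b = i.+1,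
        position z s' b = i /\ position z s' a = i.+1
      & if e then complex.Im (z a c) < complex.Im (z b c)
        else complex.Im (z b c) < complex.Im (z a c)].

(* Words in the Artin generators: the letter (i, true) with i : 'I_n.-1 is
   sigma_(i+1), and (i, false) is its inverse. *)
Definition artin_word (n : nat) := seq ('I_n.-1 * bool).

Fixpoint reads_word (R : realType) (n : nat) (z : geometric_braid R n)
    (s s' : R) (w : artin_word n) : Prop :=
  match w with
  | [::] => forall t, s <= t <= s' -> distinct_real_parts z t
  | (i, e) :: w' =>
      exists2 r, s < r < s' & half_twist z s r i e /\ reads_word z r s' w'
  end.

(* The isotopy class of z is the product w of Artin generators. *)
Definition represents (R : realType) (n : nat) (z : geometric_braid R n)
    (w : artin_word n) : Prop :=
  exists z0, braid_isotopic z z0 /\ reads_word z0 0 (2 * pi) w.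

(* z and z' may have different endpoint sets; the braid groups of the two
   endpoint sets are identified by matching their Artin generators. *)
Definition same_braid (R : realType) (n : nat)
    (z z' : geometric_braid R n) : Prop :=
  exists w : artin_word n, represents z w /\ represents z' w.

Definition forms_braid (R : realType) (n : nat) (S : set (R[i] * R))
    (B : geometric_braid R n) : Prop :=
  exists z : geometric_braid R n, S = braid_set z /\ same_braid z B.

(* rs and cs list the roots and the critical points with multiplicity. *)
Definition Xhat (R : realType) (n : nat) : set {poly R[i]} :=
  [set p | [/\ p \is monic, size p = n.+1,
    exists2 rs : seq R[i], p = \prod_(r <- rs) ('X - r%:P) & uniq rs
  & exists2 cs : seq R[i],
      p^`() = n%:R *: \prod_(c <- cs) ('X - c%:P)
    & uniq [seq p.[c] | c <- cs] /\ p`_0 \notin [seq p.[c] | c <- cs]]].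

(* A continuous loop, for the topology of coefficients. *)
Definition loop_in_Xhat (R : realType) (n : nat) (g : R -> {poly R[i]}) : Prop :=
  [/\ forall t, 0 <= t <= 2 * pi -> Xhat n (g t),
      forall k : nat,
        {within `[0, 2 * pi], continuous (fun t : R => complex.Re (g t)`_k)} /\
        {within `[0, 2 * pi], continuous (fun t : R => complex.Im (g t)`_k)}
    & g 0 = g (2 * pi)].

(* Main.v *)
Require Import Defs.
From mathcomp Require Import all_boot all_order all_algebra.
From mathcomp Require Import complex.
From mathcomp Require Import all_classical all_reals all_analysis.
From mathcomp Require Import ring lra zify.

Set Implicit Arguments.
Unset Strict Implicit.
Unset Printing Implicit Defensive.

Import Order.TTheory GRing.Theory Num.Theory.
Import numFieldNormedType.Exports.

Local Open Scope classical_set_scope.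
Local Open Scope ring_scope.


(** A monic polynomial is determined by its critical points c and its constant
    term a, and belongs to the space as soon as it has simple roots and c is good,
    which is a condition on c alone: [cpoly], [good_crit], [cpoly_Xhat]. So the
    critical points can be moved at will within an open, generic set, and the
    roots depend continuously on (c, a) as long as they stay simple.

    The two braids are realised one after the other. A path of root configurations
    forming B has, after small perturbations, good critical points; they trace
    some braid D that is not under control ([realize_roots]). It has to be
    corrected without changing the root braid. This is possible where the
    constant term is very large: there the roots are close to those of
    X^n + a whatever the critical points do, so that the critical points can run
    back along D and then along B', while the roots are almost at rest
    ([large_constant]). The constant term gets there and back along a ray avoiding
    the critical values ([ray_out]); these two parts of the path cancel in the root
    braid and are constant in the critical points. Altogether the roots form B and
    the critical points form D, the inverse of D, and B' ([realize_both]).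

    Three kinds of arguments surround this construction. Genericity: a condition
    that, for each point, excludes finitely many positions when the others are
    fixed, holds along a small perturbation of any given path ([avoid_path]), by
    moving one point at a time and bending the edges around the excluded
    positions. Smoothness: paths are merely continuous until the end; then
    critical points and constant term are interpolated smoothly, simple roots of
    smooth families are smooth ([root_smooth]), and continuous homotopies of
    smooth braids become braid isotopies ([hom_isotopic]). Words: every braid is
    homotopic to a polygon moving one point at a time, of which a word in the
    Artin generators can be read off ([polygon_of_braid]); adding edges that keep
    the order of the real parts gives the polygon any endpoints ordered like
    the given ones, with the same word ([matched_polygon]). In particular the
    braids may start at the roots and critical points of a single generic
    polynomial ([base_configuration]). *)

(** * Modulus, continuity and compactness in the complex plane *)

Local Notation nrm := (@Normc.normc _).

Section Modulus.
Variable R : realType.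
Local Notation C := R[i].
Implicit Types z w : C.

Lemma nrmE z : `|z| = (nrm z)%:C%C.
Proof. by case: z => a b; rewrite normc_def. Qed.

Lemma nrm_ge0 z : 0 <= nrm z.
Proof. by rewrite -lecR -nrmE normr_ge0. Qed.

Lemma nrmD z w : nrm (z + w) <= nrm z + nrm w.
Proof. exact: le_normcD. Qed.

Lemma nrmN z : nrm (- z) = nrm z.
Proof. exact: normcN. Qed.

Lemma nrmM z w : nrm (z * w) = nrm z * nrm w.
Proof. exact: Normc.normcM. Qed.

Lemma nrmV z : nrm z^-1 = (nrm z)^-1.
Proof. exact: Normc.normcV. Qed.

Lemma nrm0 : nrm (0 : C) = 0.
Proof. exact: Normc.normc0. Qed.

Lemma nrm1 : nrm (1 : C) = 1.
Proof. exact: Normc.normc1. Qed.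

Lemma nrm_eq0 z : (nrm z == 0) = (z == 0).
Proof.
by apply/eqP/eqP => [/Normc.eq0_normc //|->]; rewrite nrm0.
Qed.

Lemma nrm_gt0 z : (0 < nrm z) = (z != 0).
Proof. by rewrite lt_def nrm_ge0 andbT nrm_eq0. Qed.

Lemma nrmX z k : nrm (z ^+ k) = nrm z ^+ k.
Proof.
by elim: k => [|k IH]; rewrite ?expr0 ?nrm1 // !exprS nrmM IH.
Qed.

Lemma nrm_distC z w : nrm (z - w) = nrm (w - z).
Proof. by rewrite -nrmN opprB. Qed.

Lemma nrm_trans z x w : nrm (z - w) <= nrm (z - x) + nrm (x - w).
Proof. by apply: le_trans (nrmD _ _); rewrite addrA subrK. Qed.

Lemma nrmR (x : R) : nrm x%:C%C = `|x|.
Proof. by rewrite /= expr0n /= addr0 sqrtr_sqr. Qed.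

Lemma nrm_Re z : `|complex.Re z| <= nrm z.
Proof.
case: z => a b /=; rewrite -[leLHS]sqrtr_sqr ler_wsqrtr //.
by rewrite lerDl sqr_ge0.
Qed.

Lemma nrm_Im z : `|complex.Im z| <= nrm z.
Proof.
case: z => a b /=; rewrite -[leLHS]sqrtr_sqr ler_wsqrtr //.
by rewrite lerDr sqr_ge0.
Qed.

Lemma nrm_ReIm z : nrm z <= `|complex.Re z| + `|complex.Im z|.
Proof.
case: z => a b; have -> : (a +i* b)%C = a%:C%C + (0 +i* b)%C.
  by apply/eqP; rewrite eq_complex /= addr0 add0r !eqxx.
apply: le_trans (nrmD _ _) _; rewrite nrmR /= addr0 lerD //.
by rewrite add0r expr0n /= add0r sqrtr_sqr.
Qed.

Lemma nrm_prod (I : Type) (s : seq I) (F : I -> C) :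
  nrm (\prod_(i <- s) F i) = \prod_(i <- s) nrm (F i).
Proof.
elim: s => [|i s IH]; first by rewrite !big_nil nrm1.
by rewrite !big_cons nrmM IH.
Qed.

Lemma cReD z w : complex.Re (z + w) = complex.Re z + complex.Re w.
Proof. by case: z w => [a b] [c d]. Qed.
Lemma cImD z w : complex.Im (z + w) = complex.Im z + complex.Im w.
Proof. by case: z w => [a b] [c d]. Qed.
Lemma cReN z : complex.Re (- z) = - complex.Re z.
Proof. by case: z. Qed.
Lemma cImN z : complex.Im (- z) = - complex.Im z.
Proof. by case: z. Qed.
Lemma cReM z w : complex.Re (z * w) =
  complex.Re z * complex.Re w - complex.Im z * complex.Im w.
Proof. by case: z w => [a b] [c d]. Qed.
Lemma cImM z w : complex.Im (z * w) =
  complex.Re z * complex.Im w + complex.Im z * complex.Re w.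
Proof. by case: z w => [a b] [c d]. Qed.
Lemma cReV z : complex.Re z^-1 =
  complex.Re z / (complex.Re z ^+ 2 + complex.Im z ^+ 2).
Proof. by case: z => a b. Qed.
Lemma cImV z : complex.Im z^-1 =
  - complex.Im z / (complex.Re z ^+ 2 + complex.Im z ^+ 2).
Proof. by case: z => a b /=; rewrite mulNr. Qed.

Lemma cReZ (x : R) z : complex.Re (x%:C%C * z) = x * complex.Re z.
Proof. by rewrite cReM /= mul0r subr0. Qed.
Lemma cImZ (x : R) z : complex.Im (x%:C%C * z) = x * complex.Im z.
Proof. by rewrite cImM /= mul0r addr0. Qed.

Lemma complex_ext z w :
  complex.Re z = complex.Re w -> complex.Im z = complex.Im w -> z = w.
Proof. by case: z w => [a b] [c d] /= -> ->. Qed.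

Lemma nrm2_neq0 z : z != 0 -> complex.Re z ^+ 2 + complex.Im z ^+ 2 != 0.
Proof.
case: z => a b; rewrite eq_complex /= negb_and => h.
rewrite paddr_eq0 ?sqr_ge0 // !sqrf_eq0 negb_and.
by [].
Qed.

(** Discs are convex. *)
Lemma nrm_convex (x : C) (s e : R) z w : 0 <= s <= 1 ->
  nrm (z - x) <= e -> nrm (w - x) <= e ->
  nrm (((1 - s)%:C%C * z + s%:C%C * w) - x) <= e.
Proof.
move=> /andP[s0 s1] hz hw.
have -> : (1 - s)%:C%C * z + s%:C%C * w - x =
  (1 - s)%:C%C * (z - x) + s%:C%C * (w - x).
  by rewrite rmorphB /=; ring.
apply: le_trans (nrmD _ _) _; rewrite !nrmM !nrmR.
rewrite [`|s|]ger0_norm // ger0_norm ?subr_ge0 //.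
have h1 : (1 - s) * nrm (z - x) <= (1 - s) * e by rewrite ler_wpM2l ?subr_ge0.
have h2 : s * nrm (w - x) <= s * e by rewrite ler_wpM2l.
lra.
Qed.

End Modulus.

(** Continuity, smoothness, polynomiality and local Lipschitz bounds all pass
    from coordinates to polynomial expressions in them; every expression is
    treated once for all these properties. *)
Record falg (R : realType) (T : Type) (P : (T -> R[i]) -> Prop) : Prop := {
  falg_cst : forall c, P (fun=> c);
  falg_add : forall f g, P f -> P g -> P (fun x => f x + g x);
  falg_mul : forall f g, P f -> P g -> P (fun x => f x * g x) }.

Section FAlg.
Variables (R : realType) (T : Type) (P : (T -> R[i]) -> Prop).
Hypothesis aP : falg P.

Lemma falg_sum (I : Type) (s : seq I) (f : I -> T -> R[i]) :
  (forall i, P (f i)) -> P (fun x => \sum_(i <- s) f i x).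
Proof.
move=> Pf; elim: s => [|i s IH].
  rewrite (_ : (fun _ => _) = fun=> 0); first exact: (falg_cst aP).
  by apply/funext => x; rewrite big_nil.
rewrite (_ : (fun _ => _) = fun x => f i x + \sum_(j <- s) f j x).
  exact: (falg_add aP).
by apply/funext => x; rewrite big_cons.
Qed.

Lemma falg_prod (I : Type) (s : seq I) (f : I -> T -> R[i]) :
  (forall i, P (f i)) -> P (fun x => \prod_(i <- s) f i x).
Proof.
move=> Pf; elim: s => [|i s IH].
  rewrite (_ : (fun _ => _) = fun=> 1); first exact: (falg_cst aP).
  by apply/funext => x; rewrite big_nil.
rewrite (_ : (fun _ => _) = fun x => f i x * \prod_(j <- s) f j x).
  exact: (falg_mul aP).
by apply/funext => x; rewrite big_cons.
Qed.

Lemma falg_opp f : P f -> P (fun x => - f x).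
Proof.
move=> Pf; rewrite (_ : (fun _ => _) = fun x => -1 * f x).
  by apply: (falg_mul aP) => //; apply: (falg_cst aP).
by apply/funext => x; rewrite mulN1r.
Qed.

Lemma falg_sub f g : P f -> P g -> P (fun x => f x - g x).
Proof. by move=> Pf Pg; apply: (falg_add aP) => //; apply: falg_opp. Qed.

Lemma falg_exp f k : P f -> P (fun x => f x ^+ k).
Proof.
move=> Pf; elim: k => [|k IH]; first exact: (falg_cst aP 1).
rewrite (_ : (fun _ => _) = fun x => f x * f x ^+ k).
  exact: (falg_mul aP).
by apply/funext => x; rewrite exprS.
Qed.
End FAlg.

(** ** Continuity *)
Section Continuity.
Variable R : realType.
Local Notation C := R[i].

(** Limits are taken on real and imaginary parts, the form in which the
    smoothness of braids and the continuity of loops are specified. *)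
Definition ccvg (T : Type) (F : set_system T) (f : T -> C) (l : C) : Prop :=
  (complex.Re (f x) @[x --> F] --> complex.Re l) /\
  (complex.Im (f x) @[x --> F] --> complex.Im l).

Definition cc (T : topologicalType) (f : T -> C) : Prop :=
  continuous (fun x => complex.Re (f x)) /\
  continuous (fun x => complex.Im (f x)).

Section Cvg.
Variables (T : Type) (F : set_system T).
Context {FF : Filter F}.

Lemma ccvg_cst c : ccvg F (fun=> c) c.
Proof. by split; exact: cvg_cst. Qed.

Lemma ccvgD f g a b : ccvg F f a -> ccvg F g b ->
  ccvg F (fun x => f x + g x) (a + b).
Proof.
move=> [f1 f2] [g1 g2]; split.
  rewrite cReD (_ : (fun _ => _) = (fun x => complex.Re (f x) + complex.Re (g x))).
    exact: cvgD.
  by apply/funext => x; rewrite cReD.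
rewrite cImD (_ : (fun _ => _) = (fun x => complex.Im (f x) + complex.Im (g x))).
  exact: cvgD.
by apply/funext => x; rewrite cImD.
Qed.

Lemma ccvgM f g a b : ccvg F f a -> ccvg F g b ->
  ccvg F (fun x => f x * g x) (a * b).
Proof.
move=> [f1 f2] [g1 g2]; split.
  rewrite cReM (_ : (fun _ => _) = (fun x => complex.Re (f x) * complex.Re (g x)
    - complex.Im (f x) * complex.Im (g x))).
    by apply: cvgB; apply: cvgM.
  by apply/funext => x; rewrite cReM.
rewrite cImM (_ : (fun _ => _) = (fun x => complex.Re (f x) * complex.Im (g x)
    + complex.Im (f x) * complex.Re (g x))).
  by apply: cvgD; apply: cvgM.
by apply/funext => x; rewrite cImM.
Qed.

Lemma ccvgV f a : a != 0 -> ccvg F f a -> ccvg F (fun x => (f x)^-1) a^-1.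
Proof.
move=> a0 [f1 f2].
have n2 : (complex.Re (f x) ^+ 2 + complex.Im (f x) ^+ 2)^-1 @[x --> F] -->
    (complex.Re a ^+ 2 + complex.Im a ^+ 2)^-1.
  apply: cvgV; first exact: nrm2_neq0.
  by apply: cvgD; rewrite !expr2; apply: cvgM.
split.
  rewrite cReV (_ : (fun _ => _) = (fun x => complex.Re (f x) *
    (complex.Re (f x) ^+ 2 + complex.Im (f x) ^+ 2)^-1)).
    exact: cvgM.
  by apply/funext => x; rewrite cReV.
rewrite cImV (_ : (fun _ => _) = (fun x => - complex.Im (f x) *
    (complex.Re (f x) ^+ 2 + complex.Im (f x) ^+ 2)^-1)).
  by apply: cvgM => //; apply: cvgN.
by apply/funext => x; rewrite cImV.
Qed.

Lemma ccvgN f a : ccvg F f a -> ccvg F (fun x => - f x) (- a).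
Proof.
move=> fa; rewrite -mulN1r (_ : (fun _ => _) = (fun x => -1 * f x)).
  by apply: ccvgM fa; apply: ccvg_cst.
by apply/funext => x; rewrite mulN1r.
Qed.

Lemma ccvgP f a : ccvg F f a <->
  forall e : R, 0 < e -> \forall x \near F, nrm (f x - a) < e.
Proof.
split.
  move=> [/cvgrPdist_lt h1 /cvgrPdist_lt h2] e e0.
  have e2 : 0 < e / 2 by rewrite divr_gt0.
  near=> x.
  apply: le_lt_trans (nrm_ReIm _) _.
  rewrite cReD cReN cImD cImN (splitr e) ltrD //.
    by rewrite distrC; near: x; exact: h1.
  by rewrite distrC; near: x; exact: h2.
move=> h; split; apply/cvgrPdist_lt => e e0; near=> x.
  rewrite distrC -cReN -cReD; apply: le_lt_trans (nrm_Re _) _.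
  by near: x; exact: h.
rewrite distrC -cImN -cImD; apply: le_lt_trans (nrm_Im _) _.
by near: x; exact: h.
Unshelve. all: by end_near.
Qed.
End Cvg.

Lemma ccE (T : topologicalType) (f : T -> C) :
  cc f <-> forall x, ccvg (nbhs x) f (f x).
Proof.
split; first by move=> [f1 f2] x; split; [exact: f1|exact: f2].
by move=> h; split=> x; [exact: (h x).1|exact: (h x).2].
Qed.

Lemma ccP (T : topologicalType) (f : T -> C) : cc f <->
  forall x (e : R), 0 < e -> \forall y \near x, nrm (f y - f x) < e.
Proof.
rewrite ccE; split=> h x; first exact: (ccvgP (F := nbhs x) f (f x)).1.
by apply: (ccvgP (F := nbhs x) f (f x)).2 => e e0; apply: h.
Qed.

Lemma cc_falg (T : topologicalType) : falg (@cc T).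
Proof.
split.
- by move=> c; apply/ccE => x; apply: ccvg_cst.
- by move=> f g /ccE hf /ccE hg; apply/ccE => x; apply: ccvgD.
- by move=> f g /ccE hf /ccE hg; apply/ccE => x; apply: ccvgM.
Qed.

Lemma cc_comp (T U : topologicalType) (f : U -> C) (g : T -> U) :
  continuous g -> cc f -> cc (fun x => f (g x)).
Proof.
move=> cg [f1 f2]; split=> x.
  exact: (@continuous_comp _ _ _ g (fun y => complex.Re (f y)) x (cg x) (f1 _)).
exact: (@continuous_comp _ _ _ g (fun y => complex.Im (f y)) x (cg x) (f2 _)).
Qed.

Lemma cc_real (T : topologicalType) (f : T -> R) :
  continuous f -> cc (fun x => (f x)%:C%C).
Proof. by move=> cf; split => //=; exact: cst_continuous. Qed.

End Continuity.

(** ** Compactness *)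
Section Compactness.
Variable R : realType.
Local Notation C := R[i].

(** The minimum of finitely many positive bounds is positive. *)
Lemma fin_eps (I : finType) (P : R -> I -> Prop) :
  (forall e e' i, 0 < e' <= e -> P e i -> P e' i) ->
  (forall i, exists2 e, 0 < e & P e i) ->
  exists2 e, 0 < e & forall i, P e i.
Proof.
move=> mono h.
suff [e e0 he] : exists2 e, 0 < e & forall i, i \in enum I -> P e i.
  by exists e => // i; apply: he; rewrite mem_enum.
elim: (enum I) => [|i s [e e0 he]]; first by exists 1.
have [e' e'0 he'] := h i; exists (Num.min e e'); first by rewrite lt_min e0.
move=> j; rewrite inE => /orP[/eqP->|js].
  by apply: mono he'; rewrite lt_min e0 e'0 ge_min lexx orbT.
by apply: (mono e); [rewrite lt_min e0 e'0 ge_min lexx|exact: he].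
Qed.

(** Finitely many of the local bounds cover K, and their minimum is positive. *)
Lemma compact_unif (X : topologicalType) (K : set X) (P : R -> X -> Prop) :
  compact K -> (forall e e' x, 0 < e' <= e -> P e x -> P e' x) ->
  (forall x, K x -> exists2 e, 0 < e & \forall y \near x, P e y) ->
  exists2 e, 0 < e & forall x, K x -> P e x.
Proof.
move=> /compact_near_coveringP cK mono h.
have : \forall e \near 0^'+, K `<=` P e.
  have FF : Filter (0^'+ : set_system R) by typeclasses eauto.
  apply: (cK R _ P FF) => x Kx; have [e e0 he] := h x Kx.
  exists ([set y | P e y], [set e' | 0 < e' <= e]).
    split => //=; near=> e'; apply/andP; split; near: e'.
      exact: nbhs_right_gt.
    exact: nbhs_right_le.
  by move=> [y e'] /= [Pe e'e]; apply: mono Pe.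
move=> hn; near (0 : R)^'+ => e.
have KP : K `<=` P e by near: e; exact: hn.
by exists e => //; near: e; exact: nbhs_right_gt.
Unshelve. all: by end_near.
Qed.

Lemma cc_bounded (X : topologicalType) (K : set X) (f : X -> C) :
  compact K -> cc f -> exists2 M : R, 0 < M & forall x, K x -> nrm (f x) <= M.
Proof.
move=> cK /ccP cf.
have [||e e0 he] := @compact_unif X K (fun e x => nrm (f x) <= e^-1) cK.
- move=> e e' x /andP[e'0 e'e] /le_trans; apply.
  by rewrite lef_pV2 // posrE // (lt_le_trans e'0).
- move=> x _; exists (nrm (f x) + 1)^-1.
    by rewrite invr_gt0 ltr_wpDl ?nrm_ge0.
  near=> y; rewrite invrK -(subrK (f x) (f y)) addrC.
  apply: le_trans (nrmD _ _) _; rewrite lerD2l ltW //.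
  by near: y; apply: cf.
by exists e^-1 => //; rewrite invr_gt0.
Unshelve. all: by end_near.
Qed.

Lemma cc_away0 (X : topologicalType) (K : set X) (f : X -> C) :
  compact K -> cc f -> (forall x, K x -> f x != 0) ->
  exists2 e : R, 0 < e & forall x, K x -> e <= nrm (f x).
Proof.
move=> cK /ccP cf f0.
have [||e e0 he] := @compact_unif X K (fun e x => e <= nrm (f x)) cK.
- by move=> e e' x /andP[_ e'e]; apply: le_trans.
- move=> x Kx; have n0 : 0 < nrm (f x) by rewrite nrm_gt0 f0.
  exists (nrm (f x) / 2); first by rewrite divr_gt0.
  near=> y; have : nrm (f y - f x) < nrm (f x) / 2.
    by near: y; apply: cf; rewrite divr_gt0.
  have := nrmD (f y) (f x - f y); rewrite addrC subrK (nrm_distC (f x)).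
  lra.
by exists e.
Unshelve. all: by end_near.
Qed.

Definition unit_square : set (R * R) := `[0, 1] `*` `[0, 1].

Lemma compact_square : compact unit_square.
Proof. by apply: compact_setX; apply: segment_compact. Qed.

Lemma cc_unif (f : R * R -> C) (e : R) : cc f -> 0 < e ->
  exists2 d, 0 < d & forall s t t', 0 <= s <= 1 -> 0 <= t <= 1 ->
    `|t - t'| < d -> nrm (f (s, t) - f (s, t')) < e.
Proof.
move=> /ccP cf e0.
have e2 : 0 < e / 2 by rewrite divr_gt0.
have [||d d0 hd] := @compact_unif _ unit_square (fun d x => forall t',
  `|x.2 - t'| < d -> nrm (f x - f (x.1, t')) < e) compact_square.
- by move=> d d' x /andP[_ dd] h t' /lt_le_trans/(_ dd); apply: h.
- move=> x _; have /nbhs_ballP[d /= d0 hd] := cf x _ e2.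
  have d2 : 0 < d / 2 by rewrite divr_gt0.
  have dd : d / 2 <= d by lra.
  exists (d / 2) => //; apply/nbhs_ballP; exists (d / 2) => // y [y1 y2] t' yt'.
  have h1 : nrm (f y - f x) < e / 2.
    apply: hd; split.
      by exact: le_ball y1.
    by exact: le_ball y2.
  have h2 : nrm (f (y.1, t') - f x) < e / 2.
    apply: hd; split => /=.
      by exact: le_ball y1.
    rewrite /ball /= (splitr d); apply: le_lt_trans (ler_distD y.2 _ _) _.
    by rewrite ltrD.
  apply: le_lt_trans (nrm_trans _ (f x) _) _.
  by rewrite (splitr e) ltrD // nrm_distC.
by exists d => // s t t' s01 t01; apply: (hd (s, t)); split => /=; rewrite in_itv.
Unshelve. all: by end_near.
Qed.

(** Uniform continuity gives one subdivision of [0, 1] that is fine enough for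
    all strands and all stages of a homotopy. *)
Lemma mesh n (K : R * R -> 'I_n -> C) (e : R) : (forall j, cc (K^~ j)) -> 0 < e ->
  exists2 N, (0 < N)%N & forall j (s t t' : R), 0 <= s <= 1 -> 0 <= t <= 1 ->
    `|t - t'| <= N%:R^-1 -> nrm (K (s, t) j - K (s, t') j) < e.
Proof.
move=> Kc e0.
have [d d0 hd] : exists2 d : R, 0 < d & forall j (s t t' : R), 0 <= s <= 1 ->
    0 <= t <= 1 -> `|t - t'| < d -> nrm (K (s, t) j - K (s, t') j) < e.
  apply: (@fin_eps 'I_n (fun d j => forall s t t' : R, 0 <= s <= 1 ->
    0 <= t <= 1 -> `|t - t'| < d -> nrm (K (s, t) j - K (s, t') j) < e)).
    move=> d d' j /andP[_ dd] h s t t' s01 t01 /lt_le_trans/(_ dd).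
    exact: (h s t t' s01 t01).
  by move=> j; have [d d0 hd] := cc_unif (Kc j) e0; exists d.
pose N := (Num.bound d^-1).+1; exists N => // j s t t' s01 t01 tt'; apply: hd => //.
apply: le_lt_trans tt' _; rewrite -[d]invrK ltf_pV2 ?posrE ?invr_gt0 // ?ltr0n //.
apply: lt_le_trans (archi_boundP _) _; first by rewrite invr_ge0 ltW.
by rewrite ler_nat.
Qed.

Lemma inj_avoid (T : eqType) (g : nat -> T) (F : seq T) : injective g ->
  exists k, g k \notin F.
Proof.
move=> gi; apply/not_existsP => h.
have u : uniq [seq g k | k <- iota 0 (size F).+1] by rewrite map_inj_uniq ?iota_uniq.
have /(uniq_leq_size u) : {subset [seq g k | k <- iota 0 (size F).+1] <= F}.
  by move=> x /mapP[k _ ->]; apply/negPn/negP; apply: h.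
by rewrite size_map size_iota ltnn.
Qed.

Lemma harm_inj (e : R) : e != 0 -> injective (fun k : nat => e / k.+1%:R).
Proof. by move=> e0 k l /(mulfI e0) /invr_inj /eqP; rewrite eqr_nat => /eqP[]. Qed.

End Compactness.

(** * Polynomials with prescribed critical points *)

Section RootPolynomial.
Variable R : realType.
Local Notation C := R[i].

Definition rpoly (n : nat) (x : 'I_n -> C) : {poly C} :=
  \prod_(j < n) ('X - (x j)%:P).

Lemma rpolyE n (x : 'I_n -> C) :
  rpoly x = \prod_(r <- [seq x j | j <- enum 'I_n]) ('X - r%:P).
Proof. by rewrite big_map big_enum. Qed.

Lemma size_rpoly n (x : 'I_n -> C) : size (rpoly x) = n.+1.
Proof. by rewrite rpolyE size_prod_XsubC size_map size_enum_ord. Qed.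

Lemma monic_rpoly n (x : 'I_n -> C) : rpoly x \is monic.
Proof. by rewrite rpolyE monic_prod_XsubC. Qed.

Lemma horner_rpoly n (x : 'I_n -> C) u : (rpoly x).[u] = \prod_(j < n) (u - x j).
Proof. by rewrite horner_prod; apply: eq_bigr => j _; rewrite !hornerE. Qed.

Lemma root_rpolyP n (x : 'I_n -> C) u :
  (rpoly x).[u] = 0 <-> exists j, u = x j.
Proof.
rewrite horner_rpoly; split.
  by move/eqP/prodf_eq0 => [j _]; rewrite subr_eq0 => /eqP ->; exists j.
by move=> [j ->]; rewrite (bigD1 j) //= subrr mul0r.
Qed.

Lemma rpoly_perm n (x : 'I_n -> C) (s : 'I_n -> 'I_n) : injective s ->
  rpoly (x \o s) = rpoly x.
Proof. by move=> si; rewrite /rpoly [RHS](reindex_inj si). Qed.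

Lemma rpoly_split n (p : {poly C}) : p \is monic -> size p = n.+1 ->
  exists x : 'I_n -> C, p = rpoly x.
Proof.
move=> pm sp; have [r hr] := closed_field_poly_normal p.
move: hr; rewrite (monicP pm) scale1r => hr.
have sr : size r = n by move: sp; rewrite hr size_prod_XsubC => -[].
exists (fun j => r`_j); rewrite hr (big_nth 0) sr big_mkord.
by [].
Qed.

Lemma rpoly_relabel n (x y : 'I_n -> C) : injective x -> rpoly x = rpoly y ->
  exists2 s : 'I_n -> 'I_n, injective s & forall j, x j = y (s j).
Proof.
move=> xi xy.
have h j : {k | x j == y k}.
  apply: sigW; have : (rpoly y).[x j] = 0.
    by rewrite -xy; apply/root_rpolyP; exists j.
  by move/root_rpolyP => [k ->]; exists k.
exists (fun j => sval (h j)) => [j k jk|j]; last exact/eqP/(svalP (h j)).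
apply: xi; rewrite (eqP (svalP (h j))) (eqP (svalP (h k))).
by rewrite jk.
Qed.

Lemma rpoly_inj n (x y : 'I_n -> C) : injective x -> rpoly x = rpoly y ->
  injective y.
Proof.
move=> xi xy; have [s si sxy] := rpoly_relabel xi xy.
have [s' ss' s's] := injF_bij si.
by move=> j k; rewrite -(s's j) -(s's k) -!sxy => /xi ->.
Qed.

Lemma deriv_rpoly_root n (x : 'I_n -> C) j : injective x -> (rpoly x)^`().[x j] != 0.
Proof.
move=> xi; rewrite /rpoly (bigD1 j) //= derivM derivXsubC mul1r hornerD hornerM.
rewrite hornerXsubC subrr mul0r addr0 horner_prod; apply/prodf_neq0 => k kj.
by rewrite hornerXsubC subr_eq0; apply: contra kj => /eqP/xi ->.
Qed.

(** The coefficients are polynomials in the roots. *)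
Lemma falg_rpoly (T : Type) (P : (T -> C) -> Prop) n (x : T -> 'I_n -> C) :
  falg P -> (forall j, P (x^~ j)) -> forall i, P (fun t => (rpoly (x t))`_i).
Proof.
move=> aP Px; rewrite /rpoly.
suff H (s : seq 'I_n) i : P (fun t => (\prod_(j <- s) ('X - (x t j)%:P))`_i).
  move=> i; have := H (index_enum 'I_n) i.
  by [].
elim: s i => [|j s IH] i.
  rewrite (_ : (fun _ => _) = fun=> (i == 0)%:R); first exact: (falg_cst aP).
  by apply/funext => t; rewrite big_nil coef1.
rewrite (_ : (fun _ => _) = fun t =>
   (if i is i'.+1 then (\prod_(j <- s) ('X - (x t j)%:P))`_i' else 0) -
   x t j * (\prod_(j <- s) ('X - (x t j)%:P))`_i).
  apply: (falg_sub aP); first by case: i => [|i]; [exact: (falg_cst aP)|].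
  exact: (falg_mul aP).
apply/funext => t; rewrite big_cons mulrBl coefB coefXM coefCM.
by case: i.
Qed.

Lemma rpoly_scale n (x : 'I_n -> C) (l : C) i :
  (rpoly (fun j => l * x j))`_i * l ^+ i = l ^+ n * (rpoly x)`_i.
Proof.
rewrite /rpoly.
suff H (s : seq 'I_n) : forall i,
    (\prod_(j <- s) ('X - (l * x j)%:P))`_i * l ^+ i =
    l ^+ size s * (\prod_(j <- s) ('X - (x j)%:P))`_i.
  by have := H (index_enum 'I_n) i; rewrite [index_enum _]unlock -enumT size_enum_ord.
elim: s => [|j s IH] k.
  by rewrite !big_nil expr0 mul1r coef1; case: k => [|k]; rewrite ?mul0r ?expr0 ?mulr1.
rewrite !big_cons !mulrBl !coefB !coefXM !coefCM /=.
case: k => [|k] /=.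
  by have := IH 0; rewrite expr0 !mulr1 => ->; rewrite exprS; ring.
rewrite mulrBl.
have E : forall q : C, q * l ^+ k.+1 = l * (q * l ^+ k) by move=> q; rewrite exprS; ring.
rewrite [X in X - _ = _]E IH; have := IH k.+1.
set A := (\prod_(j <- s) ('X - (l * x j)%:P))`_k.+1 => hA.
have -> : l * x j * A * l ^+ k.+1 = l * x j * (A * l ^+ k.+1) by ring.
by rewrite hA [l ^+ (size s).+1]exprS; ring.
Qed.

End RootPolynomial.

Section CriticalPolynomial.
Variables (R : realType) (m : nat).
Local Notation C := R[i].
Implicit Types (c : 'I_m -> C) (a u : C).

(** The antiderivative of (m + 1) prod (X - c_k) with constant term a. Working
    with (c, a) instead of coefficients makes the critical points explicit, and
    any monic polynomial of degree m + 1 has this form. *)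
Definition cpoly c a : {poly C} :=
  a%:P + \sum_(i < m.+1) (m.+1%:R * (rpoly c)`_i / i.+1%:R) *: 'X^(i.+1).

Lemma natC_neq0 k : k.+1%:R != 0 :> C.
Proof. by rewrite pnatr_eq0. Qed.

Lemma coef_cpoly c a i : (cpoly c a)`_i =
  if i is i'.+1 then m.+1%:R * (rpoly c)`_i' / i'.+1%:R else a.
Proof.
rewrite /cpoly coefD coefC coef_sum.
case: i => [|i] /=.
  by rewrite big1 ?addr0 // => j _; rewrite coefZ coefXn mulr0.
rewrite add0r; have [im|im] := ltnP i m.+1.
  rewrite (bigD1 (Ordinal im)) //= coefZ coefXn eqxx mulr1 big1 ?addr0 // => j.
  move=> ji; rewrite coefZ coefXn eqSS [_ == _]negbTE ?mulr0 //.
  by apply: contra ji => /eqP h; apply/eqP/val_inj.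
rewrite big1 => [|j _].
  by rewrite [(rpoly c)`_i]nth_default ?size_rpoly // mulr0 mul0r.
rewrite coefZ coefXn eqSS [_ == _]negbTE ?mulr0 //.
by rewrite neq_ltn (leq_trans (ltn_ord j) im) orbT.
Qed.

Lemma cpoly0 c a : (cpoly c a)`_0 = a. Proof. by rewrite coef_cpoly. Qed.

Lemma cpolyD c a u : (cpoly c a).[u] = (cpoly c 0).[u] + a.
Proof. by rewrite /cpoly !hornerD !hornerC add0r addrC. Qed.

Lemma lead_rpoly c : (rpoly c)`_m = 1.
Proof. by have /monicP := monic_rpoly c; rewrite lead_coefE size_rpoly. Qed.

Lemma size_cpoly c a : size (cpoly c a) = m.+2.
Proof.
have h : (cpoly c a)`_m.+1 = 1.
  by rewrite coef_cpoly lead_rpoly mulr1 divff // natC_neq0.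
apply/eqP; rewrite eqn_leq; apply/andP; split.
  apply/leq_sizeP => -[|j] //; rewrite coef_cpoly ltnS => mj.
  by rewrite [(rpoly c)`_j]nth_default ?size_rpoly // mulr0 mul0r.
rewrite ltnNge; apply/negP => /leq_sizeP/(_ _ (leqnn _)).
by rewrite h => /eqP; rewrite oner_eq0.
Qed.

Lemma monic_cpoly c a : cpoly c a \is monic.
Proof.
by rewrite monicE lead_coefE size_cpoly coef_cpoly /= lead_rpoly mulr1 divff ?natC_neq0.
Qed.

Lemma deriv_cpoly c a : (cpoly c a)^`() = m.+1%:R *: rpoly c.
Proof.
apply/polyP => i; rewrite coef_deriv coef_cpoly coefZ.
by rewrite -[_ *+ _]mulr_natr divfK // natC_neq0.
Qed.

Lemma cpoly_unique c (p : {poly C}) : p^`() = m.+1%:R *: rpoly c ->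
  p = cpoly c p`_0.
Proof.
move=> hp; apply/polyP => -[|i]; rewrite coef_cpoly //.
have := congr1 (fun q : {poly C} => q`_i) hp; rewrite /= coef_deriv coefZ => <-.
by rewrite -[_ *+ _]mulr_natr mulfK // natC_neq0.
Qed.

Lemma cpoly_exists (p : {poly C}) : p \is monic -> size p = m.+2 ->
  exists c, p = cpoly c p`_0.
Proof.
move=> pm sp.
have sd : size p^`() = m.+1.
  apply/eqP; rewrite eqn_leq; apply/andP; split.
    apply/leq_sizeP => j mj; rewrite coef_deriv nth_default ?mul0rn //.
    by rewrite sp ltnS.
  rewrite ltnNge; apply/negP => /leq_sizeP/(_ _ (leqnn _)).
  rewrite coef_deriv; move/monicP: pm; rewrite lead_coefE sp /= => ->.
  by apply/eqP; rewrite natC_neq0.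
have [||c hc] := @rpoly_split R m (m.+1%:R^-1 *: p^`()).
- rewrite monicE lead_coefZ lead_coefE sd /= coef_deriv.
  move/monicP: pm; rewrite lead_coefE sp /= => ->.
  by rewrite mulVf ?natC_neq0.
- by rewrite size_scale ?invr_eq0 ?natC_neq0.
exists c; apply: cpoly_unique; rewrite -hc scalerA divff ?scale1r //.
Qed.

Lemma cpoly_perm c a (s : 'I_m -> 'I_m) : injective s ->
  cpoly (c \o s) a = cpoly c a.
Proof. by move=> si; rewrite /cpoly rpoly_perm. Qed.

Lemma cpoly_eq c c' a : c =1 c' -> cpoly c a = cpoly c' a.
Proof. by move=> /funext ->. Qed.

Lemma falg_cpoly (T : Type) (P : (T -> C) -> Prop) (c : T -> 'I_m -> C)
    (a : T -> C) : falg P -> (forall k, P (c^~ k)) -> P a ->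
  forall i, P (fun t => (cpoly (c t) (a t))`_i).
Proof.
move=> aP Pc Pa [|i].
  rewrite (_ : (fun _ => _) = a) //.
  by apply/funext => t; rewrite cpoly0.
rewrite (_ : (fun _ => _) = fun t => m.+1%:R * (rpoly (c t))`_i * i.+1%:R^-1).
  apply: (falg_mul aP); last exact: (falg_cst aP).
  by apply: (falg_mul aP); [exact: (falg_cst aP)|exact: falg_rpoly].
by apply/funext => t; rewrite coef_cpoly.
Qed.

Lemma falg_horner (T : Type) (P : (T -> C) -> Prop) (p : T -> {poly C}) d
    (u : T -> C) : falg P -> (forall t, (size (p t) <= d)%N) ->
  (forall i, P (fun t => (p t)`_i)) -> P u -> P (fun t => (p t).[u t]).
Proof.
move=> aP sp Pp Pu.
rewrite (_ : (fun _ => _) = fun t => \sum_(i < d) (p t)`_i * u t ^+ i).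
  apply: (falg_sum aP) => i; apply: (falg_mul aP) => //.
  exact: falg_exp.
by apply/funext => t; rewrite (horner_coef_wide _ (sp t)).
Qed.

Lemma falg_cpoly_horner (T : Type) (P : (T -> C) -> Prop) (c : T -> 'I_m -> C)
    (a u : T -> C) : falg P -> (forall k, P (c^~ k)) -> P a -> P u ->
  P (fun t => (cpoly (c t) (a t)).[u t]).
Proof.
move=> aP Pc Pa Pu; apply: (@falg_horner _ _ _ m.+2) => //.
  by move=> t; rewrite size_cpoly.
exact: falg_cpoly.
Qed.

(** Homogeneity: scaling the plane by l multiplies roots and critical points by
    l. *)
Lemma cpoly_scale c a (l u : C) :
  (cpoly (fun k => l * c k) (l ^+ m.+1 * a)).[l * u] =
  l ^+ m.+1 * (cpoly c a).[u].
Proof.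
rewrite (horner_coef_wide (n := m.+2)) ?size_cpoly //.
rewrite [in RHS](horner_coef_wide (n := m.+2)) ?size_cpoly // mulr_sumr.
apply: eq_bigr => -[[|i] /= im] _; rewrite !coef_cpoly.
  by rewrite !expr0 !mulr1.
have := rpoly_scale c l i.
set A := (rpoly _)`_i; set B := (rpoly c)`_i => AB.
rewrite exprMn.
have -> : m.+1%:R * A / i.+1%:R * (l ^+ i.+1 * u ^+ i.+1) =
   m.+1%:R * (A * l ^+ i) * l / i.+1%:R * u ^+ i.+1 by rewrite exprS; ring.
by rewrite AB [l ^+ m.+1]exprS; ring.
Qed.

Definition cval c k : C := (cpoly c 0).[c k].

(** Adding a constant to a polynomial shifts its critical values and its value
    at the origin alike. So this condition on the critical points alone says
    that the critical values are distinct and differ from the constant term,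
    whatever that term is. *)
Definition good_crit c : Prop :=
  injective (cval c) /\ forall k, cval c k != 0.

(** A discriminant: the failure of good_crit is the vanishing of a single
    polynomial in c, so that good_crit is an open and generic condition. *)
Definition cdisc c : C :=
  (\prod_k cval c k) *
  \prod_(kl : 'I_m * 'I_m | kl.1 != kl.2) (cval c kl.1 - cval c kl.2).

Lemma cdiscP c : good_crit c <-> cdisc c != 0.
Proof.
rewrite /cdisc mulf_eq0 negb_or; split.
  move=> [ci c0]; apply/andP; split; first by apply/prodf_neq0.
  apply/prodf_neq0 => -[k l] /= kl; rewrite subr_eq0.
  by apply: contra kl => /eqP/ci ->.
move=> /andP[/prodf_neq0 h1 /prodf_neq0 h2]; split; last by move=> k; apply: h1.
move=> k l kl; apply/eqP; apply: contraT => kl'.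
by have := h2 (k, l) kl'; rewrite /= kl subrr eqxx.
Qed.

Lemma falg_cval (T : Type) (P : (T -> C) -> Prop) (c : T -> 'I_m -> C) k :
  falg P -> (forall k, P (c^~ k)) -> P (fun t => cval (c t) k).
Proof.
move=> aP Pc; apply: (falg_cpoly_horner (a := fun=> 0)) => //.
exact: (falg_cst aP).
Qed.

Lemma falg_cdisc (T : Type) (P : (T -> C) -> Prop) (c : T -> 'I_m -> C) :
  falg P -> (forall k, P (c^~ k)) -> P (fun t => cdisc (c t)).
Proof.
move=> aP Pc; apply: (falg_mul aP).
  by apply: falg_prod => // k; apply: falg_cval.
rewrite (_ : (fun _ => _) = fun t => \prod_(kl : 'I_m * 'I_m)
   (if kl.1 != kl.2 then cval (c t) kl.1 - cval (c t) kl.2 else 1)).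
  apply: falg_prod => // kl; case: (_ != _); last exact: (falg_cst aP).
  by apply: falg_sub => //; apply: falg_cval.
by apply/funext => t; rewrite -big_mkcond.
Qed.

Lemma good_crit_perm c (s : 'I_m -> 'I_m) : injective s ->
  good_crit c -> good_crit (c \o s).
Proof.
have E k : injective s -> cval (c \o s) k = cval c (s k).
  by move=> si; rewrite /cval cpoly_perm.
move=> si [ci c0]; split; last by move=> k; rewrite E.
by move=> k l; rewrite !E // => /ci/si.
Qed.

Lemma good_crit_inj c : good_crit c -> injective c.
Proof. by move=> [ci _] k l kl; apply: ci; rewrite /cval kl. Qed.

(** A multiple root is a critical point with critical value zero. *)
Lemma cpoly_simple_roots c a : (forall k, (cpoly c a).[c k] != 0) ->
  exists2 y : 'I_m.+1 -> C, injective y & cpoly c a = rpoly y.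
Proof.
move=> h; have [y hy] := rpoly_split (monic_cpoly c a) (size_cpoly c a).
exists y => // i j yij; apply/eqP; apply: contraT => ij.
have y0 : (cpoly c a).[y i] = 0 by rewrite hy; apply/root_rpolyP; exists i.
have : (cpoly c a)^`().[y i] = 0.
  rewrite hy /rpoly (bigD1 i) //= (bigD1 j) ?(eq_sym j) //= !derivM !derivXsubC.
  by rewrite !hornerE -yij !subrr; ring.
rewrite deriv_cpoly hornerZ => /eqP; rewrite mulf_eq0 (negbTE (natC_neq0 _)) /=.
move/eqP/root_rpolyP => [k hk]; have := h k.
by rewrite -hk y0 eqxx.
Qed.

Lemma cpoly_roots_neq0 c a (y : 'I_m.+1 -> C) k : injective y ->
  cpoly c a = rpoly y -> (cpoly c a).[c k] != 0.
Proof.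
move=> yi hy; apply/eqP => h0.
have := h0; rewrite hy => /root_rpolyP[j hj].
move: (deriv_rpoly_root j yi); rewrite -hj -hy deriv_cpoly hornerZ.
by rewrite (root_rpolyP _ _).2 ?mulr0 ?eqxx //; exists k.
Qed.

End CriticalPolynomial.

(** ** Polynomial functions and Lipschitz functions *)
Section FunctionClasses.
Variable R : realType.
Local Notation C := R[i].

(** The coordinate e is the identity of C when one point moves in the plane, and
    the inclusion of R in C along real lines. *)
Definition polyfun (T : Type) (e f : T -> C) : Prop :=
  exists p : {poly C}, forall s, f s = p.[e s].

Lemma polyfun_falg (T : Type) (e : T -> C) : falg (polyfun e).
Proof.
split; first by move=> c; exists c%:P => s; rewrite hornerC.
- by move=> f g [p hp] [q hq]; exists (p + q) => s; rewrite hornerD hp hq.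
- by move=> f g [p hp] [q hq]; exists (p * q) => s; rewrite hornerM hp hq.
Qed.

Lemma polyfun_id (T : Type) (e : T -> C) : polyfun e e.
Proof. by exists 'X => s; rewrite hornerX. Qed.

Lemma polyfun_zeros (f : C -> C) s0 : polyfun id f -> f s0 != 0 ->
  exists F : seq C, forall s, s \notin F -> f s != 0.
Proof.
move=> [p hp] fs0; have p0 : p != 0.
  by apply: contra fs0 => /eqP p0; rewrite hp p0 horner0.
have [r hr] := closed_field_poly_normal p.
exists r => s; apply: contra => /eqP fs.
by rewrite -root_prod_XsubC -(rootZ _ _ (a := lead_coef p)) ?lead_coef_eq0 // -hr rootE -hp fs.
Qed.

Variable I : finType.
Implicit Types x y : I -> C.

(** The bound on E itself makes the class stable under products. *)
Definition lipb (E : (I -> C) -> C) : Prop := forall M : R, exists2 L : R, 0 <= L &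
  forall x y d, 0 <= d -> (forall i, nrm (x i) <= M) ->
    (forall i, nrm (y i) <= M) -> (forall i, nrm (x i - y i) <= d) ->
    nrm (E x) <= L /\ nrm (E x - E y) <= L * d.

Lemma lipb_falg : falg lipb.
Proof.
split.
- move=> c M; exists (nrm c); first exact: nrm_ge0.
  move=> x y d d0 _ _ _; rewrite subrr nrm0; split => //.
  by rewrite mulr_ge0 // nrm_ge0.
- move=> f g hf hg M; have [L L0 hL] := hf M; have [L' L'0 hL'] := hg M.
  exists (L + L'); first exact: addr_ge0.
  move=> x y d d0 hx hy xy; have [h1 h2] := hL x y d d0 hx hy xy.
  have [h3 h4] := hL' x y d d0 hx hy xy; split.
    by apply: le_trans (nrmD _ _) _; rewrite lerD.
  by rewrite opprD addrACA mulrDl; apply: le_trans (nrmD _ _) _; rewrite lerD.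
- move=> f g hf hg M; have [L L0 hL] := hf M; have [L' L'0 hL'] := hg M.
  exists (2 * L * L' + L * L'); first by rewrite addr_ge0 // !mulr_ge0.
  move=> x y d d0 hx hy xy; have [h1 h2] := hL x y d d0 hx hy xy.
  have [h3 h4] := hL' x y d d0 hx hy xy.
  have yx i : nrm (y i - x i) <= d by rewrite nrm_distC.
  have [h5 _] := hL y x d d0 hy hx yx.
  have LL : 0 <= L * L' by rewrite mulr_ge0.
  split.
    have : nrm (f x) * nrm (g x) <= L * L' by rewrite ler_pM ?nrm_ge0.
    rewrite nrmM; lra.
  have -> : f x * g x - f y * g y = (f x - f y) * g x + f y * (g x - g y).
    by ring.
  apply: le_trans (nrmD _ _) _; rewrite !nrmM.
  have a1 : nrm (f x - f y) * nrm (g x) <= L * d * L'.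
    by rewrite ler_pM ?nrm_ge0.
  have a2 : nrm (f y) * nrm (g x - g y) <= L * (L' * d).
    by rewrite ler_pM ?nrm_ge0.
  have : 0 <= L * L' * d by rewrite mulr_ge0.
  nra.
Qed.

Lemma lipb_coord i : lipb (fun x => x i).
Proof.
move=> M; exists (`|M| + 1); first by rewrite addr_ge0.
move=> x y d d0 hx _ xy; split.
  by apply: le_trans (hx i) _; rewrite (le_trans (ler_norm _)) // lerDl.
by apply: le_trans (xy i) _; rewrite ler_peMl // lerDr.
Qed.

(** The points x t with t in K are bounded, so that one Lipschitz constant
    serves on a neighbourhood of all of them. *)
Lemma lipb_tube (X : topologicalType) (K : set X) (x : X -> I -> C) E (e : R) :
  compact K -> (forall i, cc (x^~ i)) -> lipb E -> 0 < e ->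
  exists2 d, 0 < d & forall t y, K t -> (forall i, nrm (y i - x t i) <= d) ->
    nrm (E y - E (x t)) < e.
Proof.
move=> cK xc hE e0.
have [M M0 hM] : exists2 M : R, 0 < M & forall t, K t -> forall i, nrm (x t i) <= M.
  have [||M' M'0 hM'] := @fin_eps R I (fun d i => forall t, K t -> nrm (x t i) <= d^-1).
  - move=> d d' i /andP[d'0 d'd] h t /h /le_trans; apply.
    by rewrite lef_pV2 // posrE (lt_le_trans d'0).
  - move=> i; have [M M0 hM] := cc_bounded cK (xc i).
    by exists M^-1; rewrite ?invr_gt0 // => t /hM; rewrite invrK.
  exists M'^-1; first by rewrite invr_gt0.
  by move=> t Kt i; apply: hM'.
have [L L0 hL] := hE (M + 1).
have d0 : 0 < Num.min 1 (e / (L + 1) / 2).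
  by rewrite lt_min ltr01 !divr_gt0 // ltr_wpDl.
exists (Num.min 1 (e / (L + 1) / 2)) => // t y Kt yx.
have [||_ h] := hL y (x t) _ (ltW d0) _ _ yx.
- move=> i; rewrite -(subrK (x t i) (y i)) addrC.
  apply: le_trans (nrmD _ _) _; rewrite lerD ?hM //.
  by apply: le_trans (yx i) _; rewrite ge_min lexx.
- by move=> i; apply: le_trans (hM t Kt i) _; rewrite lerDl.
apply: le_lt_trans h _.
have h1 : L * Num.min 1 (e / (L + 1) / 2) <= L * (e / (L + 1) / 2).
  by rewrite ler_wpM2l // ge_min lexx orbT.
apply: le_lt_trans h1 _.
rewrite !mulrA ltr_pdivrMr // ltr_pdivrMr ?ltr_wpDl //.
nra.
Qed.

(** Induction on s: on the line from a point avoiding the zeros of the previous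
    functions to one where the next function does not vanish, all of them are
    nonzero polynomials in the parameter, and a small real parameter avoids
    their finitely many roots. *)
Lemma common_nonzero (J : eqType) (s : seq J) (E : J -> (I -> C) -> C) :
  (forall j x y, polyfun (fun r : R => r%:C%C)
     (fun r => E j (fun i => x i + r%:C%C * (y i - x i)))) ->
  (forall j, exists y, E j y != 0) ->
  forall x (e : R), 0 < e -> exists2 y,
    (forall i, nrm (y i - x i) < e) & forall j, j \in s -> E j y != 0.
Proof.
move=> hE ne0; elim: s => [|j s IH] x e e0.
  by exists x => // i; rewrite subrr nrm0.
have e2 : 0 < e / 2 by rewrite divr_gt0.
have [z zx zs] := IH x _ e2.
have [w wj] := ne0 j.
pose ln (r : R) i := z i + r%:C%C * (w i - z i).
have ln0 : ln 0 = z by apply/funext => i; rewrite /ln mul0r addr0.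
have ln1 : ln 1 = w by apply/funext => i; rewrite /ln mul1r addrC subrK.
have [p hp] : exists2 p : {poly C}, p != 0 & forall r : R, p.[r%:C%C] != 0 ->
    forall k, k \in j :: s -> E k (ln r) != 0.
  have {}hE k : {p : {poly C} | forall r : R, E k (ln r) = p.[r%:C%C]}.
    exact: cid (hE k z w).
  exists (\prod_(k <- j :: s) sval (hE k)).
    rewrite prodf_seq_neq0; apply/allP => k; rewrite inE => /orP[/eqP ->|ks] /=.
      apply: contra wj => /eqP p0; have := svalP (hE j) 1.
      by rewrite ln1 p0 horner0 => ->.
    apply: contra (zs k ks) => /eqP p0; have := svalP (hE k) 0.
    by rewrite ln0 p0 horner0 => ->.
  move=> r; rewrite horner_prod prodf_seq_neq0 => /allP h k /h /=.
  by rewrite (svalP (hE k)).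
move=> hp'.
have [D D0 hD] : exists2 D : R, 0 < D & forall i, nrm (w i - z i) <= D^-1.
  apply: (@fin_eps R I (fun d i => nrm (w i - z i) <= d^-1)).
    move=> d d' i /andP[d'0 d'd] /le_trans; apply.
    by rewrite lef_pV2 // posrE (lt_le_trans d'0).
  move=> i; exists (nrm (w i - z i) + 1)^-1.
    by rewrite invr_gt0 ltr_wpDl ?nrm_ge0.
  by rewrite invrK lerDl.
have [rs hrs] := closed_field_poly_normal p.
have rroot (r : R) : r%:C%C \notin rs -> p.[r%:C%C] != 0.
  apply: contra => /eqP pr.
  by rewrite -root_prod_XsubC -(rootZ _ _ (a := lead_coef p)) ?lead_coef_eq0 // -hrs rootE pr.
(* among the points (e/2) D / (k+1), infinitely many avoid the zeros *)
pose r k : R := (e / 2 * D) / k.+1%:R.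
have [|k hk] := @inj_avoid _ (fun k => (r k)%:C%C) rs.
  by move=> k l /complexI /harm_inj; apply; rewrite mulf_neq0 ?gt_eqF.
exists (ln (r k)); last exact: hp' (rroot _ hk).
move=> i; apply: le_lt_trans (nrm_trans _ (z i) _) _.
suff : nrm (ln (r k) i - z i) <= e / 2 by move: (zx i); lra.
rewrite /ln addrC addKr nrmM nrmR.
have k0 : 0 < (k.+1%:R : R) by [].
have h0 : 0 <= e / 2 * D / k.+1%:R by rewrite divr_ge0 ?mulr_ge0 ?ltW.
rewrite ger0_norm // /r.
have h1 : e / 2 * D / k.+1%:R <= e / 2 * D.
  by rewrite ler_pdivrMr // ler_peMr ?ler1n // mulr_ge0 // ltW.
have h2 : nrm (w i - z i) <= D^-1 := hD i.
apply: le_trans (ler_pM h0 (nrm_ge0 _) h1 h2) _.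
by rewrite mulfK // gt_eqF.
Qed.
End FunctionClasses.

(** * Continuity of simple roots *)

Section Roots.
Variable R : realType.
Local Notation C := R[i].

Lemma path_sep (n : nat) (X : topologicalType) (K : set X) (x : X -> 'I_n -> C) :
  compact K -> (forall j, cc (x^~ j)) -> (forall t, K t -> injective (x t)) ->
  exists2 e : R, 0 < e & forall t, K t -> forall i j, i != j ->
    e <= nrm (x t i - x t j).
Proof.
move=> cK xc xi.
have [||e e0 he] := @fin_eps R ('I_n * 'I_n)%type (fun e ij => forall t, K t ->
  ij.1 != ij.2 -> e <= nrm (x t ij.1 - x t ij.2)).
- by move=> e e' ij /andP[_ e'e] h t Kt /(h t Kt); apply: le_trans.
- move=> [i j] /=; have [->|ij] := eqVneq i j; first by exists 1.
  have [|t Kt|e e0 he] := cc_away0 (f := fun t => x t i - x t j) cK.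
  + exact: (falg_sub (@cc_falg R X)).
  + by rewrite subr_eq0; apply: contra ij => /eqP/(xi t Kt) ->.
  by exists e => // t /he.
by exists e => // t Kt i j; apply: (he (i, j)).
Qed.

Lemma config_sep (n : nat) (x : 'I_n -> C) : injective x ->
  exists2 e : R, 0 < e & forall i j, i != j -> e <= nrm (x i - x j).
Proof.
move=> xi; have [|||e e0 he] := @path_sep n R [set 0] (fun=> x).
- exact: compact_set1.
- by move=> j; apply: (falg_cst (@cc_falg R R)).
- by [].
by exists e => // i j; apply: (he 0).
Qed.

(** Otherwise every factor u - y_j has modulus at least e. *)
Lemma root_near n (y : 'I_n -> C) u (e : R) : 0 < e ->
  nrm (rpoly y).[u] < e ^+ n -> exists j, nrm (u - y j) < e.
Proof.
move=> e0; rewrite horner_rpoly nrm_prod => h.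
apply/not_existsP => far; move: h; apply/negP; rewrite -leNgt.
rewrite -[X in e ^+ X]card_ord -prodr_const; apply: ler_prod => j _.
by rewrite (ltW e0) /= leNgt; apply/negP/far.
Qed.

(** Every disc around a point x_j contains a root; the discs are disjoint, so
    that these are all the roots. *)
Lemma roots_near n (x : 'I_n -> C) (p : {poly C}) (e : R) : 0 < e ->
  p \is monic -> size p = n.+1 ->
  (forall i j, i != j -> 2 * e <= nrm (x i - x j)) ->
  (forall j, nrm p.[x j] < e ^+ n) ->
  exists2 y, p = rpoly y & forall j, nrm (y j - x j) < e.
Proof.
move=> e0 pm sp sep small.
have [y hy] := rpoly_split pm sp.
have h j : {k | nrm (x j - y k) < e}.
  apply: sigW; have := small j; rewrite hy => /(root_near e0) [k hk].
  by exists k.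
pose s j := sval (h j).
have si : injective s.
  move=> i j ij; apply/eqP; apply: contraT => /sep.
  have := nrm_trans (x i) (y (s i)) (x j).
  have := svalP (h i); have := svalP (h j).
  by rewrite -/(s i) -/(s j) -ij (nrm_distC (x j)); lra.
exists (y \o s); first by rewrite rpoly_perm.
by move=> j /=; rewrite nrm_distC; apply: (svalP (h j)).
Qed.

(** Each disc contains a single root, so that equal sets of roots are labelled
    alike. *)
Lemma rpoly_disc_eq n (x u v : 'I_n -> C) (e : R) :
  (forall i j, i != j -> 2 * e <= nrm (x i - x j)) ->
  (forall j, nrm (u j - x j) < e) -> (forall j, nrm (v j - x j) < e) ->
  rpoly u = rpoly v -> u = v.
Proof.
move=> sep hu hv uv; apply/funext => j.
have : (rpoly v).[u j] = 0 by rewrite -uv; apply/root_rpolyP; exists j.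
move/root_rpolyP => [k hk]; rewrite hk; congr v.
apply/eqP; apply: contraT => /sep.
have := nrm_trans (x k) (v k) (x j).
by have := hu j; have := hv k; rewrite (nrm_distC (x k) (v k)) hk; lra.
Qed.

(** The j-th moving disc contains a single root, labelled j. It is continuous:
    the value there of a polynomial at a nearby time is small, hence that
    polynomial has a root close by, which can only be the j-th one. *)
Lemma track_roots n (T : topologicalType) (x : T -> 'I_n -> C)
    (P : T -> {poly C}) (e : R) : 0 < e ->
  (forall j, cc (x^~ j)) -> (forall i, cc (fun t => (P t)`_i)) ->
  (forall t, P t \is monic) -> (forall t, size (P t) = n.+1) ->
  (forall t i j, i != j -> 4 * e <= nrm (x t i - x t j)) ->
  (forall t j, nrm (P t).[x t j] < e ^+ n) ->
  exists y : T -> 'I_n -> C, [/\ forall j, cc (y^~ j),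
    forall t, P t = rpoly (y t) & forall t j, nrm (y t j - x t j) < e].
Proof.
move=> e0 xc Pc Pm Ps sep small.
have /choice[y h] : forall t, exists y : 'I_n -> C,
    P t = rpoly y /\ forall j, nrm (y j - x t j) < e.
  move=> t; have [|y yP yx] := roots_near e0 (Pm t) (Ps t) _ (small t).
    by move=> i j ij; have := sep t i j ij; lra.
  by exists y.
have yP t : P t = rpoly (y t) := (h t).1.
have yx t i : nrm (y t i - x t i) < e := (h t).2 i.
exists y; split=> // j; apply/ccP => t0 eta eta0.
pose d := Num.min eta e; have d0 : 0 < d by rewrite lt_min eta0.
have ev : cc (fun t => (P t).[y t0 j]).
  apply: (@falg_horner _ _ _ _ n.+1 (fun=> y t0 j)) => //.
  - exact: cc_falg.
  - by move=> t; rewrite Ps.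
  - exact: (falg_cst (@cc_falg R T)).
have Pt0 : (P t0).[y t0 j] = 0 by rewrite yP; apply/root_rpolyP; exists j.
near=> t.
have : nrm ((P t).[y t0 j] - (P t0).[y t0 j]) < d ^+ n.
  by near: t; apply: (ccP _).1 => //; rewrite exprn_gt0.
rewrite Pt0 subr0 yP => /(root_near d0)[k hk].
have kj : k = j.
  apply/eqP; apply: contraT => /(sep t).
  have h1 : nrm (x t0 j - x t j) < e.
    by rewrite nrm_distC; near: t; apply: (ccP _).1.
  have := nrm_trans (x t k) (y t k) (x t j).
  have := nrm_trans (y t k) (y t0 j) (x t j).
  have := nrm_trans (y t0 j) (x t0 j) (x t j).
  have := yx t0 j; have := yx t k; rewrite (nrm_distC (x t k) (y t k)).
  have : nrm (y t k - y t0 j) < e.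
    by rewrite nrm_distC (lt_le_trans hk) // ge_min lexx orbT.
  by lra.
rewrite nrm_distC -[in y t j]kj (lt_le_trans hk) //.
by rewrite ge_min lexx.
Unshelve. all: by end_near.
Qed.

Definition clamp (a b t : R) : R := Num.max a (Num.min b t).

Lemma clamp_cont a b : continuous (clamp a b).
Proof.
move=> t; apply: (@continuous_max _ _ (fun=> a) (fun t => Num.min b t)).
  exact: cst_continuous.
apply: (@continuous_min _ _ (fun=> b) id); first exact: cst_continuous.
exact: cvg_id.
Qed.

Lemma clamp_in a b t : a <= b -> a <= clamp a b t <= b.
Proof.
by move=> ab; rewrite /clamp le_max lexx /= ge_max ab ge_min lexx.
Qed.

Lemma clamp_id a b t : a <= t <= b -> clamp a b t = t.
Proof.
move=> /andP[at_ tb]; rewrite /clamp (min_idPr tb).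
exact/max_idPr.
Qed.

Lemma clamp_le a b t : a <= b -> t <= a -> clamp a b t = a.
Proof.
move=> ab ta; apply/max_idPl.
by rewrite ge_min ta orbT.
Qed.

Lemma clamp_ge a b t : a <= b -> b <= t -> clamp a b t = b.
Proof.
by move=> ab bt; rewrite /clamp (min_idPl bt); apply/max_idPr.
Qed.

(** By compactness, the roots can be followed on all time intervals of some
    fixed length, starting from any labelling; the pieces are glued one after
    the other. *)
Lemma lift_roots_global n (P : R -> {poly C}) (x0 : 'I_n -> C) :
  (forall i, cc (fun t => (P t)`_i)) ->
  (forall t, exists2 x : 'I_n -> C, injective x & P t = rpoly x) ->
  P 0 = rpoly x0 ->
  exists y : R -> 'I_n -> C, [/\ forall j, cc (y^~ j), y 0 = x0 &
    forall t, 0 <= t <= 1 -> P t = rpoly (y t)].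
Proof.
move=> Pc Psimple P0.
have Ps t : size (P t) = n.+1 by have [x _ ->] := Psimple t; rewrite size_rpoly.
have Pm t : P t \is monic by have [x _ ->] := Psimple t; rewrite monic_rpoly.
pose Q d t := forall x0, P t = rpoly x0 -> exists y : R -> 'I_n -> C,
  [/\ forall j, cc (y^~ j), y t = x0 &
    forall t', `|t' - t| <= d -> P t' = rpoly (y t')].
have [||d d0 hd] := @compact_unif R R `[0, 1] Q (@segment_compact _ _ _).
- move=> d d' t /andP[_ d'd] h x hx; have [y [y1 y2 y3]] := h x hx.
  by exists y; split => // t' /le_trans/(_ d'd); apply: y3.
- move=> t0 _; have [x xi Px] := Psimple t0.
  have [e' e'0 sep] := config_sep xi.
  pose e := e' / 4; have e0 : 0 < e by rewrite divr_gt0.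
  have [d d0 hd] : exists2 d : R, 0 < d & forall j t, `|t0 - t| < d ->
      nrm (P t).[x j] < e ^+ n.
    apply: (@fin_eps R 'I_n (fun d j => forall t, `|t0 - t| < d ->
      nrm (P t).[x j] < e ^+ n)) => //.
      by move=> d d' j /andP[_ dd] h t /lt_le_trans/(_ dd); apply: h.
    move=> j; have ev : cc (fun t => (P t).[x j]).
      apply: (@falg_horner _ _ _ _ n.+1 (fun=> x j)) => //.
      - exact: cc_falg.
      - by move=> t; rewrite Ps.
      - exact: (falg_cst (@cc_falg R _)).
    have /nbhs_ballP[d /= d0 hd] := (ccP _).1 ev t0 (e ^+ n) (exprn_gt0 _ e0).
    exists d => // t /hd /=; rewrite [(P t0).[x j]](_ : _ = 0) ?subr0 //.
    by rewrite Px; apply/root_rpolyP; exists j.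
  have d2 : 0 < d / 2 by rewrite divr_gt0.
  pose P' t := P (clamp (t0 - d / 2) (t0 + d / 2) t).
  have ab : t0 - d / 2 <= t0 + d / 2 by lra.
  have [||||y [yc yP yx]] := @track_roots n R (fun=> x) P' e e0 _ _
      (fun t => Pm _) (fun t => Ps _).
  + by move=> j; apply: (falg_cst (@cc_falg R _)).
  + by move=> i; apply: (cc_comp (f := fun t => (P t)`_i)) => //; apply: clamp_cont.
  + by move=> _ i j /sep; rewrite /e; lra.
  + move=> t j; apply: hd; rewrite ltr_distl.
    by have := clamp_in t ab; lra.
  exists (d / 4); first by rewrite divr_gt0.
  apply/nbhs_ballP; exists (d / 4) => /=; first by rewrite divr_gt0.
  move=> t /= tt0 x1 Px1.
  have yP' t' : `|t' - t| <= d / 4 -> P t' = rpoly (y t').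
    move=> tt'; rewrite -yP /P' clamp_id //.
    by move: tt' tt0; rewrite /ball /= ler_distl ltr_distl; lra.
  have x1i : injective x1 by have [z zi] := Psimple t; rewrite Px1 => /esym/(rpoly_inj zi).
  have hyt : P t = rpoly (y t) by apply: yP'; rewrite subrr normr0; lra.
  have [s si hs] := rpoly_relabel x1i (etrans (esym Px1) hyt).
  exists (fun t j => y t (s j)); split => //; first by apply/funext => j; rewrite hs.
  by move=> t' /yP' ->; rewrite -(rpoly_perm (y t') si).
have H k : exists y : R -> 'I_n -> C, [/\ forall j, cc (y^~ j), y 0 = x0 &
    forall t, 0 <= t <= Num.min 1 (k%:R * d) -> P t = rpoly (y t)].
  elim: k => [|k [y [yc y0 yP]]].
    exists (fun=> x0); split => // [j|t].
      exact: (falg_cst (@cc_falg R _)).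
    rewrite mul0r le_min => /andP[t0 /andP[_ t0']].
    by rewrite (_ : t = 0) //; apply/eqP; rewrite eq_le t0 t0'.
  pose T := Num.min 1 (k%:R * d).
  have T0 : 0 <= T by rewrite le_min ler01 mulr_ge0 // ltW.
  have T1 : T <= 1 by rewrite ge_min lexx.
  have hT : P T = rpoly (y T) by apply: yP; rewrite T0 lexx.
  have T01 : `[0, 1]%classic T by rewrite /= in_itv /= T0.
  have [y' [y'c y'T y'P]] := hd T T01 (y T) hT.
  exists (fun t j => y (Num.min t T) j + (y' (Num.max t T) j - y T j)); split.
  - move=> j; apply: (falg_add (@cc_falg R R)).
      apply: (cc_comp (f := y^~ j)) (yc j) => t.
      apply: (@continuous_min _ _ id (fun=> T)); first exact: cvg_id.
      exact: cst_continuous.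
    apply: (falg_sub (@cc_falg R R)); last exact: (falg_cst (@cc_falg R R)).
    apply: (cc_comp (f := y'^~ j)) (y'c j) => t.
    apply: (@continuous_max _ _ id (fun=> T)); first exact: cvg_id.
    exact: cst_continuous.
  - by apply/funext => j; rewrite (min_idPl T0) (max_idPr T0) y'T subrr addr0 y0.
  - move=> t /andP[t0 tk]; have [tT|Tt] := leP t T.
      rewrite (yP t); last by rewrite t0.
      by congr rpoly; apply/funext => j; rewrite y'T subrr addr0.
    rewrite (y'P t); last first.
      rewrite ger0_norm ?subr_ge0; last exact: ltW.
      move: tk Tt; rewrite le_min /T => /andP[t1 tk].
      rewrite -natr1 mulrDl mul1r in tk.
      by have [kd|kd] := leP 1 (k%:R * d); lra.
    by congr rpoly; apply/funext => j; rewrite addrCA subrr addr0.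
have [k hk] : exists k, 1 <= k%:R * d.
  exists (Num.bound d^-1); rewrite -ler_pdivrMr // mul1r ltW //.
  by apply: archi_boundP; rewrite invr_ge0 ltW.
have [y [y1 y2 y3]] := H k; exists y; split => // t t01; apply: y3.
by rewrite (min_idPl hk).
Qed.

(** Clamping the time to [0, 1] extends the hypotheses to the whole line. *)
Lemma lift_roots n (P : R -> {poly C}) (x0 : 'I_n -> C) :
  (forall i, cc (fun t => (P t)`_i)) ->
  (forall t, 0 <= t <= 1 -> exists2 x : 'I_n -> C, injective x & P t = rpoly x) ->
  P 0 = rpoly x0 ->
  exists y : R -> 'I_n -> C, [/\ forall j, cc (y^~ j), y 0 = x0 &
    forall t, 0 <= t <= 1 -> P t = rpoly (y t)].
Proof.
move=> Pc Ps P0.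
have [|||y [y1 y2 y3]] := @lift_roots_global n (fun t => P (clamp 0 1 t)) x0.
- by move=> i; apply: (cc_comp (f := fun t => (P t)`_i)) => //; apply: clamp_cont.
- by move=> t; apply/Ps/clamp_in.
- by rewrite clamp_id ?lexx ?ler01.
by exists y; split => // t t01; rewrite -y3 // clamp_id.
Qed.
End Roots.

(** * Homotopies of braids relative to their endpoints *)

Notation I01 t := (0 <= t <= 1).

Section ContinuousMaps.
Variable R : realType.

Lemma cont_pair (T U V : topologicalType) (f : T -> U) (g : T -> V) :
  continuous f -> continuous g -> continuous (fun x => (f x, g x)).
Proof. by move=> cf cg x; apply: cvg_pair; [exact: cf|exact: cg]. Qed.

Lemma cont_comp (T U V : topologicalType) (f : T -> U) (g : U -> V) :
  continuous f -> continuous g -> continuous (fun x => g (f x)).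
Proof. by move=> cf cg x; apply: continuous_comp; [exact: cf|exact: cg]. Qed.

Lemma cont_fst (T U : topologicalType) : continuous (fun x : T * U => x.1).
Proof. by move=> x; apply: cvg_fst. Qed.

Lemma cont_snd (T U : topologicalType) : continuous (fun x : T * U => x.2).
Proof. by move=> x; apply: cvg_snd. Qed.

Lemma cont_add (T : topologicalType) (f g : T -> R) :
  continuous f -> continuous g -> continuous (fun x => f x + g x).
Proof. by move=> cf cg x; apply: cvgD; [exact: cf|exact: cg]. Qed.

Lemma cont_mul (T : topologicalType) (f g : T -> R) :
  continuous f -> continuous g -> continuous (fun x => f x * g x).
Proof. by move=> cf cg x; apply: cvgM; [exact: cf|exact: cg]. Qed.

Lemma cont_opp (T : topologicalType) (f : T -> R) :
  continuous f -> continuous (fun x => - f x).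
Proof. by move=> cf x; apply: cvgN; exact: cf. Qed.

Lemma cont_cst (T : topologicalType) (c : R) : continuous (fun _ : T => c).
Proof. exact: cst_continuous. Qed.

Lemma cont_id (T : topologicalType) : continuous (fun x : T => x).
Proof. by move=> x; exact: cvg_id. Qed.

Lemma cont_clamp (T : topologicalType) (f : T -> R) a b :
  continuous f -> continuous (fun x => clamp a b (f x)).
Proof. by move=> cf; apply: (cont_comp cf); exact: clamp_cont. Qed.

End ContinuousMaps.

Ltac cont := try assumption; lazymatch goal with
  | |- continuous (fun _ => ?c) => exact: cont_cst
  | |- continuous (fun x => x) => exact: cont_id
  | |- continuous (fun x => x.1) => exact: cont_fst
  | |- continuous (fun x => x.2) => exact: cont_snd
  | |- continuous (fun x => clamp _ _ (@?f x)) => apply: (cont_clamp (f := f)); cont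
  | |- continuous (fun x => (@?f x, @?g x)) => apply: (cont_pair (f := f) (g := g)); cont
  | |- continuous (fun x => @?f x + @?g x) => apply: (cont_add (f := f) (g := g)); cont
  | |- continuous (fun x => @?f x * @?g x) => apply: (cont_mul (f := f) (g := g)); cont
  | |- continuous (fun x => - @?f x) => apply: (cont_opp (f := f)); cont
  | |- _ => first [exact: cont_fst | exact: cont_snd | exact: cont_id | idtac]
  end.

Section Homotopy.
Variables (R : realType) (n : nat).
Local Notation C := R[i].
Local Notation path := (R -> 'I_n -> C).
Implicit Types z f g : path.

Definition cpath z := forall j, cc (z^~ j).
Definition ipath z := forall t, I01 t -> injective (z t).

(** Only continuity is required, so that homotopies can be glued freely;
    smoothness is restored when a homotopy is turned into a braid isotopy. *)
Definition homotopic z z' : Prop := exists K : R * R -> 'I_n -> C,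
  [/\ forall j, cc (K^~ j),
      forall s t, I01 s -> I01 t -> injective (K (s, t)),
      forall t, I01 t -> K (0, t) = z t,
      forall t, I01 t -> K (1, t) = z' t
    & forall s, I01 s -> K (s, 0) = z 0 /\ K (s, 1) = z 1].

Lemma I01_0 : I01 (0 : R). Proof. by rewrite lexx ler01. Qed.
Lemma I01_1 : I01 (1 : R). Proof. by rewrite lexx ler01. Qed.
Lemma I01_clamp (t : R) : I01 (clamp 0 1 t). Proof. exact/clamp_in/ler01. Qed.

Lemma c01_le (t : R) : t <= 0 -> clamp 0 1 t = 0.
Proof. exact/clamp_le/ler01. Qed.
Lemma c01_ge (t : R) : 1 <= t -> clamp 0 1 t = 1.
Proof. exact/clamp_ge/ler01. Qed.

(** The increment of the second homotopy is added to the first one, which is at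
    rest by then: this formula is continuous without case analysis. *)
Lemma hom_trans z z' z'' : homotopic z z' -> homotopic z' z'' -> homotopic z z''.
Proof.
move=> [K [Kc Ki K0 K1 Ke]] [L [Lc Li L0 L1 Le]].
pose H (x : R * R) j := K (clamp 0 1 (2 * x.1), x.2) j +
  (L (clamp 0 1 (2 * x.1 - 1), x.2) j - L (0, x.2) j).
have HK s t : I01 s -> I01 t -> s <= 1 / 2 -> H (s, t) = K (2 * s, t).
  move=> s01 t01 s2; apply/funext => j; rewrite /H /=.
  rewrite clamp_id; last lra.
  rewrite c01_le; last lra.
  by rewrite subrr addr0.
have HL s t : I01 s -> I01 t -> 1 / 2 <= s -> H (s, t) = L (2 * s - 1, t).
  move=> s01 t01 s2; apply/funext => j; rewrite /H /=.
  rewrite c01_ge; last lra.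
  rewrite clamp_id; last lra.
  by rewrite (K1 t t01) (L0 t t01) addrCA subrr addr0.
exists H; split.
- move=> j; apply: (falg_add (@cc_falg R _)); last apply: falg_sub.
  + by apply: (cc_comp (f := K^~ j)) (Kc j); cont.
  + exact: cc_falg.
  + by apply: (cc_comp (f := L^~ j)) (Lc j); cont.
  + by apply: (cc_comp (f := L^~ j)) (Lc j); cont.
- move=> s t s01 t01; have [s2|s2] := leP s (1 / 2).
    by rewrite HK //; apply: Ki => //; lra.
  by rewrite (HL s t s01 t01 (ltW s2)); apply: Li => //; lra.
- move=> t t01; rewrite (HK 0 t I01_0 t01); last lra.
  by rewrite mulr0 (K0 t t01).
- move=> t t01; rewrite (HL 1 t I01_1 t01); last lra.
  rewrite mulr1 (_ : 2 - 1 = 1 :> R); last lra.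
  by rewrite (L1 t t01).
- move=> s s01; have zz : z' 0 = z 0 /\ z' 1 = z 1.
    by have [<- <-] := Ke _ I01_1; rewrite !K1 ?I01_0 ?I01_1.
  have [s2|s2] := leP s (1 / 2).
    rewrite (HK s 0 s01 I01_0 s2) (HK s 1 s01 I01_1 s2).
    by apply: Ke; lra.
  rewrite (HL s 0 s01 I01_0 (ltW s2)) (HL s 1 s01 I01_1 (ltW s2)) -zz.1 -zz.2.
  by apply: Le; lra.
Qed.

(** Discs are convex, so that the points moving straight from z to z' stay in
    disjoint discs. *)
Lemma hom_disc (x z z' : path) (e : R) : cpath z -> cpath z' ->
  z 0 = z' 0 -> z 1 = z' 1 ->
  (forall t, I01 t -> forall i j, i != j -> 2 * e < nrm (x t i - x t j)) ->
  (forall t, I01 t -> forall j, nrm (z t j - x t j) <= e) ->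
  (forall t, I01 t -> forall j, nrm (z' t j - x t j) <= e) ->
  homotopic z z'.
Proof.
move=> zc zc' z0 z1 sep zx zx'.
pose K (p : R * R) j := (1 - p.1)%:C%C * z p.2 j + p.1%:C%C * z' p.2 j.
have Kx s t j : I01 s -> I01 t -> nrm (K (s, t) j - x t j) <= e.
  by move=> s01 t01; apply: nrm_convex => //; [apply: zx|apply: zx'].
exists K; split.
- move=> j; apply: (falg_add (@cc_falg R _)); apply: (falg_mul (@cc_falg R _)).
  + by apply: cc_real; cont.
  + by apply: (cc_comp (f := z^~ j)) (zc j); cont.
  + by apply: cc_real; cont.
  + by apply: (cc_comp (f := z'^~ j)) (zc' j); cont.
- move=> s t s01 t01 i j Kij; apply/eqP; apply: contraT => /(sep t t01).
  have := nrm_trans (x t i) (K (s, t) i) (x t j).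
  have := Kx s t i s01 t01; have := Kx s t j s01 t01.
  by rewrite (nrm_distC (x t i) (K _ _)) Kij; lra.
- by move=> t t01; apply/funext => j; rewrite /K /= subr0 mul1r mul0r addr0.
- by move=> t t01; apply/funext => j; rewrite /K /= subrr mul1r mul0r add0r.
- move=> s s01; split; apply/funext => j; rewrite /K /=.
    by rewrite -z0 -mulrDl -rmorphD /= subrK mul1r.
  by rewrite -z1 -mulrDl -rmorphD /= subrK mul1r.
Qed.

(** The two parametrisations are joined by a straight line. *)
Lemma hom_reparam z (phi psi : R -> R) : cpath z -> ipath z ->
  continuous phi -> continuous psi ->
  (forall t, I01 t -> I01 (phi t)) -> (forall t, I01 t -> I01 (psi t)) ->
  phi 0 = psi 0 -> phi 1 = psi 1 ->
  homotopic (fun t => z (phi t)) (fun t => z (psi t)).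
Proof.
move=> zc zi pc qc p01 q01 pq0 pq1.
exists (fun x => z ((1 - x.1) * phi x.2 + x.1 * psi x.2)); split.
- move=> j; apply: (cc_comp (f := z^~ j)) (zc j).
  apply: cont_add; apply: cont_mul; cont.
    exact: (cont_comp (@cont_snd _ _) pc).
  exact: (cont_comp (@cont_snd _ _) qc).
- move=> s t s01 t01; apply: zi => /=.
  by have := p01 t t01; have := q01 t t01; nra.
- by move=> t _; rewrite /= subr0 mul1r mul0r addr0.
- by move=> t _; rewrite /= subrr mul1r mul0r add0r.
- by move=> s _; rewrite /= -pq0 -pq1 -!mulrDl !subrK !mul1r.
Qed.

Lemma hom_ext z z' w w' : (forall t, I01 t -> z t = w t) ->
  (forall t, I01 t -> z' t = w' t) -> homotopic z z' -> homotopic w w'.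
Proof.
move=> zw zw' [K [Kc Ki K0 K1 Ke]]; exists K; split => //.
- by move=> t t01; rewrite -zw // K0.
- by move=> t t01; rewrite -zw' // K1.
- by move=> s s01; rewrite -!zw ?I01_0 ?I01_1 //; apply: Ke.
Qed.

Lemma hom_refl z : cpath z -> ipath z -> homotopic z z.
Proof.
by move=> zc zi; apply: (@hom_reparam z id id) => //; exact: cont_id.
Qed.

Lemma hom_endpoints z z' : homotopic z z' -> z' 0 = z 0 /\ z' 1 = z 1.
Proof.
move=> [K [Kc Ki K0 K1 Ke]]; have [<- <-] := Ke _ I01_1.
by rewrite !K1 ?I01_0 ?I01_1.
Qed.

(** One of the two summands is always at rest, so that continuity needs no case
    analysis. *)
Definition pcat f g : path := fun t j =>
  f (clamp 0 1 (2 * t)) j + (g (clamp 0 1 (2 * t - 1)) j - g 0 j).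

Definition backward f : path := fun t => f (1 - t).

Lemma pcat_l f g t : 0 <= t <= 1 / 2 -> pcat f g t = f (2 * t).
Proof.
move=> t01; apply/funext => j; rewrite /pcat clamp_id; last lra.
rewrite c01_le; last lra.
by rewrite subrr addr0.
Qed.

Lemma pcat_r f g t : f 1 = g 0 -> 1 / 2 <= t <= 1 -> pcat f g t = g (2 * t - 1).
Proof.
move=> fg t01; apply/funext => j; rewrite /pcat c01_ge; last lra.
rewrite clamp_id; last lra.
by rewrite fg addrCA subrr addr0.
Qed.

Lemma pcat0 f g : pcat f g 0 = f 0.
Proof. by rewrite pcat_l ?mulr0 //; lra. Qed.

Lemma pcat1 f g : f 1 = g 0 -> pcat f g 1 = g 1.
Proof.
move=> fg; rewrite pcat_r //; last lra.
by rewrite mulr1 (_ : 2 - 1 = 1 :> R) //; lra.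
Qed.

Lemma cpath_cat f g : cpath f -> cpath g -> cpath (pcat f g).
Proof.
move=> fc gc j; apply: (falg_add (@cc_falg R _)); last apply: falg_sub.
- by apply: (cc_comp (f := f^~ j)) (fc j); cont.
- exact: cc_falg.
- by apply: (cc_comp (f := g^~ j)) (gc j); cont.
- exact: (falg_cst (@cc_falg R _)).
Qed.

Lemma pcat_all f g (P : ('I_n -> C) -> Prop) : f 1 = g 0 ->
  (forall t, I01 t -> P (f t)) -> (forall t, I01 t -> P (g t)) ->
  forall t, I01 t -> P (pcat f g t).
Proof.
move=> fg Pf Pg t t01; have [t2|t2] := leP t (1 / 2).
  by rewrite pcat_l; [apply: Pf; lra|lra].
by rewrite pcat_r //; [apply: Pg; lra|lra].
Qed.

Lemma cpath_backward f : cpath f -> cpath (backward f).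
Proof. by move=> fc j; apply: (cc_comp (f := f^~ j)) (fc j); cont. Qed.

Lemma cpath_cst (x : 'I_n -> C) : cpath (fun=> x).
Proof. by move=> j; exact: (falg_cst (@cc_falg R _)). Qed.

Lemma hom_cat f f' g g' : f 1 = g 0 -> homotopic f f' -> homotopic g g' ->
  homotopic (pcat f g) (pcat f' g').
Proof.
move=> fg hf hg; have [f'0 f'1] := hom_endpoints hf.
have [g'0 _] := hom_endpoints hg.
move: hf hg => [K [Kc Ki K0 K1 Ke]] [L [Lc Li L0 L1 Le]].
pose H (x : R * R) j := K (x.1, clamp 0 1 (2 * x.2)) j +
  (L (x.1, clamp 0 1 (2 * x.2 - 1)) j - g 0 j).
have HK s t : I01 s -> 0 <= t <= 1 / 2 -> H (s, t) = K (s, 2 * t).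
  move=> s01 t2; apply/funext => j; rewrite /H /= clamp_id; last lra.
  rewrite c01_le; last lra.
  by rewrite (Le s s01).1 subrr addr0.
have HL s t : I01 s -> 1 / 2 <= t <= 1 -> H (s, t) = L (s, 2 * t - 1).
  move=> s01 t2; apply/funext => j; rewrite /H /= c01_ge; last lra.
  rewrite clamp_id; last lra.
  by rewrite (Ke s s01).2 fg addrCA subrr addr0.
exists H; split.
- move=> j; apply: (falg_add (@cc_falg R _)); last apply: falg_sub.
  + by apply: (cc_comp (f := K^~ j)) (Kc j); cont.
  + exact: cc_falg.
  + by apply: (cc_comp (f := L^~ j)) (Lc j); cont.
  + exact: (falg_cst (@cc_falg R _)).
- move=> s t s01 t01; have [t2|t2] := leP t (1 / 2).
    by rewrite HK //; [apply: Ki => //; lra|lra].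
  by rewrite HL //; [apply: Li => //; lra|lra].
- move=> t t01; have [t2|t2] := leP t (1 / 2).
    by rewrite HK ?I01_0 // ?pcat_l ?K0 //; lra.
  by rewrite HL ?I01_0 // ?pcat_r ?L0 //; lra.
- move=> t t01; have [t2|t2] := leP t (1 / 2).
    by rewrite HK ?I01_1 // ?pcat_l ?K1 //; lra.
  rewrite (HL 1 t I01_1); last lra.
  rewrite pcat_r; [|by rewrite f'1 g'0|lra].
  by rewrite L1 //; lra.
- move=> s s01; rewrite pcat0 pcat1 // (HK s 0 s01); last lra.
  rewrite (HL s 1 s01); last lra.
  rewrite mulr0 mulr1 (_ : 2 - 1 = 1 :> R); last lra.
  by rewrite (Ke s s01).1 (Le s s01).2.
Qed.

Lemma hom_cat_cst_l g : cpath g -> ipath g -> homotopic (pcat (fun=> g 0) g) g.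
Proof.
move=> gc gi.
have := @hom_reparam g (fun t => clamp 0 1 (2 * t - 1)) id gc gi.
move=> H; apply: hom_ext (H _ _ _ _ _ _) => //.
- by move=> t _; apply/funext => j; rewrite /pcat addrCA subrr addr0.
- by cont.
- by cont.
- by move=> t _; apply: I01_clamp.
- by rewrite c01_le //; lra.
- by rewrite c01_ge //; lra.
Qed.

Lemma hom_cat_cst_r f : cpath f -> ipath f -> homotopic (pcat f (fun=> f 1)) f.
Proof.
move=> fc fi.
have := @hom_reparam f (fun t => clamp 0 1 (2 * t)) id fc fi.
move=> H; apply: hom_ext (H _ _ _ _ _ _) => //.
- by move=> t _; apply/funext => j; rewrite /pcat subrr addr0.
- by cont.
- by cont.
- by move=> t _; apply: I01_clamp.
- by rewrite clamp_id //; lra.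
- by rewrite c01_ge //; lra.
Qed.

Lemma hom_cat_backward f : cpath f -> ipath f -> homotopic (pcat f (backward f)) (fun=> f 0).
Proof.
move=> fc fi.
have := @hom_reparam f (fun t => clamp 0 1 (2 * t) - clamp 0 1 (2 * t - 1))
  (fun=> 0) fc fi.
move=> H; apply: hom_ext (H _ _ _ _ _ _) => //.
- move=> t t01; have [t2|t2] := leP t (1 / 2).
    rewrite pcat_l; last lra.
    by rewrite clamp_id ?c01_le ?subr0 //; lra.
  rewrite pcat_r; [|by rewrite /backward subr0|lra].
  by rewrite c01_ge ?clamp_id //; lra.
- by cont.
- by cont.
- move=> t t01; have [t2|t2] := leP t (1 / 2).
    by rewrite clamp_id ?c01_le ?subr0 //; lra.
  by rewrite c01_ge ?clamp_id //; lra.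
- by move=> t _; rewrite lexx ler01.
- by rewrite clamp_id ?c01_le ?mulr0 ?subr0 //; lra.
- by rewrite !c01_ge ?subrr //; lra.
Qed.

(** During the first three quarters of the time f is run forth and back;
    shrinking its parameter to 0 contracts this part, and g is run during the
    last quarter throughout. *)
Lemma hom_cancel f g : cpath f -> ipath f -> cpath g -> ipath g -> f 0 = g 0 ->
  homotopic (pcat f (pcat (backward f) g)) g.
Proof.
move=> fc fi gc gi fg.
pose tau (t : R) := clamp 0 1 (2 * t) - clamp 0 1 (4 * t - 2).
pose gam (t : R) := clamp 0 1 (4 * t - 3).
have tau01 t : I01 (tau t).
  have [t2|t2] := leP t (1 / 2).
    by have := I01_clamp (2 * t); rewrite /tau (@c01_le (_ - _)) //; lra.
  rewrite /tau (@c01_ge (2 * t)); last lra.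
  by have := I01_clamp (4 * t - 2); lra.
have tau0 t : I01 t -> 3 / 4 <= t -> tau t = 0.
  by move=> t01 t3; rewrite /tau !c01_ge ?subrr //; lra.
have gam0 t : I01 t -> t <= 3 / 4 -> gam t = 0.
  by move=> t01 t3; rewrite /gam c01_le //; lra.
have pfg : backward f 1 = g 0 by rewrite /backward subrr.
have fpg : f 1 = pcat (backward f) g 0 by rewrite pcat0 /backward subr0.
pose H (x : R * R) j := f ((1 - x.1) * tau x.2) j + (g (gam x.2) j - g 0 j).
have H1 s t : I01 t -> t <= 3 / 4 -> H (s, t) = f ((1 - s) * tau t).
  by move=> t01 t3; apply/funext => j; rewrite /H /= gam0 // subrr addr0.
have H2 s t : I01 t -> 3 / 4 <= t -> H (s, t) = g (gam t).
  move=> t01 t3; apply/funext => j.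
  by rewrite /H /= tau0 // mulr0 fg addrCA subrr addr0.
apply: hom_trans (_ : homotopic (fun t => g (gam t)) g); last first.
  apply: (@hom_reparam g gam id) => //; rewrite /gam; cont.
  - by move=> t _; apply: I01_clamp.
  - by rewrite c01_le //; lra.
  - by rewrite c01_ge //; lra.
exists H; split.
- move=> j; apply: (falg_add (@cc_falg R _)); last apply: falg_sub.
  + by apply: (cc_comp (f := f^~ j)) (fc j); rewrite /tau; cont.
  + exact: cc_falg.
  + by apply: (cc_comp (f := g^~ j)) (gc j); rewrite /gam; cont.
  + exact: (falg_cst (@cc_falg R _)).
- move=> s t s01 t01; have [t3|t3] := leP t (3 / 4).
    by rewrite (H1 s t t01 t3); apply: fi; have := tau01 t; nra.
  by rewrite (H2 s t t01 (ltW t3)); apply: gi; apply: I01_clamp.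
- move=> t t01; have [t3|t3] := leP t (3 / 4); last first.
    rewrite (H2 0 t t01 (ltW t3)) pcat_r //; last lra.
    rewrite pcat_r //; last lra.
    by rewrite /gam clamp_id; [congr g; lra|lra].
  rewrite (H1 0 t t01 t3) subr0 mul1r; have [t2|t2] := leP t (1 / 2).
    rewrite pcat_l; last lra.
    by rewrite /tau clamp_id ?c01_le ?subr0 //; lra.
  rewrite pcat_r //; last lra.
  rewrite pcat_l; last lra.
  by rewrite /backward /tau c01_ge ?clamp_id //; [congr f; lra|lra|lra].
- move=> t t01; have [t3|t3] := leP t (3 / 4); last by rewrite (H2 1 t t01 (ltW t3)).
  by rewrite (H1 1 t t01 t3) subrr mul0r gam0 // fg.
- move=> s s01; rewrite pcat0 pcat1 // pcat1 //.
  rewrite (H1 s 0 I01_0); last lra.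
  rewrite (H2 s 1 I01_1); last lra.
  have -> : tau 0 = 0 by rewrite /tau clamp_id ?c01_le ?mulr0 ?subr0 //; lra.
  have -> : gam 1 = 1 by rewrite /gam c01_ge //; lra.
  by rewrite mulr0.
Qed.

End Homotopy.

(** * Smooth functions *)

Section Smooth.
Variable R : realType.
Local Notation C := R[i].

Definition smooth (f : R -> R) : Prop :=
  forall (k : nat) (t : R), derivable (derive1n k f) t 1.

(** The iterated derivatives all stay in the class S. *)
Lemma smooth_class (S : (R -> R) -> Prop) :
  (forall f, S f -> exists2 f', S f' & forall t : R, is_derive t 1 f (f' t)) ->
  forall f, S f -> smooth f.
Proof.
move=> hS f Sf; have Sk k : S (derive1n k f).
  elim: k => [//|k IH]; have [f' Sf' hf'] := hS _ IH.
  rewrite derive1nS (_ : derive1 _ = f') //.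
  by apply/funext => t; rewrite derive1E; have [_ ->] := hf' t.
by move=> k t; have [f' _ /(_ t)[]] := hS _ (Sk k).
Qed.

Lemma smooth_derive f : smooth f ->
  exists2 f', smooth f' & forall t : R, is_derive t 1 f (f' t).
Proof.
move=> sf; exists (derive1 f).
  by move=> k t; have := sf k.+1 t; rewrite derive1Sn.
by move=> t; apply: DeriveDef; [exact: (sf 0)|rewrite derive1E].
Qed.

Definition cder (f f' : R -> C) : Prop := forall t : R,
  is_derive t 1 (fun t => complex.Re (f t)) (complex.Re (f' t)) /\
  is_derive t 1 (fun t => complex.Im (f t)) (complex.Im (f' t)).

Definition csmooth (f : R -> C) : Prop :=
  smooth (fun t => complex.Re (f t)) /\ smooth (fun t => complex.Im (f t)).

Lemma csmooth_class (S : (R -> C) -> Prop) :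
  (forall f, S f -> exists2 f', S f' & cder f f') -> forall f, S f -> csmooth f.
Proof.
move=> hS f Sf.
pose S' (h : R -> R) := exists2 f, S f & h = (fun t => complex.Re (f t)) \/
  h = (fun t => complex.Im (f t)).
have cS h : S' h -> smooth h.
  apply: smooth_class => {}h [g Sg hg]; have [g' Sg' gg'] := hS _ Sg.
  case: hg => ->.
    exists (fun t => complex.Re (g' t)); first by exists g' => //; left.
    by move=> t; apply: (gg' t).1.
  exists (fun t => complex.Im (g' t)); first by exists g' => //; right.
  by move=> t; apply: (gg' t).2.
by split; apply: cS; exists f => //; [left|right].
Qed.

Lemma csmooth_cder f : csmooth f -> exists2 f', csmooth f' & cder f f'.
Proof.
move=> [/smooth_derive[a sa ha] /smooth_derive[b sb hb]].
exists (fun t => Complex (a t) (b t)); first exact: (conj sa sb).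
by move=> t; split; [exact: ha|exact: hb].
Qed.

Lemma cder_cst c : cder (fun=> c) (fun=> 0).
Proof. by move=> t; split; apply: is_derive_cst. Qed.

Lemma cder_add f g f' g' : cder f f' -> cder g g' ->
  cder (fun t => f t + g t) (fun t => f' t + g' t).
Proof.
move=> hf hg t; have [f1 f2] := hf t; have [g1 g2] := hg t.
split.
  rewrite cReD (_ : (fun _ => _) =
    (fun t => complex.Re (f t)) + (fun t => complex.Re (g t))).
    exact: is_deriveD.
  by apply/funext => x; rewrite cReD.
rewrite cImD (_ : (fun _ => _) =
  (fun t => complex.Im (f t)) + (fun t => complex.Im (g t))).
  exact: is_deriveD.
by apply/funext => x; rewrite cImD.
Qed.

Lemma cder_mul f g f' g' : cder f f' -> cder g g' ->
  cder (fun t => f t * g t) (fun t => f' t * g t + f t * g' t).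
Proof.
move=> hf hg t; have [f1 f2] := hf t; have [g1 g2] := hg t.
split.
  rewrite (_ : (fun _ => _) =
    (fun t => complex.Re (f t)) * (fun t => complex.Re (g t)) -
    (fun t => complex.Im (f t)) * (fun t => complex.Im (g t))); last first.
    by apply/funext => x; rewrite cReM.
  have h := is_deriveB (is_deriveM f1 g1) (is_deriveM f2 g2).
  apply: (@is_derive_eq _ _ _ _ _ _ _ _ h); rewrite !cReD !cReM /GRing.scale /=; ring.
rewrite (_ : (fun _ => _) =
  (fun t => complex.Re (f t)) * (fun t => complex.Im (g t)) +
  (fun t => complex.Im (f t)) * (fun t => complex.Re (g t))); last first.
  by apply/funext => x; rewrite cImM.
have h := is_deriveD (is_deriveM f1 g2) (is_deriveM f2 g1).
apply: (@is_derive_eq _ _ _ _ _ _ _ _ h); rewrite !cImD !cImM /GRing.scale /=; ring.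
Qed.

(** Caratheodory's form of derivability, which needs no division by x - t:
    quotients can be handled by the limit theorems for continuous functions. *)
Lemma cder_caratheodory f f' : cder f f' <-> forall t, exists g : R -> C,
  [/\ forall x, f x - f t = (x - t)%:C%C * g x, ccvg (nbhs t) g (g t) &
      g t = f' t].
Proof.
split.
  move=> h t; have [/is_derive1_caratheodory[a [a1 a2 a3]]
    /is_derive1_caratheodory[b [b1 b2 b3]]] := h t.
  exists (fun x => Complex (a x) (b x)); split.
  - move=> x; apply: complex_ext.
      by rewrite cReZ cReD cReN a1 /= mulrC.
    by rewrite cImZ cImD cImN b1 /= mulrC.
  - by split.
  - by apply: complex_ext; rewrite /= ?a3 ?b3.
move=> h t; have [g [g1 [g2 g3] g4]] := h t.
split; apply/is_derive1_caratheodory.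
  exists (fun x => complex.Re (g x)); split => //; last by rewrite g4.
  by move=> x; rewrite -cReN -cReD g1 cReZ mulrC.
exists (fun x => complex.Im (g x)); split => //; last by rewrite g4.
by move=> x; rewrite -cImN -cImD g1 cImZ mulrC.
Qed.

Lemma cder_cc f f' : cder f f' -> cc f.
Proof.
move=> /cder_caratheodory h; apply/ccE => t; have [g [g1 g2 _]] := h t.
have : ccvg (nbhs t) (fun x => f t + (x - t)%:C%C * g x) (f t + (t - t)%:C%C * g t).
  apply: ccvgD; first exact: ccvg_cst.
  apply: ccvgM => //; have : cc (fun x : R => (x - t)%:C%C).
    by apply: cc_real; cont.
  by move/ccE/(_ t).
rewrite subrr mul0r addr0 (_ : (fun x => _) = f) //.
by apply/funext => x; rewrite -g1 addrC subrK.
Qed.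

Lemma cder_inv f f' : (forall t, f t != 0) -> cder f f' ->
  cder (fun t => (f t)^-1) (fun t => - f' t * ((f t)^-1 * (f t)^-1)).
Proof.
move=> f0 hf; have /ccE fc := cder_cc hf.
apply/cder_caratheodory => t; have [g [g1 g2 g3]] := (cder_caratheodory _ _).1 hf t.
exists (fun x => - g x * ((f x)^-1 * (f t)^-1)); split.
- move=> x; have -> : (f x)^-1 - (f t)^-1 = - (f x - f t) * ((f x)^-1 * (f t)^-1).
    by field; rewrite !f0.
  by rewrite g1; ring.
- apply: ccvgM; first exact: ccvgN.
  by apply: ccvgM; [exact: ccvgV|exact: ccvg_cst].
- by rewrite g3.
Qed.

(** If the derivatives of the generators lie in the generated algebra, then so
    do all iterated derivatives, and the generators are smooth. This is how
    functions given implicitly are shown to be smooth. *)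
Inductive gen (B : (R -> C) -> Prop) : (R -> C) -> Prop :=
| gen_base f : B f -> gen B f
| gen_cst c : gen B (fun=> c)
| gen_add f g : gen B f -> gen B g -> gen B (fun t => f t + g t)
| gen_mul f g : gen B f -> gen B g -> gen B (fun t => f t * g t).

Lemma gen_falg B : falg (gen B).
Proof.
split; [exact: gen_cst|by move=> *; apply: gen_add|by move=> *; apply: gen_mul].
Qed.

Lemma gen_mono (B B' : (R -> C) -> Prop) : (forall f, B f -> B' f) ->
  forall f, gen B f -> gen B' f.
Proof.
move=> BB' f; elim=> {f} [f Bf|c|f g _ h1 _ h2|f g _ h1 _ h2].
- exact/gen_base/BB'.
- exact: gen_cst.
- exact: gen_add.
- exact: gen_mul.
Qed.

Lemma gen_cder (B B' : (R -> C) -> Prop) : (forall f, B f -> B' f) ->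
  (forall f, B f -> exists2 f', gen B' f' & cder f f') ->
  forall f, gen B f -> exists2 f', gen B' f' & cder f f'.
Proof.
move=> BB' hB f; elim=> {f} [f Bf|c|f g _ [f' f1 f2] _ [g' g1 g2]|
  f g gf [f' f1 f2] gg [g' g1 g2]].
- exact: hB.
- by exists (fun=> 0); [exact: gen_cst|exact: cder_cst].
- exists (fun t => f' t + g' t); [exact: gen_add|exact: cder_add].
- exists (fun t => f' t * g t + f t * g' t); last exact: cder_mul.
  by apply: gen_add; apply: gen_mul => //; apply: (gen_mono BB').
Qed.

Lemma gen_csmooth (B : (R -> C) -> Prop) :
  (forall f, B f -> exists2 f', gen B f' & cder f f') ->
  forall f, gen B f -> csmooth f.
Proof. by move=> hB; apply: csmooth_class; apply: gen_cder. Qed.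

Lemma gen_csmooth_id f : gen csmooth f -> csmooth f.
Proof.
apply: gen_csmooth => {}f /csmooth_cder[f' sf' ff'].
by exists f' => //; apply: gen_base.
Qed.

Lemma csmooth_falg : falg csmooth.
Proof.
split.
- by move=> c; apply/gen_csmooth_id/gen_cst.
- by move=> f g sf sg; apply/gen_csmooth_id/gen_add; apply: gen_base.
- by move=> f g sf sg; apply/gen_csmooth_id/gen_mul; apply: gen_base.
Qed.

Lemma csmooth_cc f : csmooth f -> cc f.
Proof. by move=> /csmooth_cder[f' _ /cder_cc]. Qed.

(** The derivative of 1 / f is a polynomial in f' and 1 / f. *)
Lemma csmooth_inv f : (forall t, f t != 0) -> csmooth f ->
  csmooth (fun t => (f t)^-1).
Proof.
move=> f0 sf; pose B g := csmooth g \/ g = (fun t => (f t)^-1).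
apply: (gen_csmooth (B := B)); last by apply: gen_base; right.
move=> g [/csmooth_cder[g' sg' gg']|->].
  by exists g' => //; apply: gen_base; left.
have [f' sf' ff'] := csmooth_cder sf.
exists (fun t => - f' t * ((f t)^-1 * (f t)^-1)); last exact: cder_inv.
have gi : gen B (fun t => (f t)^-1) by apply: gen_base; right.
apply: gen_mul; last exact: gen_mul.
by apply: (falg_opp (gen_falg B)); apply: gen_base; left.
Qed.

Lemma smooth_affine (f : R -> R) a b : smooth f -> smooth (fun t => f (a * t + b)).
Proof.
move=> sf; pose S h := exists r f, smooth f /\ h = fun t => r * f (a * t + b).
apply: (smooth_class (S := S)); last first.
  by exists 1, f; split => //; apply/funext => t; rewrite mul1r.
move=> _ [r [g [sg ->]]]; have [g' sg' gg'] := smooth_derive sg.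
exists (fun t => r * a * g' (a * t + b)); first by exists (r * a), g'.
move=> t; have h1 : is_derive t 1 (fun t : R => a * t + b) a.
  rewrite (_ : (fun _ => _) = (fun t : R => a *: id t) + cst b); last first.
    by apply/funext => x.
  by apply: is_derive_eq; rewrite addr0 [LHS]mulr1.
have h2 := @is_derive1_comp _ g (fun t => a * t + b) t _ _ (gg' (a * t + b)) h1.
rewrite (_ : (fun _ => _) = r *: (g \o (fun t => a * t + b))); last by apply/funext.
by apply: is_derive_eq; rewrite /GRing.scale /=; ring.
Qed.

Lemma size_deriv_le (p : {poly C}) d : (size p <= d.+1)%N -> (size p^`() <= d)%N.
Proof.
move=> sp; apply/leq_sizeP => j dj.
by rewrite coef_deriv nth_default ?mul0rn // (leq_trans sp).
Qed.

(** Simple roots of a smooth family of polynomials are smooth: the derivative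
    given by the implicit function theorem is a rational expression in the root
    and in smooth functions. *)
Lemma root_smooth (P : R -> {poly C}) (d : nat) (z : R -> C) :
  (forall t, (size (P t) <= d.+1)%N) -> (forall i, csmooth (fun t => (P t)`_i)) ->
  cc z -> (forall t, (P t).[z t] = 0) -> (forall t, (P t)^`().[z t] != 0) ->
  csmooth z.
Proof.
move=> sP Psm zc Pz P'z.
have /choice[a' ha'] : forall i, exists f', csmooth f' /\ cder (fun t => (P t)`_i) f'.
  by move=> i; have [f' ? ?] := csmooth_cder (Psm i); exists f'.
pose dz t := - (\sum_(i < d.+1) a' i t * z t ^+ i) * ((P t)^`().[z t])^-1.
have zdz : cder z dz.
  apply/cder_caratheodory => t0.
  have /choice[al hal] : forall i, exists g : R -> C,
    [/\ forall x, (P x)`_i - (P t0)`_i = (x - t0)%:C%C * g x,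
        ccvg (nbhs t0) g (g t0) & g t0 = a' i t0].
    by move=> i; apply: ((cder_caratheodory _ _).1 (ha' i).2 t0).
  (* P_x (z x) and P_t0 (z t0) vanish, so the variation of the root at fixed
     polynomial cancels that of the polynomial at fixed root; D and E are the two
     difference quotients *)
  pose D x := \sum_(i < d.+1) (P x)`_i * \sum_(k < i) z x ^+ (i.-1 - k) * z t0 ^+ k.
  pose E x := \sum_(i < d.+1) al i x * z t0 ^+ i.
  have DE x : (z x - z t0) * D x = - ((x - t0)%:C%C * E x).
    have h1 : (P x).[z x] - (P x).[z t0] = (z x - z t0) * D x.
      rewrite !(horner_coef_wide _ (sP x)) -sumrB /D mulr_sumr.
      by apply: eq_bigr => i _; rewrite -mulrBr subrXX mulrCA.
    have h2 : (P x).[z t0] - (P t0).[z t0] = (x - t0)%:C%C * E x.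
      rewrite (horner_coef_wide _ (sP x)) (horner_coef_wide _ (sP t0)) -sumrB.
      rewrite /E mulr_sumr; apply: eq_bigr => i _; rewrite -mulrBl.
      by have [-> _ _] := hal i; rewrite mulrA.
    by rewrite -h1 -h2 !Pz; ring.
  have Dt0 : D t0 = (P t0)^`().[z t0].
    have -> : D t0 = \sum_(i < d.+1) (P t0)`_i *+ i * z t0 ^+ i.-1.
      apply: eq_bigr => -[i id] _ /=; rewrite mulrnAl -mulrnAr; congr (_ * _).
      rewrite -[X in _ *+ X]card_ord -sumr_const; apply: eq_bigr => -[k ki] _ /=.
      by rewrite -exprD subnK // -ltnS (ltn_predK ki).
    rewrite (@horner_coef_wide _ d) ?size_deriv_le //.
    rewrite big_ord_recl mulr0n mul0r add0r; apply: eq_bigr => i _.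
    by rewrite coef_deriv.
  have Dc : ccvg (nbhs t0) D (D t0).
    suff /ccE : cc D by apply.
    have fa := @cc_falg R R.
    apply: (falg_sum fa) => i; apply: (falg_mul fa); first exact: csmooth_cc.
    apply: (falg_sum fa) => k; apply: (falg_mul fa).
      exact: (falg_exp fa).
    exact: (falg_cst fa).
  have Ec : ccvg (nbhs t0) E (E t0).
    rewrite /E; elim: (index_enum _) => [|i s IH].
      rewrite big_nil (_ : (fun _ => _) = fun=> 0); first exact: ccvg_cst.
      by apply/funext => x; rewrite big_nil.
    rewrite big_cons (_ : (fun _ => _) = fun x => al i x * z t0 ^+ i +
      \sum_(j <- s) al j x * z t0 ^+ j); last by apply/funext => x; rewrite big_cons.
    apply: ccvgD IH; apply: ccvgM; last exact: ccvg_cst.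
    by have [] := hal i.
  have D0 : D t0 != 0 by rewrite Dt0.
  pose h x := - E x * (D x)^-1.
  pose g x := if D x == 0 then (z x - z t0) * ((x - t0)%:C%C)^-1 else h x.
  have gt0 : g t0 = h t0 by rewrite /g (negbTE D0).
  exists g; split.
  - move=> x; rewrite /g; have [Dx|Dx] := eqVneq (D x) 0.
      have xt : x != t0 by apply: contra_neq D0 => <-.
      have xt' : (x - t0)%:C%C != 0 :> C by rewrite eq_complex /= subr_eq0 negb_and xt.
      by rewrite mulrCA divff ?mulr1.
    apply: (mulIf Dx); rewrite DE /h -mulrA mulfVK //; ring.
  - rewrite gt0; have hc : ccvg (nbhs t0) h (h t0).
      by apply: ccvgM; [exact: ccvgN|exact: ccvgV].
    apply: (ccvgP (F := nbhs t0) _ _).2 => e e0.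
    near=> x; have Dx : D x != 0.
      have : nrm (D x - D t0) < nrm (D t0).
        by near: x; apply: (ccvgP (F := nbhs t0) _ _).1 => //; rewrite nrm_gt0.
      by apply: contraTneq => ->; rewrite sub0r nrmN ltxx.
    rewrite /g (negbTE Dx); near: x.
    exact: (ccvgP (F := nbhs t0) h (h t0)).1.
  - rewrite gt0 /h /dz Dt0; congr (- _ * _).
    by apply: eq_bigr => i _; have [_ _ ->] := hal i.
(* z and the inverse of P' at z generate, over the smooth functions, an algebra
   stable under derivation *)
pose B0 f := csmooth f \/ f = z.
pose B f := B0 f \/ f = fun t => ((P t)^`().[z t])^-1.
have B0B f : B0 f -> B f by left.
have gsm f : csmooth f -> gen B f by move=> sf; apply: gen_base; left; left.
have gz : gen B z by apply: gen_base; left; right.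
have ginv : gen B (fun t => ((P t)^`().[z t])^-1) by apply: gen_base; right.
have gdz : gen B dz.
  apply: gen_mul => //; apply: (falg_opp (gen_falg B)).
  apply: (falg_sum (gen_falg B)) => i; apply: gen_mul.
    by apply: gsm; exact: (ha' i).1.
  exact: (falg_exp (gen_falg B)).
have hB0 f : B0 f -> exists2 f', gen B f' & cder f f'.
  move=> [/csmooth_cder[f' sf' ff']|->]; last by exists dz.
  by exists f' => //; apply: gsm.
apply: (gen_csmooth (B := B)) gz => f [/hB0 //|->].
have gP' : gen B0 (fun t => (P t)^`().[z t]).
  apply: (@falg_horner _ _ _ _ d.+1) => //; first exact: gen_falg.
  - by move=> t; rewrite (leq_trans (size_deriv_le (sP t))).
  - move=> i; apply: gen_base; left.
    rewrite (_ : (fun _ => _) = fun t => (P t)`_i.+1 * i.+1%:R).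
      apply: (falg_mul csmooth_falg) => //.
      exact: (falg_cst csmooth_falg).
    by apply/funext => t; rewrite coef_deriv mulr_natr.
  - by apply: gen_base; right.
have [w' gw' ww'] := gen_cder B0B hB0 gP'.
exists (fun t => - w' t * (((P t)^`().[z t])^-1 * ((P t)^`().[z t])^-1)).
  apply: gen_mul; last exact: gen_mul.
  exact: (falg_opp (gen_falg B)).
exact: cder_inv.
Unshelve. all: by end_near.
Qed.
End Smooth.

(** ** A smooth step function *)
Section Step.
Variable R : realType.
Local Notation C := R[i].

(** The functions P(1/x) exp(-1/x), extended by zero to x <= 0; this class is
    stable under derivation. *)
Definition flat (P : {poly R}) (x : R) : R :=
  if 0 < x then P.[x^-1] * expR (- x^-1) else 0.

Lemma poly_growth (P : {poly R}) : exists2 K : R, 0 <= K &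
  forall y, 1 <= y -> `|P.[y]| <= K * y ^+ size P.
Proof.
exists (\sum_(i < size P) `|P`_i|); first by apply: sumr_ge0.
move=> y y1; rewrite horner_coef; apply: le_trans (ler_norm_sum _ _ _) _.
rewrite mulr_suml; apply: ler_sum => i _; rewrite normrM ler_wpM2l //.
have y0 : 0 <= y by apply: le_trans y1.
by rewrite normrX ger0_norm // ler_weXn2l // ltnW.
Qed.

(** The exponential exp (1/x) exceeds any power of 1/x. *)
Lemma flat_small (P : {poly R}) : exists2 K : R, 0 <= K &
  forall x, 0 < x <= 1 -> `|flat P x| <= K * x ^+ 2.
Proof.
have [K K0 hK] := poly_growth P; set d := size P in hK.
exists (K * (d.+2)`!%:R); first by rewrite mulr_ge0.
move=> x /andP[x0 x1]; rewrite /flat x0.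
have y1 : 1 <= x^-1 by rewrite -invr1 lef_pV2 ?posrE.
have y0 : 0 < x^-1 by rewrite invr_gt0.
have F0 : 0 < ((d.+2)`!%:R : R) by rewrite ltr0n fact_gt0.
have e1 : expR (- x^-1) <= (d.+2)`!%:R * x ^+ d.+2.
  rewrite expRN -[leRHS]invrK lef_pV2 ?posrE ?expR_gt0 //; last first.
    by rewrite invr_gt0 mulr_gt0 // exprn_gt0.
  apply: le_trans (expR_ge1Dxn d.+1 (ltW y0)).
  by rewrite invfM exprVn mulrC lerDr.
rewrite normrM (ger0_norm (expR_ge0 _)).
apply: le_trans (ler_pM (normr_ge0 _) (expR_ge0 _) (hK _ y1) e1) _.
rewrite -(addn2 d) exprD exprVn mulrACA [x^- d * _]mulrA mulVf ?mul1r //.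
by rewrite expf_neq0 // gt_eqF.
Qed.

(** Away from 0 this is a computation in 1/x. At 0 the difference quotient is at
    most of order x, because the function is of order x ^+ 2. *)
Lemma flat_der (P : {poly R}) (x : R) :
  is_derive x 1 (flat P) (flat ('X^2 * (P - P^`())) x).
Proof.
have [x0|x0|->] := ltgtP x 0.
- have -> : flat ('X^2 * (P - P^`())) x = 0 by rewrite /flat ltNge ltW.
  apply: (@near_eq_is_derive _ _ _ (cst 0)) => //.
  near=> y; rewrite /flat ltNge ltW //; near: y.
  exact: lt_nbhsl.
- have h1 : is_derive x 1 (fun y : R => y^-1) (- x^-2).
    have := @is_deriveV R id x 1 1; rewrite gt_eqF // => /(_ isT (is_derive_id _ _)).
    move=> h; apply: (@is_derive_eq _ _ _ _ _ _ _ _ h).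
    by rewrite /GRing.scale /= mulr1.
  have h2 : is_derive x 1 (fun y => - y^-1) (x^-2).
    have := is_deriveN h1; rewrite opprK.
    by [].
  have h3 := is_derive1_comp (is_derive_poly P x^-1) h1.
  have h4 := @is_derive1_comp _ expR (fun y : R => - y^-1) x _ _ (is_derive_expR (- x^-1)) h2.
  have h5 := is_deriveM h3 h4.
  have E : ((horner P \o GRing.inv) x *: (expR (- x^-1) * x^-2) +
      (expR \o (fun y : R => - y^-1)) x *: (P^`().[x^-1] * - x^-2)) =
      flat ('X^2 * (P - P^`())) x.
    by rewrite /flat x0 /= !hornerE /GRing.scale /= exprVn; ring.
  apply: near_eq_is_derive (is_derive_eq h5 E).
  near=> y; have y0 : 0 < y by near: y; exact: lt_nbhsr.
  by rewrite /flat y0.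
- have -> : flat ('X^2 * (P - P^`())) 0 = 0 by rewrite /flat ltxx.
  apply/is_derive1_caratheodory; have [K K0 hK] := flat_small P.
  have f0 : flat P 0 = 0 by rewrite /flat ltxx.
  pose q x := flat P x / x; have q0 : q 0 = 0 by rewrite /q f0 mul0r.
  exists q; split => //.
    move=> y; rewrite f0 !subr0; have [->|y0] := eqVneq y 0.
      by rewrite f0 mulr0.
    by rewrite divfK.
  change (q x @[x --> (0 : R)] --> q 0); rewrite q0 /q.
  apply/cvgrPdist_lt => e e0.
  have K1 : 0 < K + 1 by rewrite ltr_wpDl.
  near=> y; have [y0|y0] := leP y 0.
    have -> : flat P y = 0 by rewrite /flat ltNge y0.
    by rewrite mul0r subr0 normr0.
  have y1 : y < Num.min 1 (e / (K + 1)).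
    near: y; apply: lt_nbhsl.
    by rewrite lt_min ltr01 divr_gt0.
  move: y1; rewrite lt_min ltr_pdivlMr // => /andP[y1 ye].
  rewrite sub0r normrN normrM normfV (gtr0_norm y0) ltr_pdivrMr //.
  apply: le_lt_trans (hK y _) _; first by rewrite y0 ltW.
  by rewrite expr2 mulrA ltr_pM2r //; nra.
Unshelve. all: by end_near.
Qed.

Lemma flat_smooth (P : {poly R}) : smooth (flat P).
Proof.
apply: (smooth_class (S := fun f => exists P, f = flat P)); last by exists P.
move=> _ [Q ->]; exists (flat ('X^2 * (Q - Q^`()))); first by eexists.
exact: flat_der.
Qed.

Definition chi (x : R) : R := flat 1 x / (flat 1 x + flat 1 (1 - x)).

Lemma flat1_le0 x : x <= 0 -> flat 1 x = 0.
Proof. by move=> x0; rewrite /flat ltNge x0. Qed.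

Lemma flat1_gt0 x : 0 < x -> 0 < flat 1 x.
Proof. by move=> x0; rewrite /flat x0 hornerC mul1r expR_gt0. Qed.

Lemma flat1_ge0 x : 0 <= flat 1 x.
Proof.
by have [x0|x0] := leP x 0; [rewrite flat1_le0|rewrite ltW ?flat1_gt0].
Qed.

Lemma flat1_lt x y : x < y -> 0 < y -> flat 1 x < flat 1 y.
Proof.
move=> xy y0; have [x0|x0] := leP x 0; first by rewrite flat1_le0 // flat1_gt0.
by rewrite /flat x0 y0 !hornerC !mul1r ltr_expR ltrN2 ltf_pV2.
Qed.

Lemma chi_den x : 0 < flat 1 x + flat 1 (1 - x).
Proof.
have [x0|x0] := leP x 0; last by rewrite ltr_wpDr ?flat1_ge0 ?flat1_gt0.
by rewrite ltr_wpDl ?flat1_ge0 ?flat1_gt0 //; lra.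
Qed.

Lemma chi_le0 x : x <= 0 -> chi x = 0.
Proof. by move=> x0; rewrite /chi flat1_le0 // mul0r. Qed.

Lemma chi_ge1 x : 1 <= x -> chi x = 1.
Proof.
move=> x1; have := chi_den x; rewrite /chi (@flat1_le0 (1 - x)); last lra.
by rewrite addr0 => h; rewrite divff // gt_eqF.
Qed.

Lemma chi01 x : 0 <= chi x <= 1.
Proof.
rewrite /chi; apply/andP; split.
  by rewrite divr_ge0 ?flat1_ge0 // ltW // chi_den.
by rewrite ler_pdivrMr ?chi_den // mul1r lerDl flat1_ge0.
Qed.

Lemma chi_lt x y : 0 <= x -> x < y -> y <= 1 -> chi x < chi y.
Proof.
move=> x0 xy y1; rewrite /chi ltr_pdivrMr ?chi_den // mulrAC ltr_pdivlMr ?chi_den //.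
have h1 := @flat1_lt x y xy (le_lt_trans x0 xy).
have h2 : flat 1 (1 - y) < flat 1 (1 - x) by apply: flat1_lt; lra.
have := flat1_ge0 x; have := flat1_ge0 (1 - y).
have : flat 1 x * flat 1 (1 - y) < flat 1 y * flat 1 (1 - x).
  by apply: ltr_pM; rewrite ?flat1_ge0.
lra.
Qed.

Lemma chi_csmooth : csmooth (fun x => (chi x)%:C%C).
Proof.
have h (f : R -> R) : smooth f -> csmooth (fun x => (f x)%:C%C).
  by move=> sf; have [_ h0] := falg_cst (@csmooth_falg R) 0.
have s1 := h _ (@flat_smooth 1).
have s2 : csmooth (fun x => (flat 1 (1 - x))%:C%C).
  apply: h; have := @smooth_affine R (flat 1) (-1) 1 (@flat_smooth 1).
  rewrite (_ : (fun x => flat 1 (-1 * x + 1)) = (fun x => flat 1 (1 - x))) //.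
  by apply/funext => x; rewrite mulN1r addrC.
have fa := @csmooth_falg R.
have s3 : csmooth (fun x => ((flat 1 x + flat 1 (1 - x))%:C%C)^-1).
  apply: csmooth_inv.
    by move=> t; rewrite eq_complex /= gt_eqF // chi_den.
  rewrite (_ : (fun _ => _) = fun x => (flat 1 x)%:C%C + (flat 1 (1 - x))%:C%C).
    exact: (falg_add fa).
  by apply/funext => x; rewrite rmorphD.
rewrite (_ : (fun _ => _) = fun x => (flat 1 x)%:C%C * ((flat 1 x + flat 1 (1 - x))%:C%C)^-1).
  exact: (falg_mul fa).
by apply/funext => x; rewrite /chi rmorphM /= fmorphV.
Qed.

Lemma chi_cont : continuous chi.
Proof. by have [] := csmooth_cc chi_csmooth. Qed.

(** The smooth step from 0 to 1 on the m-th of N equal subintervals *)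
Definition step (N m : nat) (t : R) : R := chi (N%:R * t - m%:R).

Lemma step_csmooth N m : csmooth (fun t => (step N m t)%:C%C).
Proof.
have [h1 _] := chi_csmooth; split; last exact: (falg_cst (@csmooth_falg R) 0).2.
exact: (@smooth_affine R (fun x => complex.Re (chi x)%:C%C) N%:R (- m%:R) h1).
Qed.

End Step.

(** * Polygonal paths of configurations *)

Section Polygon.
Variable R : realType.
Local Notation C := R[i].

Lemma avoid_Re (x : C) (e : R) (F : seq R) : 0 < e ->
  exists2 s : C, nrm (s - x) < e & complex.Re s \notin F.
Proof.
move=> e0; have e2 : e / 2 != 0 by rewrite gt_eqF // divr_gt0.
have [|k hk] := @inj_avoid _ (fun k : nat => complex.Re x + e / 2 / k.+1%:R) F.
  by move=> k l /addrI /harm_inj; apply.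
exists (x + (e / 2 / k.+1%:R)%:C%C); last by rewrite cReD.
have h0 : 0 < (k.+1%:R : R) by [].
rewrite addrC addKr nrmR ger0_norm; last by rewrite !divr_ge0 // ltW.
have h1 : 1 <= (k.+1%:R : R) by rewrite ler1n.
by rewrite ltr_pdivrMr //; nra.
Qed.

End Polygon.

Section Vpath.
Variables (R : realType) (n : nat).
Local Notation C := R[i].
Implicit Types (v : nat -> 'I_n -> C) (p q r x : 'I_n -> C).

(** The increment from v m to v m.+1 is weighted by B m, which is meant to be 1
    after and 0 before the m-th of N time intervals. Real weights give polygons,
    complex ones bend the edges. *)
Definition bpath N v (B : nat -> R -> C) (t : R) (j : 'I_n) : C :=
  v 0%N j + \sum_(m < N) B m t * (v m.+1 j - v m j).

Lemma bpath_seg N v (B : nat -> R -> C) t m j : (m < N)%N ->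
  (forall k, (k < m)%N -> B k t = 1) ->
  (forall k, (m < k < N)%N -> B k t = 0) ->
  bpath N v B t j = v m j + B m t * (v m.+1 j - v m j).
Proof.
move=> mN B1 B0; rewrite /bpath -(big_mkord xpredT (fun m => B m t * (v m.+1 j - v m j))).
rewrite (@big_cat_nat _ _ _ m) //=; last exact: ltnW.
rewrite [X in _ + (_ + X)]big_ltn // [X in _ + (_ + (_ + X))]big1_seq ?addr0; last first.
  by move=> k /andP[_]; rewrite mem_index_iota => h; rewrite B0 // mul0r.
rewrite addrA; congr (_ + _).
rewrite (eq_big_nat _ _ (F2 := fun k => v k.+1 j - v k j)); last first.
  by move=> k /andP[_ km]; rewrite B1 // mul1r.
by rewrite telescope_sumr // addrC subrK.
Qed.

Definition vpath N v : R -> 'I_n -> C := bpath N v (fun m t => (step N m t)%:C%C).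

(** An arc of parabola from 0 to 1; the arcs for different values of eta are
    disjoint apart from their ends. *)
Definition bend (eta x : R) : C := Complex x (eta * (x * (1 - x))).

Lemma bend0 eta : bend eta 0 = 0.
Proof. by apply: complex_ext => //=; rewrite mul0r mulr0. Qed.
Lemma bend1 eta : bend eta 1 = 1.
Proof. by apply: complex_ext => //=; rewrite subrr !mulr0. Qed.

(** Each point of F lies on at most one of the arcs, and the values 1 / k of eta
    are infinitely many. *)
Lemma bend_avoid (a d : C) (F : seq C) : d != 0 ->
  exists2 eta : R, 0 < eta <= 1 &
    forall x : R, 0 < x < 1 -> a + bend eta x * d \notin F.
Proof.
move=> d0; pose bad (f : C) := let w := (f - a) / d in
  complex.Im w / (complex.Re w * (1 - complex.Re w)).
have [|k hk] := @inj_avoid _ (fun k : nat => 1 / k.+1%:R : R) (map bad F).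
  exact/harm_inj/oner_neq0.
exists (1 / k.+1%:R); first by rewrite divr_gt0 //= div1r invf_le1 // ler1n.
move=> x x01; apply: contra hk => hF; apply/mapP; eexists; first exact: hF.
rewrite /bad addrC addKr mulfK //= mulfK // mulf_neq0 //; lra.
Qed.

Lemma seg_exists k (x : R) : 0 <= x <= k.+1%:R ->
  exists2 m : nat, (m < k.+1)%N & m%:R <= x <= m.+1%:R.
Proof.
elim: k => [|k IH] h; first by exists 0%N.
have [xk|xk] := leP x k.+1%:R; last by exists k.+1 => //; lra.
have [|m mk hm] := IH; first by lra.
by exists m => //; apply: ltnW.
Qed.

Lemma step_before N m k (t : R) : (k < m)%N -> m%:R <= N%:R * t -> step N k t = 1 :> R.
Proof.
move=> km mt; apply: chi_ge1.
have : (k.+1%:R : R) <= m%:R by rewrite ler_nat.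
by rewrite -natr1; lra.
Qed.

Lemma step_after N m k (t : R) : (m < k)%N -> N%:R * t <= m.+1%:R -> step N k t = 0 :> R.
Proof.
move=> mk tm; apply: chi_le0.
have : (m.+1%:R : R) <= k%:R by rewrite ler_nat.
by lra.
Qed.

Lemma vpath_seg N v t m j : (m < N)%N -> m%:R <= N%:R * t <= m.+1%:R ->
  vpath N v t j = v m j + (step N m t)%:C%C * (v m.+1 j - v m j).
Proof.
move=> mN /andP[h1 h2]; apply: bpath_seg => // k.
  by move=> km; rewrite (step_before km).
by move=> /andP[mk _]; rewrite (step_after mk).
Qed.

Lemma vpath_seg_ex N (t : R) : (0 < N)%N -> I01 t ->
  exists2 m, (m < N)%N & m%:R <= N%:R * t <= m.+1%:R.
Proof.
case: N => // N _ t01; apply: seg_exists.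
have : (0 : R) <= N.+1%:R by [].
by nra.
Qed.

Lemma vpath0 N v t : t <= 0 -> vpath N v t = v 0%N.
Proof.
move=> t0; apply/funext => j; rewrite /vpath /bpath big1 ?addr0 // => m _.
rewrite /step chi_le0 ?mul0r //.
have : (0 : R) <= N%:R by [].
by have : (0 : R) <= m%:R by []; nra.
Qed.

Lemma vpath1 N v t : 1 <= t -> vpath N v t = v N.
Proof.
move=> t1; apply/funext => j; rewrite /vpath /bpath.
rewrite (eq_bigr (fun m : 'I_N => v m.+1 j - v m j)); last first.
  move=> m _; rewrite /step chi_ge1 ?mul1r //.
  have : (m.+1%:R : R) <= N%:R by rewrite ler_nat.
  by rewrite -natr1; have : (0 : R) <= N%:R by []; nra.
rewrite -(big_mkord xpredT (fun m => v m.+1 j - v m j)) telescope_sumr //.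
by rewrite addrC subrK.
Qed.

Lemma vpath_clamp N v t : vpath N v t = vpath N v (clamp 0 1 t).
Proof.
have [t0|t0] := leP t 0.
  by rewrite c01_le // !vpath0.
have [t1|t1] := leP 1 t; first by rewrite c01_ge // !vpath1.
by rewrite clamp_id // !ltW.
Qed.

Lemma vpath_csmooth N v j : csmooth ((vpath N v)^~ j).
Proof.
have fa := @csmooth_falg R.
apply: (falg_add fa); first exact: (falg_cst fa).
apply: (falg_sum fa) => m; apply: (falg_mul fa); last exact: (falg_cst fa).
exact: step_csmooth.
Qed.

Lemma vpath_cpath N v : cpath (vpath N v).
Proof. by move=> j; apply/csmooth_cc/vpath_csmooth. Qed.

Lemma vpath_near N v t m j x (e : R) : (m < N)%N ->
  m%:R <= N%:R * t <= m.+1%:R -> nrm (v m j - x j) <= e ->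
  nrm (v m.+1 j - x j) <= e -> nrm (vpath N v t j - x j) <= e.
Proof.
move=> mN ht h1 h2; rewrite (vpath_seg _ _ mN ht).
have := nrm_convex (chi01 _ : 0 <= step N m t <= 1) h1 h2.
rewrite rmorphB /=; set s := (step N m t)%:C%C.
by rewrite (_ : v m j + s * (v m.+1 j - v m j) = (1 - s) * v m j + s * v m.+1 j) //; ring.
Qed.

Definition interp N (f : R -> 'I_n -> C) := vpath N (fun m => f (m%:R / N%:R)).

Lemma interp0 N f t : t <= 0 -> interp N f t = f 0.
Proof. by move=> t0; rewrite /interp vpath0 // mul0r. Qed.

Lemma interp1 N f t : (0 < N)%N -> 1 <= t -> interp N f t = f 1.
Proof. by move=> N0 t1; rewrite /interp vpath1 // divff // pnatr_eq0 -lt0n. Qed.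

Lemma interp_near N f t j (e : R) : (0 < N)%N -> I01 t ->
  (forall t', I01 t' -> `|t - t'| <= N%:R^-1 -> nrm (f t j - f t' j) <= e) ->
  nrm (interp N f t j - f t j) <= e.
Proof.
move=> N0 t01 h; have [m mN ht] := vpath_seg_ex N0 t01.
have NR : 0 < (N%:R : R) by rewrite ltr0n.
have mN' : (m.+1%:R : R) <= N%:R by rewrite ler_nat.
have m0 : (0 : R) <= m%:R by [].
have m1 : (m.+1%:R : R) = m%:R + 1 by rewrite natr1.
have a1 : m%:R / N%:R <= t by rewrite ler_pdivrMr // mulrC; lra.
have a2 : t <= m.+1%:R / N%:R by rewrite ler_pdivlMr // mulrC; lra.
have a3 : m.+1%:R / N%:R = m%:R / N%:R + N%:R^-1 :> R by rewrite m1 mulrDl mul1r.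
have a4 : m.+1%:R / N%:R <= 1 :> R by rewrite ler_pdivrMr // mul1r.
have a5 : 0 <= m%:R / N%:R :> R by rewrite divr_ge0 // ltW.
apply: (vpath_near (x := f t) mN ht); rewrite nrm_distC; apply: h.
- by lra.
- by rewrite ger0_norm; lra.
- by lra.
- by rewrite ler0_norm; lra.
Qed.

(** ** Moving one point at a time through generic configurations *)

Definition upd p (j : 'I_n) (s : C) : 'I_n -> C := fun k => if k == j then s else p k.

(** The configurations passed through when the points of p are moved to those of
    r one after the other. *)
Definition hyb r p (i : nat) : 'I_n -> C := fun k => if (k < i)%N then r k else p k.

Lemma hyb0 r p : hyb r p 0 = p. Proof. by apply/funext. Qed.

Lemma hyb_full r p i : (n <= i)%N -> hyb r p i = r.
Proof. by move=> ni; apply/funext => k; rewrite /hyb (leq_trans (ltn_ord k)). Qed.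

Variable Good : ('I_n -> C) -> Prop.
Hypothesis Good_upd : forall p, Good p -> forall j, exists F : seq R,
  forall s, complex.Re s \notin F -> Good (upd p j s).

(** The points of r are chosen one after the other. For each of them, the two
    hybrids reached so far only exclude finitely many real parts. *)
Lemma generic_hybrid p q x (e : R) : Good p -> Good q -> 0 < e ->
  exists2 r, (forall j, nrm (r j - x j) < e) &
    forall i, Good (hyb r p i) /\ Good (hyb r q i).
Proof.
move=> Gp Gq e0.
suff H i : (i <= n)%N -> exists2 r, (forall j, nrm (r j - x j) < e) &
    forall i', (i' <= i)%N -> Good (hyb r p i') /\ Good (hyb r q i').
  have [r rx hr] := H n (leqnn n); exists r => // i.
  have [ni|ni] := leqP i n; first exact: hr.
  rewrite !hyb_full 1?ltnW //; have := hr n (leqnn n).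
  by rewrite !hyb_full.
elim: i => [|i IH] ni.
  exists x => [j|i']; first by rewrite subrr nrm0.
  by rewrite leqn0 => /eqP->; rewrite !hyb0.
have [r rx hr] := IH (ltnW ni); pose j := Ordinal ni.
have [Gp' Gq'] := hr i (leqnn i).
have [F hF] := Good_upd Gp' j; have [F' hF'] := Good_upd Gq' j.
have [s sx] := avoid_Re (x j) (F ++ F') e0.
rewrite mem_cat negb_or => /andP[sF sF'].
exists (upd r j s) => [k|i']; first by rewrite /upd; case: eqVneq => [->|].
have E y i1 : (i1 <= i)%N -> hyb (upd r j s) y i1 = hyb r y i1.
  move=> i1i; apply/funext => k; rewrite /hyb /upd; case: ltnP => // ki.
  case: eqVneq => // kj; move: ki; rewrite kj /= => ii1.
  by have := leq_trans ii1 i1i; rewrite ltnn.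
have E' y : hyb (upd r j s) y i.+1 = upd (hyb r y i) j s.
  apply/funext => k; rewrite /hyb /upd; have [->|kj] := eqVneq k j.
    by rewrite /= ltnSn.
  rewrite ltnS leq_eqVlt (_ : (k == i :> nat) = false) //.
  by apply: contra_neqF kj => /eqP ki; apply/val_inj.
rewrite leq_eqVlt => /orP[/eqP->|i'i]; last by rewrite !E //; apply: hr.
by rewrite !E'; split; [apply: hF|apply: hF'].
Qed.

Lemma generic_near p x (e : R) : Good p -> 0 < e ->
  exists2 r, (forall j, nrm (r j - x j) < e) & Good r.
Proof.
move=> Gp e0; have [r rx hr] := generic_hybrid x Gp Gp e0.
by exists r => //; have [] := hr n; rewrite hyb_full.
Qed.

Definition single_move p q := exists i : nat, forall k : 'I_n, (k : nat) != i -> q k = p k.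

Lemma single_hyb r p i : single_move (hyb r p i) (hyb r p i.+1).
Proof. by exists i => k ki; rewrite /hyb ltnS [(k <= i)%N]leq_eqVlt (negbTE ki). Qed.

Lemma single_sym p q : single_move p q -> single_move q p.
Proof. by move=> [i h]; exists i => k ki; rewrite h. Qed.

Lemma single_refl p : single_move p p.
Proof. by exists 0%N. Qed.

(** The path is sampled at the times r / M, and generic configurations q r are
    chosen near the samples. From q r to q r.+1 one passes through an auxiliary
    configuration near both: the points of q r are moved to it one by one, and
    then to q r.+1 in the reverse order. The intermediate configurations are
    hybrids, which are generic for a suitable auxiliary configuration. *)
Lemma generic_polygon z (e : R) : cpath z -> Good (z 0) -> Good (z 1) -> 0 < e ->
  exists N v, [/\ (0 < N)%N, v 0%N = z 0, v N = z 1,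
    (forall m, (m <= N)%N -> Good (v m)) &
    forall m, (m < N)%N -> single_move (v m) (v m.+1) /\
      forall t, m%:R <= N%:R * t <= m.+1%:R -> forall j,
        nrm (v m j - z t j) < e /\ nrm (v m.+1 j - z t j) < e].
Proof.
move=> zc G0 G1 e0; have e2 : 0 < e / 2 by rewrite divr_gt0.
have [|[//|M'] _ hM] := @mesh R n (fun x : R * R => z x.2) (e / 2) _ e2.
  by move=> j; apply: (cc_comp (f := z^~ j)) (zc j); cont.
pose M := M'.+1; rewrite -/M in hM; have M0 : 0 < (M%:R : R) by [].
have zM (r : nat) (t : R) j : (r < M)%N -> r%:R <= M%:R * t <= r.+1%:R ->
    nrm (z (r%:R / M%:R) j - z t j) < e / 2 /\
    nrm (z (r.+1%:R / M%:R) j - z t j) < e / 2.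
  move=> rM ht.
  have mN' : (r.+1%:R : R) <= M%:R by rewrite ler_nat.
  have m0 : (0 : R) <= r%:R by [].
  have m1 : (r.+1%:R : R) = r%:R + 1 by rewrite natr1.
  have a1 : r%:R / M%:R <= t by rewrite ler_pdivrMr // mulrC; lra.
  have a2 : t <= r.+1%:R / M%:R by rewrite ler_pdivlMr // mulrC; lra.
  have a3 : r.+1%:R / M%:R = r%:R / M%:R + M%:R^-1 :> R by rewrite m1 mulrDl mul1r.
  have a4 : r.+1%:R / M%:R <= 1 :> R by rewrite ler_pdivrMr // mul1r.
  have a5 : 0 <= r%:R / M%:R :> R by rewrite divr_ge0 // ltW.
  split; [apply: (hM j 0 (r%:R / M%:R) t)|apply: (hM j 0 (r.+1%:R / M%:R) t)];
    by rewrite ?I01_0 ?ler_norml //; lra.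
have /choice[q hq] : forall r : nat, exists q, [/\ Good q,
    forall j, nrm (q j - z (r%:R / M%:R) j) < e / 2, r = 0%N -> q = z 0 &
    r = M -> q = z 1].
  move=> r; have [r0|r0] := eqVneq r 0%N.
    exists (z 0); split => //; last by rewrite r0.
    by move=> j; rewrite r0 mul0r subrr nrm0.
  have [rM|rM] := eqVneq r M.
    exists (z 1); split => //; last by move=> r0'; rewrite r0' eqxx in r0.
    by move=> j; rewrite rM divff ?gt_eqF // subrr nrm0.
  have [p px Gp] := generic_near (z (r%:R / M%:R)) G0 e2.
  by exists p; split => // /eqP; rewrite ?(negbTE r0) ?(negbTE rM).
have /choice[mid hmid] : forall r : nat, exists p,
    (forall j, nrm (p j - z (r%:R / M%:R) j) < e / 2) /\
    forall i, Good (hyb p (q r) i) /\ Good (hyb p (q r.+1) i).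
  move=> r; have [Gq _ _ _] := hq r; have [Gq' _ _ _] := hq r.+1.
  by have [p px hp] := generic_hybrid (z (r%:R / M%:R)) Gq Gq' e2; exists p.
pose L := n.+1; pose L2 := (L + L)%N.
(* the position after i of the 2 (n + 1) moves of stage r; the last move
   of the first half and the first move of the second do nothing *)
pose w (r : nat) i := if (i <= L)%N then hyb (mid r) (q r) i
  else hyb (mid r) (q r.+1) (L2 - i).
have wL (r : nat) : w r L2 = w r.+1 0%N.
  by rewrite /w leq0n leqNgt -addn1 leq_add2l //= subnn !hyb0.
have wG (r : nat) i : Good (w r i).
  by rewrite /w; case: ifP => _; [exact: ((hmid r).2 i).1|exact: ((hmid r).2 _).2].
have wS (r : nat) i : (i < L2)%N -> single_move (w r i) (w r i.+1).
  move=> iL; rewrite /w; case: (ltngtP i L) => [||->].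
  - by move=> _; exact: single_hyb.
  - move=> Li; have E : (L2 - i = (L2 - i.+1).+1)%N by lia.
    by rewrite E; exact/single_sym/single_hyb.
  - rewrite !hyb_full; [exact: single_refl|by rewrite /L2 /L; lia|by rewrite /L; lia].
have wN (r : nat) i (t : R) j : (r < M)%N -> r%:R <= M%:R * t <= r.+1%:R -> nrm (w r i j - z t j) < e.
  move=> rM ht; have [h1 h2] := zM r t j rM ht.
  have [_ q1 _ _] := hq r; have [_ q2 _ _] := hq r.+1.
  have m1 := (hmid r).1 j; have := q1 j; have := q2 j.
  have := nrm_trans (q r j) (z (r%:R / M%:R) j) (z t j).
  have := nrm_trans (mid r j) (z (r%:R / M%:R) j) (z t j).
  have := nrm_trans (q r.+1 j) (z (r.+1%:R / M%:R) j) (z t j).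
  by rewrite /w /hyb; do 2 case: ifP => _; lra.
have L20 : (0 < L2)%N by [].
pose v m := w (m %/ L2)%N (m %% L2)%N.
have vE (r : nat) i : (i < L2)%N -> v (r * L2 + i)%N = w r i.
  by move=> iL; rewrite /v divnMDl // divn_small // addn0 modnMDl modn_small.
exists (M * L2)%N, v; split => //.
- by rewrite (vE 0%N 0%N) // /w /= hyb0; have [_ _ ->] := hq 0%N.
- by rewrite -[(M * L2)%N]addn0 vE // /w /= hyb0; have [_ _ _ ->] := hq M.
- by move=> m _; apply: wG.
move=> m mN; pose r := (m %/ L2)%N; pose i := (m %% L2)%N.
have iL : (i < L2)%N by rewrite ltn_mod.
have mE : m = (r * L2 + i)%N by apply: divn_eq.
have rM : (r < M)%N by rewrite /r ltn_divLR.
have -> : v m = w r i by [].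
have -> : v m.+1 = w r i.+1.
  rewrite mE -addnS; have [h|h] := ltnP i.+1 L2; first exact: vE.
  have -> : i.+1 = L2 by apply/eqP; rewrite eqn_leq iL h.
  by rewrite wL addnC -mulSn -[(_ * _)%N]addn0 vE.
split; first exact: wS.
move=> t ht; have {}ht : r%:R <= M%:R * t <= r.+1%:R.
  have L2R : 0 < (L2%:R : R) by rewrite ltr0n.
  have b1 : (r%:R * L2%:R : R) <= m%:R by rewrite -natrM ler_nat leq_divM.
  have b2 : (m.+1%:R : R) <= r.+1%:R * L2%:R.
    by rewrite -natrM ler_nat ltn_ceil.
  move: ht; rewrite natrM => /andP[t1 t2].
  by apply/andP; split; rewrite -(ler_pM2r L2R); lra.
by move=> j; split; apply: wN.
Qed.
End Vpath.

(** ** Generic paths *)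
Section Avoid.
Variables (R : realType) (n : nat).
Local Notation C := R[i].
Variable Good : ('I_n -> C) -> Prop.
Hypothesis Good_upd : forall p, Good p -> forall j, exists F : seq C,
  forall s, s \notin F -> Good (upd p j s).

(** A single point moving along an edge of a polygon only has to avoid finitely
    many points of the plane, none of which is an end of the edge: bending the
    edge into an arc suffices. *)
Lemma avoid_path (z : R -> 'I_n -> C) (e : R) :
  cpath z -> Good (z 0) -> Good (z 1) -> 0 < e ->
  exists y : R -> 'I_n -> C, [/\ cpath y, y 0 = z 0, y 1 = z 1 &
    forall t, I01 t -> Good (y t) /\ forall j, nrm (y t j - z t j) < e].
Proof.
move=> zc G0 G1 e0; have e4 : 0 < e / 4 by rewrite divr_gt0.
have Gre p : Good p -> forall j, exists F : seq R,
    forall s, complex.Re s \notin F -> Good (upd p j s).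
  move=> Gp j; have [F hF] := Good_upd Gp j; exists (map (@complex.Re R) F) => s sF.
  by apply: hF; apply: contra sF; apply: map_f.
have [N [v [N0 v0 vN vG vS]]] := generic_polygon Gre zc G0 G1 e4.
have /choice[eta heta] : forall m, exists eta : R, 0 < eta <= 1 /\
    ((m < N)%N -> forall x : R, 0 < x < 1 ->
      Good (fun j => v m j + bend eta x * (v m.+1 j - v m j))).
  move=> m; have [mN|mN] := ltnP m N; last by exists 1; rewrite ltr01 lexx.
  have [[i hi] _] := vS m mN.
  have [ni|ni] := leqP n i.
    exists 1; rewrite ltr01 lexx; split => // _ x _.
    rewrite (_ : (fun _ => _) = v m); first exact/vG/ltnW.
    apply/funext => j; rewrite hi ?subrr ?mulr0 ?addr0 //.
    by rewrite neq_ltn (leq_trans (ltn_ord j) ni).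
  pose j0 := Ordinal ni.
  have hi' j : j != j0 -> v m.+1 j = v m j by move=> jj0; apply: hi; apply: contra jj0 => /eqP h; apply/eqP/val_inj.
  have [d0|d0] := eqVneq (v m.+1 j0 - v m j0) 0.
    exists 1; rewrite ltr01 lexx; split => // _ x _.
    rewrite (_ : (fun _ => _) = v m); first exact/vG/ltnW.
    apply/funext => j; have [->|/hi' ->] := eqVneq j j0.
      by rewrite d0 mulr0 addr0.
    by rewrite subrr mulr0 addr0.
  have [F hF] := Good_upd (vG m (ltnW mN)) j0.
  have [eta eta01 hb] := bend_avoid (v m j0) F d0.
  exists eta; split => // _ x x01.
  rewrite (_ : (fun _ => _) = upd (v m) j0 (v m j0 + bend eta x * (v m.+1 j0 - v m j0))).
    exact/hF/hb.
  apply/funext => j; rewrite /upd; case: eqVneq => [->|/hi' ->] //.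
  by rewrite subrr mulr0 addr0.
pose B m t := bend (eta m) (step N m t).
pose y := bpath N v B.
have ySeg t m j : (m < N)%N -> m%:R <= N%:R * t <= m.+1%:R ->
    y t j = v m j + B m t * (v m.+1 j - v m j).
  move=> mN /andP[h1 h2]; apply: bpath_seg => // k.
    by move=> km; rewrite /B (step_before km) // bend1.
  by move=> /andP[mk _]; rewrite /B (step_after mk) // bend0.
have stepc m : continuous (step N m : R -> R).
  have h : continuous (fun t : R => N%:R * t - m%:R) by cont.
  exact: (cont_comp h (@chi_cont R)).
exists y; split.
- move=> j; have fa := @cc_falg R R.
  apply: (falg_add fa); first exact: (falg_cst fa).
  apply: (falg_sum fa) => m; apply: (falg_mul fa); last exact: (falg_cst fa).
  have sc := stepc m.
  split; first exact: sc.
  by rewrite /B /=; cont.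
- apply/funext => j; rewrite (ySeg 0 0%N) //; last by rewrite mulr0 lexx ler01.
  by rewrite /B /step mulr0 subr0 chi_le0 // bend0 mul0r addr0 v0.
- apply/funext => j; have N1 : (N.-1.+1 = N)%N by rewrite prednK.
  have NR : (N.-1%:R : R) + 1 = N%:R by rewrite natr1 N1.
  rewrite (ySeg 1 N.-1) ?N1 //; last by rewrite -NR; lra.
  rewrite /B /step chi_ge1; last by rewrite -NR; lra.
  by rewrite bend1 mul1r addrC subrK vN.
move=> t t01; have [m mN ht] := vpath_seg_ex N0 t01.
have Ey : y t = fun j => v m j + B m t * (v m.+1 j - v m j).
  by apply/funext => j; apply: ySeg.
split.
  rewrite Ey; have /andP[c0 c1] := chi01 (N%:R * t - m%:R).
  have [s0|s0] := eqVneq (step N m t) 0.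
    rewrite (_ : (fun _ => _) = v m); first exact/vG/ltnW.
    by apply/funext => j; rewrite /B s0 bend0 mul0r addr0.
  have [s1|s1] := eqVneq (step N m t) 1.
    rewrite (_ : (fun _ => _) = v m.+1); first exact/vG.
    by apply/funext => j; rewrite /B s1 bend1 mul1r addrC subrK.
  apply: (heta m).2 => //; rewrite !lt_def s0 [1 == _]eq_sym s1.
  by rewrite c0 c1.
move=> j; rewrite (ySeg t m j mN ht).
have /andP[eta0 eta1] := (heta m).1.
have [h1 h2] := (vS m mN).2 t ht j.
have hv := vpath_near (v := v) (x := z t) mN ht (ltW h1) (ltW h2).
rewrite (vpath_seg _ _ mN ht) in hv.
set s := step N m t in hv *; have s01 : 0 <= s <= 1 := chi01 _.
have -> : v m j + B m t * (v m.+1 j - v m j) - z t j =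
    (v m j + s%:C%C * (v m.+1 j - v m j) - z t j) +
    (B m t - s%:C%C) * (v m.+1 j - v m j) by ring.
apply: le_lt_trans (nrmD _ _) _; rewrite nrmM.
have a1 : nrm (B m t - s%:C%C) <= 1.
  apply: le_trans (nrm_ReIm _) _.
  rewrite cReD cImD cReN cImN /= -/s subrr normr0 add0r subr0.
  have /andP[p0 p1] : 0 <= s * (1 - s) <= 1 by apply/andP; split; nra.
  have p2 : 0 <= eta m * (s * (1 - s)) by rewrite mulr_ge0 // ltW.
  by rewrite (ger0_norm p2) mulr_ile1 // ltW.
have a2 : nrm (v m.+1 j - v m j) < e / 2.
  have := nrm_trans (v m.+1 j) (z t j) (v m j).
  by rewrite (nrm_distC (z t j)); lra.
have : nrm (B m t - s%:C%C) * nrm (v m.+1 j - v m j) <= 1 * nrm (v m.+1 j - v m j).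
  by rewrite ler_wpM2r // nrm_ge0.
lra.
Qed.
End Avoid.

(** * Reading words off polygonal braids *)

Section Reading.
Variables (R : realType) (n : nat).
Local Notation C := R[i].
Local Notation cRe := (@complex.Re R).
Local Notation cIm := (@complex.Im R).
Implicit Types (z : geometric_braid R n) (p q : 'I_n -> C) (w : artin_word n).

Definition re_cont z := forall j, continuous (fun t => cRe (z j t)).

Lemma sign_const (f : R -> R) (s s' : R) : continuous f ->
  (forall t, s <= t <= s' -> f t != 0) ->
  forall t u, s <= t <= s' -> s <= u <= s' -> (0 < f t) = (0 < f u).
Proof.
move=> fc f0.
suff H t u : t <= u -> s <= t <= s' -> s <= u <= s' -> (0 < f t) = (0 < f u).
  by move=> t u ht hu; have [tu|/ltW ut] := leP t u; [apply: H|rewrite (H u t)].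
move=> tu ht hu.
have [|ft] := ltP 0 (f t); have [|fu] := ltP 0 (f u) => //.
  move=> ft; have [||c] := @IVT R f t u 0 tu.
  - exact: continuous_subspaceT.
  - by rewrite ge_min fu orbT le_max ltW.
  rewrite in_itv /= => hc fc0; have hc' : s <= c <= s' by lra.
  by have := f0 c hc'; rewrite fc0 eqxx.
move=> fu'; have [||c] := @IVT R f t u 0 tu.
- exact: continuous_subspaceT.
- by rewrite ge_min ft /= le_max (ltW fu') orbT.
rewrite in_itv /= => hc fc0; have hc' : s <= c <= s' by lra.
  by have := f0 c hc'; rewrite fc0 eqxx.
Qed.

Lemma order_const z j k (s s' : R) : re_cont z ->
  (forall t, s <= t <= s' -> cRe (z j t) != cRe (z k t)) ->
  forall t u, s <= t <= s' -> s <= u <= s' ->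
  (cRe (z j t) < cRe (z k t)) = (cRe (z j u) < cRe (z k u)).
Proof.
move=> zc h t u ht hu; rewrite -subr_gt0 -[in RHS]subr_gt0.
have h1 := zc j; have h2 := zc k.
apply: (@sign_const (fun t => cRe (z k t) - cRe (z j t)) s s') => //; first by cont.
by move=> t' ht'; rewrite subr_eq0 eq_sym h.
Qed.

Lemma position_const z (s s' : R) : re_cont z ->
  (forall t, s <= t <= s' -> distinct_real_parts z t) ->
  forall t u j, s <= t <= s' -> s <= u <= s' -> position z t j = position z u j.
Proof.
move=> zc zd t u j ht hu; apply: eq_card => k; rewrite !inE.
have [->|kj] := eqVneq k j; first by rewrite !ltxx.
apply: (order_const (s := s) (s' := s')) => // t' ht'.
by apply: contra kj => /eqP /(zd t' ht') ->.
Qed.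

Lemma half_twist_extend z (s s1 r : R) i e : re_cont z -> s <= s1 ->
  (forall t, s <= t <= s1 -> distinct_real_parts z t) ->
  half_twist z s1 r i e -> half_twist z s r i e.
Proof.
move=> zc ss1 zd [a [b [c [/andP[c1 c2] h1 [h2 h3] h4 h5]]]].
have ps j : position z s j = position z s1 j.
  by apply: (position_const zc zd); rewrite ?lexx ?ss1.
exists a, b, c; split => //; first by rewrite c2 (le_lt_trans ss1).
  move=> t j k /andP[st tr]; have [s1t|ts1] := leP s1 t.
    by apply: h1; rewrite s1t tr.
  by move/(zd t); rewrite st (ltW ts1) => /(_ isT) ->; left.
by rewrite !ps.
Qed.

Lemma reads_cat z (s r s' : R) w1 w2 : re_cont z -> s <= r -> r <= s' ->
  reads_word z s r w1 -> reads_word z r s' w2 -> reads_word z s s' (w1 ++ w2).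
Proof.
move=> zc; elim: w1 s => [|[i e] w1 IH] s sr rs' /=.
  case: w2 => [|[i e] w2] /= h1.
    move=> h2 t /andP[st ts']; have [tr|rt] := leP t r.
      by apply: h1; rewrite st tr.
    by apply: h2; rewrite ts' ltW.
  move=> [r2 /andP[rr2 r2s'] [ht h2]]; exists r2.
    by rewrite r2s' (le_lt_trans sr).
  by split => //; apply: half_twist_extend ht.
move=> [r0 /andP[sr0 r0r] [ht h1]] h2; exists r0.
  by rewrite sr0 (lt_le_trans r0r).
by split => //; apply: IH => //; apply: ltW.
Qed.

Definition rank_in p j : nat := #|[pred k : 'I_n | cRe (p k) < cRe (p j)]|.

(** Every other strand stays on the same side of a and on the same side of b.
    Since a and b have equal real parts at height c, it is on the same side of
    both; hence a and b are neighbours and exchange their positions. *)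
Lemma half_twistI z (s s' c : R) a b : re_cont z -> s < c < s' -> a != b ->
  (forall t j k, s <= t <= s' -> cRe (z j t) = cRe (z k t) ->
     j = k \/ t = c /\ (j, k) \in [:: (a, b); (b, a)]) ->
  cRe (z a c) = cRe (z b c) ->
  cRe (z a s) < cRe (z b s) -> cRe (z b s') < cRe (z a s') ->
  z a c <> z b c ->
  (rank_in (z^~ s) a).+1 = rank_in (z^~ s) b /\
  half_twist z s s' (rank_in (z^~ s) a) (cIm (z a c) < cIm (z b c)).
Proof.
move=> zc /andP[sc cs'] ab co eqc abs bas' abc.
have hs : s <= s <= s' by rewrite lexx ltW // (lt_trans sc).
have hs' : s <= s' <= s' by rewrite lexx ltW // (lt_trans sc).
have hc : s <= c <= s' by rewrite !ltW.
have ord j k t u : j \notin [:: a; b] -> k \in [:: a; b] -> s <= t <= s' -> s <= u <= s' ->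
    (cRe (z j t) < cRe (z k t)) = (cRe (z j u) < cRe (z k u)).
  move=> jab kab; apply: order_const => // t' ht'; apply/eqP => /(co t' j k ht').
  case=> [jk|[_]]; first by rewrite jk kab in jab.
  by rewrite !inE !xpair_eqE; move: jab; rewrite !inE negb_or => /andP[/negbTE -> /negbTE ->].
have L j t u : j \notin [:: a; b] -> s <= t <= s' -> s <= u <= s' ->
    (cRe (z j t) < cRe (z a t)) = (cRe (z j u) < cRe (z b u)).
  move=> jab ht hu; rewrite (ord j a t c jab) ?inE ?eqxx //.
  by rewrite (ord j b u c jab) ?inE ?eqxx ?orbT // eqc.
have Pab : position z s b = (position z s a).+1.
  rewrite /position (eq_card (B := [predU1 a & [pred k | cRe (z k s) < cRe (z a s)]])).
    by rewrite cardU1 !inE ltxx.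
  move=> k; rewrite !inE; have [->|ka] := eqVneq k a; first by rewrite abs.
  have [->|kb] := eqVneq k b; first by rewrite ltxx /= ltNge ltW.
  by rewrite /= (L k s s) // !inE negb_or ka.
have Pba : position z s' a = (position z s' b).+1.
  rewrite /position (eq_card (B := [predU1 b & [pred k | cRe (z k s') < cRe (z b s')]])).
    by rewrite cardU1 !inE ltxx.
  move=> k; rewrite !inE; have [->|kb] := eqVneq k b; first by rewrite bas'.
  have [->|ka] := eqVneq k a; first by rewrite ltxx /= ltNge ltW.
  by rewrite /= (L k s' s') // !inE negb_or ka.
have Pss' : position z s' b = position z s a.
  apply: eq_card => k; rewrite !inE.
  have [->|kb] := eqVneq k b; first by rewrite ltxx ltNge ltW.
  have [->|ka] := eqVneq k a; first by rewrite ltxx ltNge ltW.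
  by rewrite (L k s s') // !inE negb_or ka.
split; first by rewrite /rank_in -/(position z s b) Pab.
exists a, b, c; split => //; first by rewrite sc.
- by rewrite Pba Pss'.
- case: ltP => // h; rewrite lt_def h andbT; apply/eqP => h'.
  by apply: abc; apply: complex_ext.
Qed.

(** The word is required to be read for all increasing parametrisations of the
    segment, so that segments can be cut and their pieces read separately. *)
Definition segment_word p q w : Prop :=
  forall z (s s' : R) (th : R -> R), re_cont z -> s < s' -> continuous th ->
    (forall t u, s <= t -> t < u -> u <= s' -> th t < th u) ->
    th s = 0 -> th s' = 1 ->
    (forall t k, s <= t <= s' -> z k t = p k + (th t)%:C%C * (q k - p k)) ->
    reads_word z s s' w.

Lemma th_range (th : R -> R) (s s' : R) :
  (forall t u, s <= t -> t < u -> u <= s' -> th t < th u) ->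
  th s = 0 -> th s' = 1 -> forall t, s <= t <= s' -> 0 <= th t <= 1.
Proof.
move=> mono th0 th1 t /andP[st ts']; apply/andP; split.
  move: st; rewrite le_eqVlt => /orP[/eqP <-|st]; first by rewrite th0.
  by rewrite -th0 ltW //; apply: mono.
move: ts'; rewrite le_eqVlt => /orP[/eqP ->|ts']; first by rewrite th1.
by rewrite -th1 ltW //; apply: mono.
Qed.

(** If p and q are ordered alike, then so are their convex combinations. *)
Lemma segment_word_same p q : injective (cRe \o p) ->
  (forall j k, cRe (p j) < cRe (p k) -> cRe (q j) < cRe (q k)) ->
  segment_word p q [::].
Proof.
move=> pi pq z s s' th zc ss' thc mono th0 th1 zE t ht j k.
have tr := th_range mono th0 th1 ht.
rewrite !zE // !cReD !cReZ !cReD !cReN => jk.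
have conv (u x y : R) : 0 <= u <= 1 -> 0 < x -> 0 < y -> 0 < (1 - u) * x + u * y.
  move=> /andP[u0 u1] x0 y0; have [u2|u2] := leP u (1 / 2).
    have a : 0 < (1 - u) * x by apply: mulr_gt0 => //; lra.
    have b : 0 <= u * y by apply: mulr_ge0 => //; exact: ltW.
    by lra.
  have a : 0 <= (1 - u) * x by apply: mulr_ge0; [lra|exact: ltW].
  have b : 0 < u * y by apply: mulr_gt0 => //; lra.
  by lra.
apply: pi => /=; apply/eqP; apply: contraT; rewrite neq_lt => /orP[] h.
  have h' := pq _ _ h.
  have := conv (th t) (cRe (p k) - cRe (p j)) (cRe (q k) - cRe (q j)) tr.
  by rewrite !subr_gt0 => /(_ h h'); lra.
have h' := pq _ _ h.
have := conv (th t) (cRe (p j) - cRe (p k)) (cRe (q j) - cRe (q k)) tr.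
by rewrite !subr_gt0 => /(_ h h'); lra.
Qed.

Definition segment_point p q (tau : R) k : C := p k + tau%:C%C * (q k - p k).

Lemma segment_point0 p q : segment_point p q 0 = p.
Proof. by apply/funext => k; rewrite /segment_point mul0r addr0. Qed.

Lemma segment_point_l p q (tau u : R) :
  segment_point p (segment_point p q tau) u = segment_point p q (u * tau).
Proof.
by apply/funext => k; rewrite /segment_point rmorphM /=; ring.
Qed.

Lemma segment_point_r p q (tau u : R) :
  segment_point (segment_point p q tau) q u = segment_point p q (tau + u * (1 - tau)).
Proof.
by apply/funext => k; rewrite /segment_point !rmorphD !rmorphM !rmorphB /=; ring.
Qed.

Lemma segment_word_cat p q (tau : R) w1 w2 : 0 < tau < 1 ->
  segment_word p (segment_point p q tau) w1 ->
  segment_word (segment_point p q tau) q w2 -> segment_word p q (w1 ++ w2).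
Proof.
move=> /andP[t0 t1] h1 h2 z s s' th zc ss' thc mono th0 th1 zE.
have [||r] := @IVT R th s s' tau (ltW ss').
- exact: continuous_subspaceT.
- by rewrite th0 th1 ge_min le_max (ltW t0) (ltW t1) /= orbT.
rewrite in_itv /= => /andP[sr rs'] thr.
have sr' : s < r by rewrite lt_def sr andbT; apply: contraTneq t0 => rs; rewrite -thr rs th0 ltxx.
have rs'' : r < s' by rewrite lt_def rs' andbT; apply: contraTneq t1 => rs; rewrite -thr -rs th1 ltxx.
have tau0 : tau != 0 by rewrite gt_eqF.
have tau1 : 1 - tau != 0 by rewrite gt_eqF // subr_gt0.
have thP t k : s <= t <= s' -> z k t = segment_point p q (th t) k by apply: zE.
apply: (reads_cat zc sr rs').
  apply: (h1 z s r (fun t => th t / tau)) => //.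
  - by cont.
  - move=> t u st tu ur; rewrite ltr_pM2r ?invr_gt0 //.
    by apply: mono => //; apply: le_trans ur rs'.
  - by rewrite th0 mul0r.
  - by rewrite thr divff.
  - move=> t k /andP[st tr]; rewrite thP ?st ?(le_trans tr) //.
    by rewrite -/(segment_point p (segment_point p q tau) _ k) segment_point_l divfK.
apply: (h2 z r s' (fun t => (th t - tau) / (1 - tau))) => //.
- by cont.
- move=> t u st tu ur; rewrite ltr_pM2r ?invr_gt0 ?subr_gt0 // ltrD2r.
  by apply: mono => //; apply: le_trans sr st.
- by rewrite thr subrr mul0r.
- by rewrite th1 divff.
- move=> t k /andP[rt ts']; rewrite thP ?ts' ?(le_trans sr) //.
  rewrite -/(segment_point (segment_point p q tau) q _ k) segment_point_r.
  by rewrite divfK // addrCA subrr addr0.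
Qed.

Definition segment_inj p q := forall tau, I01 tau -> injective (segment_point p q tau).

(** The moving point j0 passes k0 once and no other point. It plays the role of
    a in a half twist if it moves to the right, and that of b if it moves to the
    left. The other branch of the final case analysis is void: the rank of a is
    less than n - 1 because that of b is its successor. *)
Lemma segment_word_cross p q j0 k0 (tc tau : R) :
  (forall k, k != j0 -> q k = p k) -> injective (cRe \o p) -> segment_inj p q ->
  j0 != k0 -> 0 < tc < tau -> tau < 1 ->
  cRe (p k0) = cRe (p j0) + tc * (cRe (q j0) - cRe (p j0)) ->
  (forall k u, k != j0 -> 0 <= u <= tau ->
     cRe (p k) = cRe (p j0) + u * (cRe (q j0) - cRe (p j0)) -> k = k0) ->
  exists w, segment_word p (segment_point p q tau) w.
Proof.
move=> fixed pi pqi jk /andP[tc0 tct] tau1 hk0 only.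
pose d := cRe (q j0) - cRe (p j0).
have kj : k0 != j0 by rewrite eq_sym.
have d0 : d != 0.
  apply: contra jk => /eqP d0; apply/eqP/pi => /=.
  by rewrite hk0 -/d d0 mulr0 addr0.
have tau0 : 0 < tau by apply: lt_trans tct.
pose a := if 0 < d then j0 else k0; pose b := if 0 < d then k0 else j0.
have ab : a != b by rewrite /a /b; case: ifP.
pose e := cIm (segment_point p q tc a) < cIm (segment_point p q tc b).
have Re_j0 u : cRe (segment_point p q u j0) = cRe (p j0) + u * d.
  by rewrite cReD cReZ cReD cReN.
have pt_k u k : k != j0 -> segment_point p q u k = p k.
  by move=> kj0; rewrite /segment_point fixed // subrr mulr0 addr0.
have key z (s s' : R) (th : R -> R) : re_cont z -> s < s' -> continuous th ->
    (forall t u, s <= t -> t < u -> u <= s' -> th t < th u) ->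
    th s = 0 -> th s' = 1 ->
    (forall t k, s <= t <= s' -> z k t = segment_point p q (th t * tau) k) ->
    (rank_in p a).+1 = rank_in p b /\ exists2 r, s < r < s' &
      half_twist z s r (rank_in p a) e /\
      forall t, r <= t <= s' -> distinct_real_parts z t.
  move=> zc ss' thc mono th0 th1 zE.
  have [||c] := @IVT R th s s' (tc / tau) (ltW ss').
  - exact: continuous_subspaceT.
  - have q0 : 0 <= tc / tau by rewrite divr_ge0 // ltW.
    have q1 : tc / tau <= 1 by rewrite ler_pdivrMr // mul1r ltW.
    by rewrite th0 th1 ge_min le_max q0 q1 /= orbT.
  rewrite in_itv /= => /andP[sc cs'] thc0.
  have thcE : th c * tau = tc by rewrite thc0 divfK // gt_eqF.
  have sc' : s < c.
    rewrite lt_def sc andbT; apply: contraTneq tc0 => cs.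
    by rewrite -thcE cs th0 mul0r ltxx.
  have cs'' : c < s'.
    rewrite lt_def cs' andbT; apply: contraTneq tct => cs.
    by rewrite -thcE -cs th1 mul1r ltxx.
  have hs : s <= s <= s' by rewrite lexx ltW.
  have hs' : s <= s' <= s' by rewrite lexx ltW.
  have hc : s <= c <= s' by rewrite sc.
  have zs : z^~ s = p.
    by apply/funext => k; rewrite zE // th0 mul0r segment_point0.
  have zc' : z^~ c = segment_point p q tc.
    by apply/funext => k; rewrite zE // thcE.
  have zcE k : z k c = segment_point p q tc k by rewrite zE // thcE.
  have Rj t : s <= t <= s' -> cRe (z j0 t) = cRe (p j0) + th t * tau * d.
    by move=> ht; rewrite zE // Re_j0.
  have Rk t k : k != j0 -> s <= t <= s' -> cRe (z k t) = cRe (p k).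
    by move=> kj0 ht; rewrite zE // pt_k.
  have thinj t : s <= t <= s' -> th t * tau = tc -> t = c.
    move=> /andP[st ts'] E; have {}E : th t = th c.
      by apply: (mulIf (_ : tau != 0)); rewrite ?gt_eqF // E thcE.
    apply/eqP; apply: contraT; rewrite neq_lt => /orP[] h.
      by have := mono _ _ st h cs'; rewrite E ltxx.
    by have := mono _ _ sc h ts'; rewrite E ltxx.
  have cross t k : s <= t <= s' -> k != j0 -> cRe (z k t) = cRe (z j0 t) ->
      k = k0 /\ t = c.
    move=> ht kj0; rewrite (Rk t k kj0 ht) (Rj t ht) => hk.
    have tr := th_range mono th0 th1 ht.
    have kk0 : k = k0 by apply: (only k (th t * tau)) => //; nra.
    split => //; apply: thinj => //; move: hk; rewrite kk0 hk0 => /addrI.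
    by move/(mulIf d0).
  have same t j k : s <= t <= s' -> cRe (z j t) = cRe (z k t) ->
      j = k \/ t = c /\ (j, k) \in [:: (a, b); (b, a)].
    move=> ht jkE; have [jj0|jj0] := eqVneq j j0.
      have [->|kj0] := eqVneq k j0; first by left.
      right; have [|-> ->] := cross t k ht kj0; first by rewrite -jkE jj0.
      split => //; rewrite jj0 /a /b; case: ifP => _; by rewrite !inE eqxx ?orbT.
    have [kj0|kj0] := eqVneq k j0.
      right; have [|-> ->] := cross t j ht jj0; first by rewrite jkE kj0.
      split => //; rewrite kj0 /a /b; case: ifP => _; by rewrite !inE eqxx ?orbT.
    by left; apply: pi; move: jkE; rewrite !Rk.
  pose r := (c + s') / 2.
  have cr : c < r by rewrite /r; lra.
  have rs' : r < s' by rewrite /r; lra.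
  have hr : s <= r <= s' by lra.
  have thr : tc < th r * tau.
    by rewrite -thcE ltr_pM2r // mono // ltW.
  have Rk0 t : s <= t <= s' -> cRe (z k0 t) = cRe (p j0) + tc * d.
    by move=> ht; rewrite Rk.
  have dsgn : ~~ (0 < d) -> d < 0 by move=> h; rewrite lt_neqAle d0 leNgt.
  have [||||||h1 h2] := @half_twistI z s r c a b zc _ ab.
  - by rewrite sc'.
  - by move=> t j k /andP[st tr]; apply: same; rewrite st (le_trans tr) // ltW.
  - by rewrite /a /b; case: ifP => _; rewrite (Rj _ hc) (Rk0 _ hc) thcE.
  - rewrite /a /b; case: ifPn => [dp|/dsgn dn]; rewrite (Rj _ hs) (Rk0 _ hs) th0; nra.
  - rewrite /a /b; case: ifPn => [dp|/dsgn dn]; rewrite (Rj _ hr) (Rk0 _ hr); nra.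
  - rewrite !zcE => /pqi E; have := ab; rewrite E ?eqxx //.
    by rewrite ltW //= ltW // (lt_trans tct).
  rewrite zs in h1 h2; split => //; exists r; first by lra.
  split; first by rewrite /e -!zcE.
  move=> t /andP[rt ts'] j k jkE; have st : s <= t by apply: le_trans rt; lra.
  have [||[tc' _]] := same t j k _ jkE => //; first by rewrite st.
  by move: rt; rewrite tc' leNgt cr.
have [ra|ra] := ltnP (rank_in p a) n.-1.
  exists [:: (Ordinal ra, e)] => z s s' th zc ss' thc mono th0 th1 zE /=.
  have [|_ [r hr [h1 h2]]] := key z s s' th zc ss' thc mono th0 th1.
    by move=> t k ht; rewrite zE // -/(segment_point p (segment_point p q tau) _ k) segment_point_l.
  by exists r.
exists [::] => z s s' th zc ss' thc mono th0 th1 zE /=.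
have [|h _] := key z s s' th zc ss' thc mono th0 th1.
  by move=> t k ht; rewrite zE // -/(segment_point p (segment_point p q tau) _ k) segment_point_l.
have : (rank_in p b < n)%N.
  rewrite -[X in (_ < X)%N]card_ord; apply: proper_card; apply/properP; split.
    by apply/fintype.subsetP.
  by exists b; rewrite // !inE ltxx.
by rewrite -h; move: ra; clear; lia.
Qed.

(** Induction on the number of points to be passed, cutting the segment just
    after the first of them. *)
Lemma segment_word_single p q j0 : (forall k, k != j0 -> q k = p k) ->
  injective (cRe \o p) -> injective (cRe \o q) -> segment_inj p q ->
  exists w, segment_word p q w.
Proof.
have [N] := ubnP #|[pred k | (cRe (p j0) < cRe (p k) < cRe (q j0)) ||
  (cRe (q j0) < cRe (p k) < cRe (p j0))]|.
elim: N p => // N IH p cN fixed pi qi pqi.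
pose d := cRe (q j0) - cRe (p j0).
(* the parameter at which j0 meets the real part of k *)
pose T k := (cRe (p k) - cRe (p j0)) / d.
pose btw p' := [pred k | (cRe (p' j0) < cRe (p' k) < cRe (q j0)) ||
  (cRe (q j0) < cRe (p' k) < cRe (p' j0))].
have btwE k : k \in btw p -> d != 0 /\ 0 < T k < 1.
  rewrite !inE => /orP[] /andP[h1 h2].
    have d0 : 0 < d by rewrite /d; lra.
    split; first by rewrite gt_eqF.
    rewrite /T ltr_pdivrMr // mul1r; apply/andP; split; last by rewrite /d; lra.
    by apply: divr_gt0 => //; lra.
  have d0 : d < 0 by rewrite /d; lra.
  split; first by rewrite lt_eqF.
  rewrite /T ltr_ndivrMr // mul1r; apply/andP; split; last by rewrite /d; lra.
  by rewrite ltr_ndivlMr // mul0r; lra.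
have [/pred0P none|some] := boolP (pred0b (btw p)).
  exists [::]; apply: segment_word_same => // j k jk.
  have h i : i != j0 -> (cRe (p j0) < cRe (p i)) = (cRe (q j0) < cRe (q i)).
    move=> ij; rewrite (fixed i ij); have := none i; rewrite !inE => /negbT.
    have n1 : cRe (p i) != cRe (p j0) by apply/eqP => /pi E; move: ij; rewrite E eqxx.
    have n2 : cRe (p i) != cRe (q j0).
      apply/eqP => E; have /qi E' : cRe (q i) = cRe (q j0) by rewrite (fixed i ij).
      by move: ij; rewrite E' eqxx.
    by case: (ltgtP (cRe (p j0)) (cRe (p i))) n1;
       case: (ltgtP (cRe (q j0)) (cRe (p i))) n2; rewrite ?eqxx.
  have [jj|jj] := eqVneq j j0; have [kk|kk] := eqVneq k j0.
  - by move: jk; rewrite jj kk ltxx.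
  - by rewrite jj -h // -jj.
  - have n2 : cRe (q j) != cRe (q j0) by apply/eqP => /qi E; move: jj; rewrite E eqxx.
    rewrite kk lt_neqAle n2 leNgt -h // -leNgt ltW // -kk.
    by [].
  - by rewrite !fixed.
have [k0 k0b kmin] : exists2 k0, k0 \in btw p & forall k, k \in btw p -> T k0 <= T k.
  move/pred0Pn: some => [k1 hk1].
  by case: (@arg_minP _ R 'I_n k1 (btw p) T hk1) => k0 h1 h2; exists k0.
have [d0 /andP[Tp T1]] := btwE k0 k0b.
have [eps eps0 heps] : exists2 eps : R, 0 < eps & forall k, T k0 < T k -> T k0 + eps < T k.
  apply: (@fin_eps R 'I_n (fun eps k => T k0 < T k -> T k0 + eps < T k)).
    by move=> e e' k /andP[_ e'e] h /h; apply: le_lt_trans; rewrite lerD2l.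
  move=> k; have [kT|kT] := ltP (T k0) (T k); last by exists 1 => //; rewrite ltNge kT.
  by exists ((T k - T k0) / 2) => [|_]; lra.
pose tau := T k0 + Num.min eps ((1 - T k0) / 2).
have m0 : 0 < Num.min eps ((1 - T k0) / 2) by rewrite lt_min eps0; lra.
have me : Num.min eps ((1 - T k0) / 2) <= eps by rewrite ge_min lexx.
have m1 : Num.min eps ((1 - T k0) / 2) <= (1 - T k0) / 2 by rewrite ge_min lexx orbT.
have tau1 : tau < 1 by rewrite /tau; lra.
have kT : T k0 < tau by rewrite /tau; lra.
have k0j : k0 != j0.
  by apply: contraTneq Tp => ->; rewrite /T subrr mul0r ltxx.
have TE k : cRe (p k) = cRe (p j0) + T k * d by rewrite /T divfK // addrC subrK.
have gap k : T k0 < T k -> tau < T k by move=> /heps; rewrite /tau; lra.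
have only k u : k != j0 -> 0 <= u <= tau -> cRe (p k) = cRe (p j0) + u * d -> k = k0.
  move=> kj /andP[u0 ut]; rewrite [LHS]TE => /addrI /(mulIf d0) uT.
  have up : 0 < T k.
    rewrite lt_def uT u0 andbT -uT; apply: contra kj => /eqP T0; apply/eqP/pi.
    by rewrite /= TE T0 mul0r addr0.
  have kb : k \in btw p.
    rewrite !inE (TE k); have qE : cRe (q j0) = cRe (p j0) + d by rewrite addrC subrK.
    have Tk1 : T k < 1 by lra.
    rewrite qE; case: (ltgtP d 0) d0 => // dd _; apply/orP; [right|left].
      have x1 : 0 < (1 - T k) * - d by apply: mulr_gt0; lra.
      have x2 : 0 < T k * - d by apply: mulr_gt0; lra.
      by apply/andP; split; lra.
    have x1 : 0 < (1 - T k) * d by apply: mulr_gt0; lra.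
    have x2 : 0 < T k * d by apply: mulr_gt0; lra.
    by apply/andP; split; lra.
  have := kmin k kb; rewrite le_eqVlt => /orP[/eqP E|/gap g]; last by exfalso; lra.
  by apply: pi; rewrite /= (TE k) (TE k0) E.
have [w1 hw1] : exists w, segment_word p (segment_point p q tau) w.
  by apply: (segment_word_cross fixed pi pqi _ _ tau1 (TE k0) only); rewrite ?Tp // eq_sym.
pose p' := segment_point p q tau.
have p'k k : k != j0 -> p' k = p k.
  by move=> kj; rewrite /p' /segment_point fixed // subrr mulr0 addr0.
have p'j : cRe (p' j0) = cRe (p j0) + tau * d.
  by rewrite cReD cReZ cReD cReN.
have p'j_ne k : k != j0 -> cRe (p k) <> cRe (p' j0).
  move=> kj; rewrite p'j => E; have tau01 : 0 <= tau <= tau by lra.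
  have kk := only k tau kj tau01 E; move: E; rewrite TE => /addrI /(mulIf d0).
  by rewrite kk => E; move: kT; rewrite E ltxx.
have [|||||w2 hw2] := IH p'.
- rewrite -ltnS; apply: leq_trans cN; apply: proper_card; apply/properP; split.
    apply/fintype.subsetP => k; rewrite !inE.
    have [->|kj] := eqVneq k j0; first by rewrite ltxx /= ltxx andbF.
    rewrite (p'k k kj) p'j; have qE : cRe (q j0) = cRe (p j0) + d by rewrite addrC subrK.
    rewrite qE; case: (ltgtP d 0) d0 => // dd _.
      have x1 : 0 < (1 - tau) * - d by apply: mulr_gt0; lra.
      have x2 : 0 < tau * - d by apply: mulr_gt0; lra.
      move=> /orP[] /andP[h1 h2]; first by exfalso; lra.
      by apply/orP; right; apply/andP; split; lra.
    have x1 : 0 < (1 - tau) * d by apply: mulr_gt0; lra.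
    have x2 : 0 < tau * d by apply: mulr_gt0; lra.
    move=> /orP[] /andP[h1 h2]; last by exfalso; lra.
    by apply/orP; left; apply/andP; split; lra.
  exists k0 => //; rewrite !inE (p'k k0 k0j) p'j (TE k0).
  have qE : cRe (q j0) = cRe (p j0) + d by rewrite addrC subrK.
  rewrite qE; apply/negP; case: (ltgtP d 0) d0 => // dd _.
    have x1 : 0 < (tau - T k0) * - d by apply: mulr_gt0; lra.
    have x2 : 0 < (1 - tau) * - d by apply: mulr_gt0; lra.
    by move=> /orP[] /andP[h1 h2]; exfalso; lra.
  have x1 : 0 < (tau - T k0) * d by apply: mulr_gt0; lra.
  have x2 : 0 < (1 - tau) * d by apply: mulr_gt0; lra.
  by move=> /orP[] /andP[h1 h2]; exfalso; lra.
- by move=> k kj; rewrite p'k // fixed.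
- move=> j k /=; have [->|jj] := eqVneq j j0; have [->|kk] := eqVneq k j0 => //.
  + by rewrite (p'k k) // => /esym/(p'j_ne k kk).
  + by rewrite (p'k j) // => /(p'j_ne j jj).
  + by rewrite !p'k // => /pi.
- by [].
- move=> u u01; rewrite segment_point_r; apply: pqi; nra.
exists (w1 ++ w2); apply: (segment_word_cat (tau := tau)) => //.
by rewrite tau1 (lt_trans Tp).
Qed.
End Reading.

(** * From paths to geometric braids *)

Section Geometric.
Variables (R : realType) (n : nat).
Local Notation C := R[i].
Local Notation cRe := (@complex.Re R).
Local Notation cIm := (@complex.Im R).
Local Notation tau := (2 * pi : R).
Implicit Types (z : geometric_braid R n) (v : nat -> 'I_n -> C).

Lemma tau_gt0 : 0 < tau. Proof. by rewrite mulr_gt0 // pi_gt0. Qed.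
Lemma tau_neq0 : tau != 0. Proof. by rewrite gt_eqF // tau_gt0. Qed.

Lemma unscale t : 0 <= t <= tau -> I01 (t / tau).
Proof.
move=> /andP[t0 t1]; rewrite divr_ge0 ?(ltW tau_gt0) //=.
by rewrite ler_pdivrMr ?tau_gt0 // mul1r.
Qed.

Lemma scale_in t : I01 t -> 0 <= tau * t <= tau.
Proof. by move=> t01; have := tau_gt0; nra. Qed.

Definition csmooth_on (f : R -> C) : Prop :=
  exists2 F, csmooth F & forall t, 0 <= t <= tau -> f t = F t.

Lemma csmooth_on_falg : falg csmooth_on.
Proof.
have fa := @csmooth_falg R; split.
- by move=> c; exists (fun=> c) => //; apply: (falg_cst fa).
- move=> f g [F sF fF] [G sG gG]; exists (fun t => F t + G t).
    exact: (falg_add fa).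
  by move=> t ht; rewrite fF ?gG.
- move=> f g [F sF fF] [G sG gG]; exists (fun t => F t * G t).
    exact: (falg_mul fa).
  by move=> t ht; rewrite fF ?gG.
Qed.

Lemma csmooth_onP (f : R -> C) : csmooth_on f <->
  smooth_on 0 tau (fun t => cRe (f t)) /\ smooth_on 0 tau (fun t => cIm (f t)).
Proof.
split.
  move=> [F [F1 F2] fF]; split.
    exists (fun t => cRe (F t)); split; [exact: F1|by move=> t ht; rewrite fF].
  exists (fun t => cIm (F t)); split; [exact: F2|by move=> t ht; rewrite fF].
move=> [[A [A1 A2]] [B [B1 B2]]]; exists (fun t => Complex (A t) (B t)).
  exact: (conj A1 B1).
by move=> t ht; apply: complex_ext => /=; [exact: A2|exact: B2].
Qed.

Lemma strand_csmooth z j : csmooth_on (z j).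
Proof. exact/csmooth_onP/strand_smooth. Qed.

Lemma csmooth_rescale (f : R -> C) : csmooth f -> csmooth (fun t => f (t / tau)).
Proof.
move=> [f1 f2].
have E (g : R -> R) : smooth g -> smooth (fun t => g (t / tau)).
  move=> sg; have := @smooth_affine R g tau^-1 0 sg.
  by rewrite (_ : (fun t => g (tau^-1 * t + 0)) = fun t => g (t / tau)) //;
    apply/funext => t; rewrite addr0 mulrC.
by split; [exact: (E _ f1)|exact: (E _ f2)].
Qed.

Lemma geometric_of (f : 'I_n -> R -> C) : (forall j, csmooth_on (f j)) ->
  (forall t, 0 <= t <= tau -> injective (f^~ t)) ->
  (forall i, exists j, f i 0 = f j tau) ->
  exists z, forall j t, z j t = f j t.
Proof.
move=> fs fi fc.
have h1 j : smooth_on 0 tau (fun t => cRe (f j t)) /\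
    smooth_on 0 tau (fun t => cIm (f j t)) by apply/csmooth_onP.
have h2 t : 0 <= t <= tau -> forall i j, i <> j -> f i t <> f j t.
  by move=> ht i j ij /(fi t ht).
by exists (GeometricBraid h1 h2 fc).
Qed.

(** The time is clamped because the strands of a braid are arbitrary outside [0,
    2 pi], whereas paths are to be continuous on the whole line. *)
Definition braid_path z : R -> 'I_n -> C := fun t j => z j (tau * clamp 0 1 t).

Lemma braid_pathE z t j : I01 t -> braid_path z t j = z j (tau * t).
Proof. by move=> t01; rewrite /braid_path clamp_id. Qed.

Lemma braid_path_cpath z : cpath (braid_path z).
Proof.
move=> j; have [F sF zF] := strand_csmooth z j.
rewrite (_ : (braid_path z)^~ j = fun t => F (tau * clamp 0 1 t)).
  by apply: (cc_comp (f := F)) (csmooth_cc sF); cont.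
by apply/funext => t; rewrite /braid_path zF // scale_in // I01_clamp.
Qed.

Lemma braid_path_ipath z : ipath (braid_path z).
Proof.
move=> t t01 i j; rewrite !braid_pathE // => h.
apply/eqP; apply: contraT => /eqP ij.
by case: (strand_disjoint (scale_in t01) ij h).
Qed.

Lemma interp_cc N (X : topologicalType) (K : X * R -> 'I_n -> C) (f : X -> R) j :
  (forall j, cc (K^~ j)) -> continuous f ->
  cc (fun x : X => interp N (fun t => K (x, t)) (f x) j).
Proof.
move=> Kc fc; have fa := @cc_falg R X.
have pc (r : R) : cc (fun x : X => K (x, r) j).
  apply: (cc_comp (f := K^~ j)) (Kc j); apply: cont_pair; first exact: cont_id.
  exact: cst_continuous.
apply: (falg_add fa); first exact: pc.
apply: (falg_sum fa) => m; apply: (falg_mul fa); last by apply: falg_sub.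
apply: cc_real; rewrite /step.
have h : continuous (fun x : X => N%:R * f x - m%:R) by cont.
exact: (cont_comp h (@chi_cont R)).
Qed.

Lemma within_ext (X : topologicalType) (A : set X) (f g : X -> R) :
  continuous g -> (forall x, A x -> f x = g x) -> {within A, continuous f}.
Proof.
move=> gc fg; have h : {within A, continuous g} := continuous_subspaceT gc.
by apply: subspace_eq_continuous h => x xA; apply/esym/fg; move: xA; rewrite inE.
Qed.

(** At each stage of the homotopy the strands are interpolated smoothly in time.
    The interpolations of the two given braids differ from these braids, so
    their errors are added with weights 1 - s and s; all terms being small, the
    strands stay disjoint. *)
Lemma hom_isotopic z z' : homotopic (braid_path z) (braid_path z') ->
  braid_isotopic z z'.
Proof.
move=> [K [Kc Ki K0 K1 Ke]].
have [[s t] [/= hs ht]|e e0 he] := path_sep (@compact_square R) Kc.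
  by apply: Ki; move: hs ht; rewrite /= !in_itv.
have e8 : 0 < e / 8 by rewrite divr_gt0.
have [N N0 hN] := mesh Kc e8.
pose I s t j := interp N (fun t => K (s, t)) t j.
have IK s t j : I01 s -> I01 t -> nrm (I s t j - K (s, t) j) <= e / 8.
  move=> s01 t01; apply: (interp_near (f := fun t => K (s, t))) => // t' t'01 tt'.
  exact/ltW/hN.
have I0 s j : I01 s -> I s 0 j = z j 0.
  move=> s01; rewrite /I interp0 // (Ke s s01).1 braid_pathE ?I01_0 //.
  by rewrite mulr0.
have I1 s j : I01 s -> I s 1 j = z j tau.
  move=> s01; rewrite /I interp1 // (Ke s s01).2 braid_pathE ?I01_1 //.
  by rewrite mulr1.
have zK t j : 0 <= t <= tau -> z j t = K (0, t / tau) j.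
  by move=> /unscale t01; rewrite K0 // braid_pathE // mulrC divfK // tau_neq0.
have z'K t j : 0 <= t <= tau -> z' j t = K (1, t / tau) j.
  by move=> /unscale t01; rewrite K1 // braid_pathE // mulrC divfK // tau_neq0.
have [Ez0 Ez1] : (forall j, z' j 0 = z j 0) /\ forall j, z' j tau = z j tau.
  have t0 : 0 <= (0 : R) <= tau by rewrite lexx ltW // tau_gt0.
  have t1 : 0 <= tau <= tau by rewrite lexx ltW // tau_gt0.
  have [e1 e2] := Ke _ (I01_1 R).
  split=> j; first by rewrite z'K // mul0r e1 -K0 ?I01_0 // zK // mul0r.
  by rewrite z'K // divff ?tau_neq0 // e2 -K0 ?I01_1 // zK // divff ?tau_neq0.
pose F s j t := I s (t / tau) j + ((1 - s)%:C%C * (z j t - I 0 (t / tau) j) +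
  s%:C%C * (z' j t - I 1 (t / tau) j)).
have FK s t j : I01 s -> 0 <= t <= tau -> nrm (F s j t - K (s, t / tau) j) <= e / 4.
  move=> s01 ht; have t01 := unscale ht.
  have a1 := IK s (t / tau) j s01 t01.
  have a2 := IK 0 (t / tau) j (I01_0 R) t01.
  have a3 := IK 1 (t / tau) j (I01_1 R) t01.
  rewrite /F addrAC; apply: le_trans (nrmD _ _) _.
  have := @nrm_convex R 0 s (e / 8) (z j t - I 0 (t / tau) j) (z' j t - I 1 (t / tau) j) s01.
  rewrite !subr0 zK // z'K // (nrm_distC (K (0, _) j)) (nrm_distC (K (1, _) j)).
  by move=> /(_ a2 a3); lra.
have F0 s j : I01 s -> F s j 0 = z j 0.
  by move=> s01; rewrite /F mul0r !I0 ?I01_0 ?I01_1 // Ez0 subrr !mulr0 !addr0.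
have F1 s j : I01 s -> F s j tau = z j tau.
  by move=> s01; rewrite /F divff ?tau_neq0 // !I1 ?I01_0 ?I01_1 // Ez1 subrr !mulr0 !addr0.
have /choice[H hH] : forall s : R, exists h : geometric_braid R n,
    forall j t, h j t = F (clamp 0 1 s) j t.
  move=> s; have s01 := I01_clamp s; set u := clamp 0 1 s in s01 *.
  apply: geometric_of.
  - move=> j; have fa := csmooth_on_falg.
    have Is r : csmooth_on (fun t => I r (t / tau) j).
      exists (fun t => I r (t / tau) j) => //.
      by apply: (csmooth_rescale (f := fun t => I r t j)); apply: vpath_csmooth.
    apply: (falg_add fa) => //; apply: (falg_add fa); apply: (falg_mul fa);
      first [exact: (falg_cst fa)|apply: (falg_sub fa) => //; exact: strand_csmooth].
  - move=> t ht i j Fij; apply/eqP; apply: contraT => ij.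
    have sq : @unit_square R (u, t / tau).
      by split; rewrite /= in_itv //= unscale.
    have := he _ sq i j ij.
    have := nrm_trans (K (u, t / tau) i) (F u i t) (K (u, t / tau) j).
    have := FK u t i s01 ht; have := FK u t j s01 ht.
    by rewrite (nrm_distC (K (u, t / tau) i) (F u i t)) /= Fij; lra.
  - move=> i; have [j hj] := strand_closed z i; exists j.
    by rewrite F0 // F1.
exists H; split.
- move=> j; have [G sG zG] := strand_csmooth z j.
  have [G' sG' z'G'] := strand_csmooth z' j.
  pose g (st : R * R) := I (clamp 0 1 st.1) (st.2 / tau) j +
    ((1 - clamp 0 1 st.1)%:C%C * (G st.2 - I 0 (st.2 / tau) j) +
     (clamp 0 1 st.1)%:C%C * (G' st.2 - I 1 (st.2 / tau) j)).
  have fa := @cc_falg R (R * R)%type.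
  have gc : cc g.
    have tc : continuous (fun st : R * R => st.2 / tau) by cont.
    have Kc' (u : R * R -> R) : continuous u ->
        cc (fun st : R * R => I (u st) (st.2 / tau) j).
      move=> uc; apply: (@interp_cc N _ (fun x : (R * R) * R => K (u x.1, x.2))) => //.
      move=> j'; apply: (cc_comp (f := K^~ j')) (Kc j').
      have h1 : continuous (fun x : (R * R) * R => u x.1) by apply: (cont_comp (@cont_fst _ _)).
      by cont.
    apply: (falg_add fa); first by apply: Kc'; cont.
    apply: (falg_add fa); apply: (falg_mul fa).
    + by apply: cc_real; cont.
    + apply: falg_sub => //; last by apply: Kc'; cont.
      by apply: (cc_comp (f := G)) (csmooth_cc sG); cont.
    + by apply: cc_real; cont.
    + apply: falg_sub => //; last by apply: Kc'; cont.
      by apply: (cc_comp (f := G')) (csmooth_cc sG'); cont.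
  have E st : (`[0, 1] `*` `[0, tau]) st -> H st.1 j st.2 = g st.
    move=> [/= s01 t01]; move: t01; rewrite in_itv /= => t01.
    by rewrite hH /F zG // z'G'.
  split; [apply: (within_ext gc.1)|apply: (within_ext gc.2)] => st hst.
    by rewrite E.
  by rewrite E.
- move=> j t ht; rewrite hH clamp_id ?I01_0 // /F.
  by rewrite subr0 mul0r mul1r addr0 addrC subrK.
- move=> j t ht; rewrite hH clamp_id ?I01_1 // /F.
  by rewrite subrr mul0r mul1r add0r addrC subrK.
- by move=> s j s01; rewrite !hH clamp_id // F0 ?F1.
Qed.

(** ** Words of polygonal braids *)

Definition readable_segment (p q : 'I_n -> C) (w : artin_word n) : Prop :=
  segment_inj p q /\ segment_word p q w.

Lemma vpath_ipath N v : (0 < N)%N ->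
  (forall m, (m < N)%N -> segment_inj (v m) (v m.+1)) -> ipath (vpath N v).
Proof.
move=> N0 vi t t01; have [m mN ht] := vpath_seg_ex N0 t01.
rewrite (_ : vpath N v t = segment_point (v m) (v m.+1) (step N m t)).
  exact/vi/chi01.
by apply/funext => j; rewrite (vpath_seg _ _ mN ht).
Qed.

Lemma polygon_reads z N v (ws : nat -> artin_word n) : (0 < N)%N ->
  (forall j t, z j t = vpath N v (t / tau) j) ->
  (forall m, (m < N)%N -> segment_word (v m) (v m.+1) (ws m)) ->
  reads_word z 0 tau (flatten [seq ws m | m <- iota 0 N]).
Proof.
move=> N0 zE hw.
have NR : 0 < (N%:R : R) by rewrite ltr0n.
have zc : re_cont z.
  move=> j; rewrite (_ : (fun t => cRe (z j t)) = fun t => cRe (vpath N v (t / tau) j)).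
    by have [] := csmooth_cc (csmooth_rescale (vpath_csmooth N v j)).
  by apply/funext => t; rewrite zE.
(* the height of the vertex v m *)
pose T (m : nat) : R := tau * m%:R / N%:R.
have TS m : T m.+1 = T m + tau / N%:R.
  have E : (m.+1%:R : R) = m%:R + 1 by rewrite natr1.
  by rewrite /T E; ring.
have TN : T N = tau by rewrite /T mulfK // gt_eqF.
have tN : 0 < tau / N%:R by rewrite divr_gt0 // tau_gt0.
have T0 : T 0%N = 0 by rewrite /T mulr0 mul0r.
have Tge m : 0 <= T m.
  apply: divr_ge0; last exact: ltW.
  by apply: mulr_ge0 => //; exact/ltW/tau_gt0.
suff H : forall m, (m < N)%N ->
    reads_word z 0 (T m.+1) (flatten [seq ws k | k <- iota 0 m.+1]).
  by have := H N.-1; rewrite prednK // TN; apply; rewrite leqnn.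
have seg m : (m < N)%N -> reads_word z (T m) (T m.+1) (ws m).
  move=> mN; have arg t : N%:R * (t / tau) - m%:R = (t - T m) * (N%:R / tau).
    have key (a b x y : R) : a != 0 -> b != 0 ->
      b * (x / a) - y = (x - a * y / b) * (b / a) by move=> a0 b0; field; rewrite a0 b0.
    by apply: key; rewrite ?tau_neq0 ?gt_eqF.
  have Nt : 0 < N%:R / tau by rewrite divr_gt0 // tau_gt0.
  have len : (T m.+1 - T m) * (N%:R / tau) = 1.
    have key (a b x : R) : a != 0 -> b != 0 -> (x + a / b - x) * (b / a) = 1.
      by move=> a0 b0; field; rewrite a0 b0.
    by rewrite TS; apply: key; rewrite ?tau_neq0 ?gt_eqF.
  apply: (hw m mN z (T m) (T m.+1) (fun t => step N m (t / tau))) => //.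
  - by rewrite TS ltrDl.
  - have h : continuous (fun t : R => N%:R * (t / tau) - m%:R) by cont.
    exact: (cont_comp h (@chi_cont R)).
  - move=> t u tT tu uT; rewrite /step !arg; apply: chi_lt.
    + by apply: mulr_ge0; [lra|exact: ltW].
    + by rewrite ltr_pM2r //; lra.
    + apply: le_trans (_ : (T m.+1 - T m) * (N%:R / tau) <= 1); last by rewrite len.
      by rewrite ler_pM2r //; lra.
  - by rewrite /step arg subrr mul0r chi_le0.
  - by rewrite /step arg len chi_ge1.
  - move=> t k /andP[h1 h2]; rewrite zE; apply: vpath_seg => //.
    have a1 : 0 <= (t - T m) * (N%:R / tau) by apply: mulr_ge0; [lra|exact: ltW].
    have a2 : (t - T m) * (N%:R / tau) <= 1.
      apply: le_trans (_ : (T m.+1 - T m) * (N%:R / tau) <= 1); last by rewrite len.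
      by rewrite ler_pM2r //; lra.
    have E : (m.+1%:R : R) = m%:R + 1 by rewrite natr1.
    by move: a1 a2; rewrite -arg E; lra.
elim=> [|m IH] mN.
  by rewrite /= cats0 -T0; apply: seg.
rewrite -addn1 iotaD map_cat flatten_cat /= cats0 add0n addn1.
apply: (reads_cat zc (Tge _)); last exact: seg.
  by rewrite [T m.+2]TS lerDl ltW.
exact/IH/ltnW.
Qed.

Lemma represents_polygon z N v (ws : nat -> artin_word n) : (0 < N)%N ->
  homotopic (braid_path z) (vpath N v) ->
  (forall m, (m < N)%N -> readable_segment (v m) (v m.+1) (ws m)) ->
  represents z (flatten [seq ws m | m <- iota 0 N]).
Proof.
move=> N0 hz hw.
have [h0 h1] := hom_endpoints hz.
have vi : ipath (vpath N v) by apply: vpath_ipath => // m mN; have [] := hw m mN.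
have [||| z0 hz0] := @geometric_of (fun j t => vpath N v (t / tau) j).
- move=> j; exists (fun t => vpath N v (t / tau) j) => //.
  exact: (csmooth_rescale (vpath_csmooth N v j)).
- by move=> t /unscale t01; apply: vi.
- move=> i; have [j hj] := strand_closed z i; exists j.
  rewrite mul0r divff ?tau_neq0 // h0 h1 !braid_pathE ?I01_0 ?I01_1 //.
  by rewrite mulr0 mulr1.
exists z0; split.
  apply: hom_isotopic; apply: hom_ext hz => // t t01.
  by apply/funext => j; rewrite braid_pathE // hz0 mulrC mulKf // tau_neq0.
by apply: polygon_reads => // m mN; have [] := hw m mN.
Qed.

(** A generic polygon moves one point at a time between configurations with
    distinct real parts; each edge is cut at its crossings and read off. *)
Lemma polygon_of_braid (z : R -> 'I_n -> C) : cpath z -> ipath z ->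
  injective (cRe \o z 0) -> injective (cRe \o z 1) ->
  exists N v (ws : nat -> artin_word n), [/\ (0 < N)%N, v 0%N = z 0, v N = z 1,
    forall m, (m < N)%N -> readable_segment (v m) (v m.+1) (ws m) &
    homotopic z (vpath N v)].
Proof.
move=> zc zi z0 z1.
have [|e e0 he] := @path_sep R n R `[0, 1] z (@segment_compact _ _ _) zc.
  by move=> t; rewrite /= in_itv => /zi.
have e4 : 0 < e / 4 by rewrite divr_gt0.
pose Good (p : 'I_n -> C) := injective (cRe \o p).
have Good_upd p : Good p -> forall j, exists F : seq R,
    forall s, cRe s \notin F -> Good (upd p j s).
  move=> Gp j; exists [seq cRe (p k) | k <- enum 'I_n] => s sF k l.
  have nF i : cRe s <> cRe (p i).
    move=> E; move: sF; rewrite E => /negP; apply.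
    by apply/mapP; exists i; rewrite // mem_enum.
  rewrite /= /upd; case: eqVneq => [->|kj]; case: eqVneq => [->|lj] //.
  - by move=> /nF.
  - by move=> /esym/nF.
  - by move=> /Gp.
have [N [v [N0 v0 vN vG vS]]] := generic_polygon Good_upd zc z0 z1 e4.
have si m : (m < N)%N -> segment_inj (v m) (v m.+1).
  move=> mN u u01 i j uij; apply/eqP; apply: contraT => ij.
  have NR : 0 < (N%:R : R) by rewrite ltr0n.
  pose t : R := m%:R / N%:R.
  have tm : N%:R * t = m%:R by rewrite /t mulrC divfK // gt_eqF.
  have ht : m%:R <= N%:R * t <= m.+1%:R by rewrite tm lexx ler_nat leqnSn.
  have t01 : I01 t.
    by rewrite /t divr_ge0 ?(ltW NR) //= ler_pdivrMr // mul1r ler_nat ltnW.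
  have near k : nrm (segment_point (v m) (v m.+1) u k - z t k) <= e / 4.
    have [h1 h2] := (vS m mN).2 t ht k.
    have := nrm_convex u01 (ltW h1) (ltW h2).
    rewrite (_ : (1 - u)%:C%C * v m k + u%:C%C * v m.+1 k =
      segment_point (v m) (v m.+1) u k) // /segment_point rmorphB /=; ring.
  have := he t _ i j ij; rewrite /= in_itv /= => /(_ t01).
  have := nrm_trans (z t i) (segment_point (v m) (v m.+1) u i) (z t j).
  have := near i; have := near j; rewrite uij.
  by rewrite (nrm_distC (z t i) (segment_point _ _ _ _)); lra.
have /choice[ws hws] : forall m, exists w : artin_word n, (m < N)%N ->
    segment_word (v m) (v m.+1) w.
  move=> m; have [mN|mN] := ltnP m N; last by exists [::].
  have [[i hi] _] := vS m mN.
  have [ni|ni] := leqP n i.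
    exists [::] => _; have E : v m.+1 = v m.
      by apply/funext => k; apply: hi; rewrite neq_ltn (leq_trans (ltn_ord k) ni).
    by rewrite E; apply: segment_word_same => //; exact: (vG m (ltnW mN)).
  have [||||w hw] := @segment_word_single R n (v m) (v m.+1) (Ordinal ni).
  - by move=> k ki; apply: hi; apply: contra ki => /eqP h; apply/eqP/val_inj.
  - exact: (vG m (ltnW mN)).
  - exact: (vG m.+1 mN).
  - exact: si.
  - by exists w.
exists N, v, ws; split => //; first by move=> m mN; split; [exact: si|exact: hws].
apply: (@hom_disc R n z z (vpath N v) (e / 4)) => //.
- exact: vpath_cpath.
- by rewrite vpath0.
- by rewrite vpath1.
- move=> t t01 i j ij; have := he t _ i j ij.
  by rewrite /= in_itv /= => /(_ t01); lra.
- by move=> t t01 j; rewrite subrr nrm0 ltW.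
- move=> t t01 j; have [m mN ht] := vpath_seg_ex N0 t01.
  have [h1 h2] := (vS m mN).2 t ht j.
  by apply: (vpath_near (x := z t) mN ht); apply: ltW.
Qed.

End Geometric.

(** * Genericity of critical points *)

(** With one critical point at 1 and the others at 0, the critical value at 1 is
    - 1 / m: no critical value vanishes identically in c. *)
Lemma cval_delta (R : realType) m (k : 'I_m) :
  cval (fun l => (l == k)%:R : R[i]) k != 0.
Proof.
case: m k => [[]//|m'] k.
have rE : rpoly (fun l => (l == k)%:R : R[i]) = ('X^(m'.+1) : {poly R[i]}) - 'X^m'.
  rewrite /rpoly (bigD1 k) //= eqxx.
  rewrite (eq_bigr (fun=> 'X)) => [|l /negbTE ->]; last by rewrite subr0.
  rewrite prodr_const; have -> : #|[pred i : 'I_m'.+1 | i != k]| = m'.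
    have := cardC (pred1 k); rewrite card1 card_ord add1n => -[E].
    by rewrite -[RHS]E; apply: eq_card => l; rewrite !inE.
  by rewrite mulrBl -exprS mul1r.
rewrite /cval eqxx /cpoly hornerD hornerC add0r horner_sum.
rewrite (eq_bigr (fun i : 'I_m'.+2 => m'.+2%:R *
  (rpoly (fun l => (l == k)%:R : R[i]))`_i / i.+1%:R)); last first.
  by move=> i _; rewrite hornerZ hornerXn expr1n mulr1.
rewrite rE big_ord_recr big_ord_recr /= big1 => [|i _]; last first.
  rewrite coefB !coefXn (ltn_eqF (ltn_ord i)).
  by rewrite (ltn_eqF (leq_trans (ltn_ord i) (leqnSn _))) subrr mulr0 mul0r.
rewrite !coefB !coefXn !eqxx (ltn_eqF (ltnSn m')) (gtn_eqF (ltnSn m')) add0r subr0 sub0r.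
rewrite mulrN1 mulr1 divff ?natC_neq0 // mulNr addrC subr_eq0.
apply/negP => /eqP E; have := congr1 (fun z => z * m'.+1%:R) E.
rewrite mul1r divfK ?natC_neq0 // => /eqP.
by rewrite eqr_nat eqn_leq ltnn andbF.
Qed.

Section Generic.
Variables (R : realType) (m : nat).
Local Notation C := R[i].
Local Notation cRe := (@complex.Re R).
Implicit Types (c : 'I_m -> C).

Lemma cpoly_tube (X : topologicalType) (K : set X) (c : X -> 'I_m -> C)
    (a u : X -> C) (e : R) : compact K -> (forall k, cc (c^~ k)) -> cc a -> cc u ->
  0 < e -> exists2 d, 0 < d & forall t c' a', K t ->
    (forall k, nrm (c' k - c t k) <= d) -> nrm (a' - a t) <= d ->
    nrm ((cpoly c' a').[u t] - (cpoly (c t) (a t)).[u t]) < e.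
Proof.
move=> cK cc_c cc_a cc_u e0.
pose J := option (option 'I_m).
pose E (y : J -> C) := (cpoly (fun k => y (Some (Some k))) (y (Some None))).[y None].
pose x t (j : J) := match j with
  | None => u t | Some None => a t | Some (Some k) => c t k end.
have xc j : cc (x^~ j) by case: j => [[k|]|]; [exact: cc_c|exact: cc_a|exact: cc_u].
have lE : lipb E.
  have fa := @lipb_falg R J.
  by apply: (falg_cpoly_horner fa) => [k||]; apply: lipb_coord.
have [d d0 hd] := lipb_tube cK xc lE e0.
exists d => // t c' a' Kt hc ha.
apply: (hd t (fun j => match j with
  | None => u t | Some None => a' | Some (Some k) => c' k end) Kt).
case=> [[k|]|]; [exact: hc|exact: ha|].
by rewrite subrr nrm0 ltW.
Qed.

Lemma good_crit_tube (X : topologicalType) (K : set X) (c : X -> 'I_m -> C) :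
  compact K -> (forall k, cc (c^~ k)) -> (forall t, K t -> good_crit (c t)) ->
  exists2 d : R, 0 < d & forall t c', K t ->
    (forall k, nrm (c' k - c t k) <= d) -> good_crit c'.
Proof.
move=> cK cc_c gc.
have dc : cc (fun t => cdisc (c t)) by apply: falg_cdisc => //; exact: cc_falg.
have [t Kt|e e0 he] := cc_away0 cK dc; first exact/cdiscP/gc.
have lE : lipb (@cdisc R m).
  by apply: (falg_cdisc (@lipb_falg R _) (c := id)) => k; apply: lipb_coord.
have [d d0 hd] := lipb_tube cK cc_c lE e0.
exists d => // t c' Kt hc; apply/cdiscP; apply/negP => /eqP c0.
have := hd t c' Kt hc; rewrite c0 sub0r nrmN.
by have := he t Kt; lra.
Qed.

(** As a function of a single critical point, cdisc is a polynomial, and it is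
    not zero. *)
Lemma good_crit_upd c : good_crit c -> forall k, exists F : seq C,
  forall s, s \notin F -> good_crit (upd c k s).
Proof.
move=> gc k; have pf : polyfun id (fun s => cdisc (upd c k s)).
  apply: falg_cdisc; first exact: polyfun_falg.
  move=> l; rewrite /upd; case: (l == k); first exact: polyfun_id.
  exact: (falg_cst (@polyfun_falg R _ _)).
have [|F hF] := @polyfun_zeros R _ (c k) pf.
  rewrite (_ : upd c k (c k) = c); first exact/cdiscP.
  by apply/funext => l; rewrite /upd; case: eqVneq => [->|].
by exists F => s /hF /cdiscP.
Qed.

Definition good_root (p : 'I_m.+1 -> C) : Prop := injective p /\
  exists2 c : 'I_m -> C, injective c & (rpoly p)^`() = m.+1%:R *: rpoly c.

Lemma simple_crit (p : 'I_m.+1 -> C) :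
  (forall u, (rpoly p)^`().[u] = 0 -> (rpoly p)^`()^`().[u] != 0) ->
  exists2 c : 'I_m -> C, injective c & (rpoly p)^`() = m.+1%:R *: rpoly c.
Proof.
move=> h; have [c hc] := cpoly_exists (monic_rpoly p) (size_rpoly p).
have E : (rpoly p)^`() = m.+1%:R *: rpoly c by rewrite hc deriv_cpoly.
exists c => // k l kl; apply/eqP; apply: contraT => nkl.
have c0 : (rpoly p)^`().[c k] = 0.
  by rewrite E hornerZ (root_rpolyP c _).2 ?mulr0 //; exists k.
have := h _ c0; rewrite E derivZ hornerZ.
rewrite /rpoly (bigD1 k) //= (bigD1 l) ?(eq_sym l) //= !derivM !derivXsubC.
rewrite !hornerE -kl !subrr !mul0r !add0r !mulr0 ?mul0r.
by rewrite ?addr0 ?mulr0 eqxx.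
Qed.

(** Moving a root s of (X - s) h: a double critical point u is a root of
    h h'' - 2 h'^2, and it determines s. *)
Lemma good_root_upd p : good_root p -> forall j, exists F : seq C,
  forall s, s \notin F -> good_root (upd p j s).
Proof.
move=> [pi _] j; pose h : {poly C} := \prod_(i < m.+1 | i != j) ('X - (p i)%:P).
pose Q := h * h^`()^`() - 2%:R *: h^`() ^+ 2.
have hE s : rpoly (upd p j s) = ('X - s%:P) * h.
  rewrite /rpoly (bigD1 j) //= /upd eqxx; congr (_ * _).
  by apply: eq_bigr => i /negbTE ->.
have hroot i : i != j -> h.[p i] = 0.
  by move=> ij; rewrite /h (bigD1 i) //= !hornerE subrr mul0r.
have hsimple i : i != j -> h^`().[p i] != 0.
  move=> ij; rewrite /h (bigD1 i) //= derivM derivXsubC mul1r.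
  rewrite hornerD hornerM hornerXsubC subrr mul0r addr0 horner_prod.
  apply/prodf_neq0 => k /andP[_ ki]; rewrite hornerXsubC subr_eq0.
  by apply: contra ki => /eqP /pi ->.
have hrootE u : h.[u] = 0 -> exists2 i, i != j & u = p i.
  rewrite /h horner_prod => /eqP/prodf_eq0 [i ij].
  by rewrite hornerXsubC subr_eq0 => /eqP ->; exists i.
have h'nz u : h.[u] = 0 -> h^`().[u] != 0.
  by move=> /hrootE[i ij ->]; apply: hsimple.
have [rs hrs] := closed_field_poly_normal Q.
exists ([seq p i | i <- enum 'I_m.+1] ++ [seq u + h.[u] / h^`().[u] | u <- rs]) => s.
rewrite mem_cat negb_or => /andP[sp srs]; split.
  have nF i : s <> p i.
    move=> E; move: sp; rewrite E => /negP; apply.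
    by apply/mapP; exists i; rewrite // mem_enum.
  move=> k l; rewrite /upd; case: eqVneq => [->|kj]; case: eqVneq => [->|lj] //.
  - by move=> /nF.
  - by move=> /esym/nF.
  - by move=> /pi.
apply: simple_crit => u; rewrite hE.
have -> : (('X - s%:P) * h)^`() = h + ('X - s%:P) * h^`().
  by rewrite derivM derivXsubC mul1r.
have -> : (h + ('X - s%:P) * h^`())^`() = h^`() *+ 2 + ('X - s%:P) * h^`()^`().
  by rewrite derivD derivM derivXsubC mul1r addrA mulr2n.
rewrite !(hornerXsubC, hornerD, hornerM, hornerMn) => e1; apply/eqP => e2.
have h'u : h^`().[u] != 0.
  apply/eqP => h'0; move: e1; rewrite h'0 mulr0 addr0 => /h'nz.
  by rewrite h'0 eqxx.
have Q0 : Q.[u] = 0.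
  rewrite /Q !(horner_exp, hornerD, hornerN, hornerZ, hornerM).
  have e1' : h.[u] = - ((u - s) * h^`().[u]) by apply/eqP; rewrite -addr_eq0 e1.
  have e2' : (u - s) * h^`()^`().[u] = - (h^`().[u] *+ 2).
    by apply/eqP; rewrite -addr_eq0 addrC e2.
  rewrite e1' mulNr mulrAC e2' mulr_natl; ring.
have Qnz : Q != 0.
  have [jj|/existsPn noi] := boolP [exists i, i != j].
    have [i ij] := existsP jj; apply/eqP => Q00; move: (hsimple i ij).
    have := congr1 (fun q : {poly C} => q.[p i]) Q00.
    rewrite /Q !(horner_exp, hornerD, hornerN, hornerZ, hornerM) hroot // mul0r add0r horner0.
    by move/eqP; rewrite oppr_eq0 mulf_eq0 pnatr_eq0 /= expf_eq0 /= => /eqP ->; rewrite eqxx.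
  have h1 : h = 1 by rewrite /h big1 // => i ij; have := noi i; rewrite ij.
  by move: h'u; rewrite h1 -polyC1 derivC horner0 eqxx.
move: srs => /negP; apply; apply/mapP; exists u.
  rewrite -root_prod_XsubC -(rootZ _ _ (a := lead_coef Q)) ?lead_coef_eq0 // -hrs.
  by apply/eqP.
have -> : h.[u] = (s - u) * h^`().[u].
  by apply/eqP; rewrite -subr_eq0 -e1; apply/eqP; ring.
by rewrite mulfK // addrC subrK.
Qed.

(** Each of the conditions excludes the zeros of a function that is polynomial
    on real lines. Configurations with one point at 1 and the others at 0 show
    that none of these functions vanishes identically. *)
Lemma good_crit_dense c (e : R) : 0 < e -> exists c',
  [/\ forall k, nrm (c' k - c k) < e, good_crit c' & injective (cRe \o c')].
Proof.
move=> e0.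
pose J : finType := ('I_m * 'I_m * bool + 'I_m)%type.
pose E (j : J) c : C := match j with
  | inl (k, l, true) => if k == l then 1 else cval c k - cval c l
  | inl (k, l, false) => if k == l then 1 else (cRe (c k) - cRe (c l))%:C%C
  | inr k => cval c k end.
have lineE j x y : polyfun (fun r : R => r%:C%C)
    (fun r => E j (fun i => x i + r%:C%C * (y i - x i))).
  have fa := @polyfun_falg R R (fun r : R => r%:C%C).
  have Px k : polyfun (fun r : R => r%:C%C) (fun r => x k + r%:C%C * (y k - x k)).
    apply: (falg_add fa); first exact: (falg_cst fa).
    by apply: (falg_mul fa); [exact: polyfun_id|exact: (falg_cst fa)].
  have Pv k := @falg_cval R m R _ (fun r i => x i + r%:C%C * (y i - x i)) k fa Px.
  case: j => [[[k l] []]|k] /=.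
  - by case: eqP => _; [exact: (falg_cst fa)|exact: falg_sub].
  - case: eqP => _; first exact: (falg_cst fa).
    rewrite [X in polyfun _ X](_ : _ = fun r => (cRe (x k) - cRe (x l))%:C%C +
      r%:C%C * (cRe (y k) - cRe (x k) - (cRe (y l) - cRe (x l)))%:C%C).
      apply: (falg_add fa); first exact: (falg_cst fa).
      by apply: (falg_mul fa); [exact: polyfun_id|exact: (falg_cst fa)].
    apply/funext => r; rewrite !cReD !cReZ !cReD !cReN -rmorphM -rmorphD /=.
    by congr (_%:C%C); ring.
  - exact: Pv.
pose delta (k : 'I_m) : 'I_m -> C := fun l => (l == k)%:R.
have cval_ne k : cval (delta k) k != 0 by exact: cval_delta.
have cval_0 k l : l != k -> cval (delta k) l = 0.
  by move=> /negbTE lk; rewrite /cval /delta lk horner_coef0 cpoly0.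
have neE j : exists y, E j y != 0.
  case: j => [[[k l] []]|k]; last by exists (delta k); exact: cval_ne.
  - exists (delta k); rewrite /E; have [_|kl] := eqVneq k l; first by rewrite oner_neq0.
    by rewrite (cval_0 k l) ?subr0 // eq_sym.
  - exists (delta k); rewrite /E; have [_|kl] := eqVneq k l; first by rewrite oner_neq0.
    have lk : (l == k) = false by rewrite eq_sym; exact/negbTE.
    by rewrite /delta eqxx lk /= subr0 oner_neq0.
have [c' c'c hc'] := @common_nonzero R _ J (enum J) E lineE neE c e e0.
have {}hc' j : E j c' != 0 by apply: hc'; rewrite mem_enum.
exists c'; split => //.
  split; last by move=> k; exact: (hc' (inr k)).
  move=> k l kl; apply/eqP; apply: contraT => nkl.
  by have := hc' (inl (k, l, true)); rewrite /E (negbTE nkl) kl subrr eqxx.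
move=> k l /= kl; apply/eqP; apply: contraT => nkl.
by have := hc' (inl (k, l, false)); rewrite /E (negbTE nkl) kl subrr eqxx.
Qed.
End Generic.

Section Base.
Variable R : realType.
Local Notation C := R[i].
Local Notation cRe := (@complex.Re R).

(** Elements of equal rank are matched. *)
Lemma sort_alike m (x y : 'I_m -> R) : injective x -> injective y ->
  exists2 s : 'I_m -> 'I_m, injective s & forall j k, y j < y k -> x (s j) < x (s k).
Proof.
pose rk (w : 'I_m -> R) j := #|[pred k | w k < w j]|.
have rk_lt w j k : w j < w k -> (rk w j < rk w k)%N.
  move=> jk; apply: proper_card; apply/properP; split.
    by apply/fintype.subsetP => l; rewrite !inE => /lt_trans/(_ jk).
  by exists j; rewrite !inE ?jk ?ltxx.
have rk_ord w j : (rk w j < m)%N.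
  rewrite -[X in (_ < X)%N]card_ord; apply: proper_card; apply/properP; split.
    by apply/fintype.subsetP.
  by exists j; rewrite // !inE ltxx.
move=> xi yi.
pose f w j := Ordinal (rk_ord w j).
have fi w : injective w -> injective (f w).
  move=> wi j k /(congr1 val) /= E; apply: wi; apply/eqP.
  by apply: contraT; rewrite neq_lt => /orP[] /rk_lt; rewrite E ltnn.
have [g gK Kg] := injF_bij (fi x xi).
exists (g \o f y).
  by apply: inj_comp; [exact: can_inj Kg|exact: fi].
move=> j k /rk_lt jk /=; have K (i : 'I_m) : rk x (g i) = i := congr1 val (Kg i).
rewrite ltNge le_eqVlt; apply/negP => /orP[/eqP/xi E|/rk_lt h].
  by have := K (f y k); rewrite E K /= => E'; move: jk; rewrite E' ltnn.
by move: h; rewrite !K /= ltnNge (ltnW jk).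
Qed.

(** The critical points of prod (X - p_j) are perturbed into good ones with
    distinct real parts, keeping the constant term; the roots move so little
    that they keep their order. The labels of the critical points are then
    permuted to follow the order of q. *)
Lemma base_configuration m (p : 'I_m.+1 -> C) (q : 'I_m -> C) :
  injective (cRe \o p) -> injective (cRe \o q) ->
  exists (p1 : 'I_m.+1 -> C) (c1 : 'I_m -> C) a1,
  [/\ cpoly c1 a1 = rpoly p1, good_crit c1,
      forall j k, cRe (p j) < cRe (p k) -> cRe (p1 j) < cRe (p1 k),
      injective (cRe \o c1) &
      forall j k, cRe (q j) < cRe (q k) -> cRe (c1 j) < cRe (c1 k)].
Proof.
move=> pi qi.
have [c hc] := cpoly_exists (monic_rpoly p) (size_rpoly p).
set a := (rpoly p)`_0 in hc.
have pinj : injective p by move=> j k E; apply: pi; rewrite /= E.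
have [e e0 he] : exists2 e : R, 0 < e & forall i j, i != j -> e <= `|cRe (p i) - cRe (p j)|.
  have [|e e0 he] := @config_sep R _ (fun j => (cRe (p j))%:C%C).
    by move=> j k /complexI /pi.
  by exists e => // i j /he; rewrite -rmorphB nrmR.
have e2 : 0 < e / 2 by rewrite divr_gt0.
have [d d0 hd] : exists2 d : R, 0 < d & forall j c', (forall k, nrm (c' k - c k) <= d) ->
    nrm (cpoly c' a).[p j] < (e / 2) ^+ m.+1.
  apply: (@fin_eps R 'I_m.+1 (fun d j => forall c', (forall k, nrm (c' k - c k) <= d) ->
    nrm (cpoly c' a).[p j] < (e / 2) ^+ m.+1)).
    move=> d d' j /andP[_ dd] h c' hc'; apply: h => k.
    exact: le_trans (hc' k) dd.
  move=> j; have K1 : compact [set (0 : R)] by exact: compact_set1.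
  have cst_cc (b : C) : cc (fun _ : R => b) by exact: (falg_cst (@cc_falg R R)).
  have [d d0 hd] := cpoly_tube (c := fun=> c) K1 (fun k => cst_cc (c k)) (cst_cc a)
    (cst_cc (p j)) (exprn_gt0 m.+1 e2).
  exists d => // c' hc'; have := hd 0 c' a erefl hc'.
  rewrite subrr nrm0 -hc [(rpoly p).[p j]](_ : _ = 0) ?subr0; last first.
    by apply/root_rpolyP; exists j.
  by apply; apply: ltW.
have [c' [c'c gc' c're]] := good_crit_dense c d0.
have [||p1 hp1 p1p] := roots_near (x := p) e2 (monic_cpoly c' a) (size_cpoly c' a).
- move=> i j ij; rewrite mulrC divfK //; apply: le_trans (he i j ij) _.
  by rewrite -cReN -cReD nrm_Re.
- by move=> j; apply: hd => k; exact: ltW.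
have [s si hs] := sort_alike c're qi.
exists p1, (c' \o s), a; split.
- by rewrite cpoly_perm.
- exact: good_crit_perm.
- move=> j k jk; have kj : k != j by apply: contraTneq jk => ->; rewrite ltxx.
  have := he k j kj; rewrite ger0_norm ?subr_ge0; last exact: ltW.
  have := nrm_Re (p1 j - p j); have := nrm_Re (p1 k - p k).
  have := p1p j; have := p1p k; rewrite !cReD !cReN !ler_norml.
  by lra.
- by move=> j k /= /c're /si.
- exact: hs.
Qed.
End Base.

(** * Loops of polynomials with prescribed braids *)

Section Loops.
Variables (R : realType) (m : nat).
Local Notation C := R[i].
Local Notation croots := (R -> 'I_m.+1 -> C).
Local Notation ccrits := (R -> 'I_m -> C).
Local Notation cval0 := (R -> 'I_1 -> C).

(** The critical points, the constant term and the roots of a path of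
    polynomials. The constant term is a configuration of one point, so that it
    can be concatenated and reversed like the others. *)
Definition poly_path (c : ccrits) (a : cval0) (z : croots) : Prop :=
  [/\ cpath c, cpath a, cpath z & forall t, I01 t ->
    [/\ good_crit (c t), injective (z t) & cpoly (c t) (a t ord0) = rpoly (z t)]].

Lemma cpoly_rpoly (c c' : 'I_m -> C) a : rpoly c = rpoly c' -> cpoly c a = cpoly c' a.
Proof. by rewrite /cpoly => ->. Qed.

Lemma poly_path_cat c1 a1 z1 c2 a2 z2 : poly_path c1 a1 z1 -> poly_path c2 a2 z2 ->
  c1 1 = c2 0 -> a1 1 = a2 0 -> z1 1 = z2 0 ->
  poly_path (pcat c1 c2) (pcat a1 a2) (pcat z1 z2).
Proof.
move=> [c1c a1c z1c h1] [c2c a2c z2c h2] ec ea ez; split; try exact: cpath_cat.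
move=> t t01; have [t2|t2] := leP t (1 / 2).
  have ht : 0 <= t <= 1 / 2 by lra.
  by rewrite !(pcat_l _ _ ht); apply: h1; lra.
have ht : 1 / 2 <= t <= 1 by lra.
by rewrite (pcat_r ec ht) (pcat_r ea ht) (pcat_r ez ht); apply: h2; lra.
Qed.

Lemma poly_path_backward c a z : poly_path c a z -> poly_path (backward c) (backward a) (backward z).
Proof.
move=> [cc_ ac zc h]; split; try exact: cpath_backward.
by move=> t t01; apply: h; lra.
Qed.

Lemma cpath_clamp n (f : R -> 'I_n -> C) : cpath f -> cpath (fun t => f (clamp 0 1 t)).
Proof. by move=> fc j; apply: (cc_comp (f := f^~ j)) (fc j); exact: clamp_cont. Qed.

Lemma quarter_gt0 (e : R) : 0 < e -> 0 < e / 4. Proof. by move=> e0; rewrite divr_gt0. Qed.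

(** The roots are followed in disjoint discs around those of the given path,
    hence form a homotopic braid. They are defined and simple at all times of
    the real line because the parameters are clamped; smoothness of the roots is
    to be proved on the whole line. *)
Lemma nearby_roots (c : ccrits) (a : cval0) (z : croots) :
  cpath c -> cpath a -> cpath z -> ipath z ->
  (forall t, I01 t -> cpoly (c t) (a t ord0) = rpoly (z t)) ->
  exists2 d, 0 < d & forall (c' : ccrits) (a' : cval0), cpath c' -> cpath a' ->
    (forall t k, I01 t -> nrm (c' t k - c t k) <= d) ->
    (forall t, I01 t -> nrm (a' t ord0 - a t ord0) <= d) ->
    c' 0 = c 0 -> c' 1 = c 1 -> a' 0 = a 0 -> a' 1 = a 1 ->
    exists z', [/\ cpath z', z' 0 = z 0, z' 1 = z 1, homotopic z' z &
      forall t, injective (z' t) /\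
        cpoly (c' (clamp 0 1 t)) (a' (clamp 0 1 t) ord0) = rpoly (z' t)].
Proof.
move=> pc pa pz zi hz.
have K01 := @segment_compact R 0 1.
have in01 (t : R) : `[0, 1]%classic t -> I01 t by rewrite /= in_itv.
have to01 (t : R) : I01 t -> `[0, 1]%classic t by rewrite /= in_itv.
have [t /in01|e e0 he] := path_sep K01 pz; first exact: zi.
pose eps := e / 4; have eps0 : 0 < eps by rewrite divr_gt0.
have [d d0 hd] : exists2 d : R, 0 < d & forall j t c' a', I01 t ->
    (forall k, nrm (c' k - c t k) <= d) -> nrm (a' - a t ord0) <= d ->
    nrm (cpoly c' a').[z t j] < eps ^+ m.+1.
  apply: (@fin_eps R 'I_m.+1 (fun d j => forall t c' a', I01 t ->
    (forall k, nrm (c' k - c t k) <= d) -> nrm (a' - a t ord0) <= d ->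
    nrm (cpoly c' a').[z t j] < eps ^+ m.+1)).
    move=> d d' j /andP[_ dd] h t c' a' t01 h1 h2; apply: (h t) => //.
      by move=> k; apply: le_trans (h1 k) dd.
    exact: le_trans h2 dd.
  move=> j; have [d d0 hd] := cpoly_tube K01 pc (pa ord0) (pz j) (exprn_gt0 m.+1 eps0).
  exists d => // t c' a' t01 h1 h2; have := hd t c' a' (to01 t t01) h1 h2.
  rewrite hz // [(rpoly (z t)).[z t j]](_ : _ = 0) ?subr0 //.
  by apply/root_rpolyP; exists j.
exists d => // c' a' c'c a'c hc ha c0 c1 a0 a1.
have [|||||| y [yc yP yz]] := @track_roots R m.+1 R (fun t => z (clamp 0 1 t))
  (fun t => cpoly (c' (clamp 0 1 t)) (a' (clamp 0 1 t) ord0)) eps eps0.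
- exact: cpath_clamp.
- apply: (falg_cpoly (@cc_falg R R)) => [k|].
    exact: (cpath_clamp c'c).
  exact: (cpath_clamp a'c).
- by move=> t; apply: monic_cpoly.
- by move=> t; apply: size_cpoly.
- move=> t i j ij; have := he _ (to01 _ (I01_clamp t)) _ _ ij.
  by rewrite /eps; lra.
- move=> t j; apply: hd; first exact: I01_clamp.
    by move=> k; apply: hc; exact: I01_clamp.
  by apply: ha; exact: I01_clamp.
have sep t i j : i != j -> 2 * eps < nrm (z (clamp 0 1 t) i - z (clamp 0 1 t) j).
  by move=> ij; have := he _ (to01 _ (I01_clamp t)) _ _ ij; rewrite /eps; lra.
have yi t : injective (y t).
  move=> i j yij; apply/eqP; apply: contraT => /(sep t).
  have := nrm_trans (z (clamp 0 1 t) i) (y t i) (z (clamp 0 1 t) j).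
  have := yz t i; have := yz t j.
  by rewrite (nrm_distC (z (clamp 0 1 t) i) (y t i)) yij; lra.
have ends t : clamp 0 1 t = t -> c' t = c t -> a' t = a t -> I01 t -> y t = z t.
  move=> ct hct hat t01; apply: (@rpoly_disc_eq R m.+1 (z t) _ _ eps).
  - by move=> i j ij; have := sep t i j ij; rewrite ct => /ltW.
  - by move=> j; have := yz t j; rewrite ct.
  - by move=> j; rewrite subrr nrm0.
  - by rewrite -yP ct hct hat hz.
have y0 : y 0 = z 0 by apply: ends; rewrite ?I01_0 ?clamp_id ?I01_0.
have y1 : y 1 = z 1 by apply: ends; rewrite ?I01_1 ?clamp_id ?I01_1.
exists y; split => //.
apply: (@hom_disc R m.+1 z y z eps) => //.
+ by move=> t t01 i j ij; have := sep t i j ij; rewrite clamp_id.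
+ by move=> t t01 j; have := yz t j; rewrite clamp_id // => /ltW.
+ by move=> t t01 j; rewrite subrr nrm0 ltW.
Qed.

(** A first perturbation of the roots makes the critical points simple along the
    whole path, so that they can be followed. A second perturbation makes them
    good, and the roots of the perturbed polynomials are followed in turn. *)
Lemma realize_roots (Z : croots) (c0 : 'I_m -> C) (a0 : C) :
  cpath Z -> ipath Z -> rpoly (Z 1) = rpoly (Z 0) -> good_crit c0 ->
  cpoly c0 a0 = rpoly (Z 0) ->
  exists c a z, [/\ poly_path c a z, homotopic z Z,
    c 0 = c0, rpoly (c 1) = rpoly c0 & a 0 = (fun=> a0) /\ a 1 = (fun=> a0)].
Proof.
move=> Zc Zi Z01 gc0 hc0.
have K01 := @segment_compact R 0 1.
have in01 (t : R) : `[0, 1]%classic t -> I01 t by rewrite /= in_itv.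
have to01 (t : R) : I01 t -> `[0, 1]%classic t by rewrite /= in_itv.
have [t /in01|e e0 he] := path_sep K01 Zc; first exact: Zi.
have dE : (rpoly (Z 0))^`() = m.+1%:R *: rpoly c0 by rewrite -hc0 deriv_cpoly.
have g0 : good_root (Z 0).
  by split; [exact/Zi/I01_0|exists c0 => //; exact: good_crit_inj].
have g1 : good_root (Z 1).
  split; first exact/Zi/I01_1.
  by exists c0; [exact: good_crit_inj|rewrite Z01].
have [Z1 [Z1c Z10 Z11 hZ1]] := avoid_path (@good_root_upd R m) Zc g0 g1 (quarter_gt0 e0).
have Z1i : ipath Z1 by move=> t /hZ1[[]].
have Z1near t j : I01 t -> nrm (Z1 t j - Z t j) < e / 4 by move=> /hZ1[_]; apply.
have nC : m.+1%:R != 0 :> C := natC_neq0 R m.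
(* the critical points of the perturbed path are simple and can be followed *)
pose P t := m.+1%:R^-1 *: (rpoly (Z1 t))^`().
have coefc i : cc (fun t => (rpoly (Z1 t))`_i) by apply: (falg_rpoly (@cc_falg R R)).
have [|||c [cc_ c00 cP]] := @lift_roots R m P c0.
- move=> i; rewrite (_ : (fun _ => _) = fun t => m.+1%:R^-1 * i.+1%:R * (rpoly (Z1 t))`_i.+1).
    have fa := @cc_falg R R; apply: (falg_mul fa) => //.
    exact: (falg_cst fa).
  by apply/funext => t; rewrite /P coefZ coef_deriv -[_`_i.+1 *+ _]mulr_natl mulrA.
- move=> t /hZ1[[_ [x xi hx]] _]; exists x => //.
  by rewrite /P hx scalerA mulVf // scale1r.
- by rewrite /P Z10 dE scalerA mulVf // scale1r.
have cPE t : I01 t -> (rpoly (Z1 t))^`() = m.+1%:R *: rpoly (c t).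
  by move=> t01; rewrite -cP // /P scalerA divff // scale1r.
have c1E : rpoly (c 1) = rpoly c0.
  by rewrite -cP ?I01_1 // /P Z11 Z01 dE scalerA mulVf // scale1r.
have gc1 : good_crit (c 1).
  have [s si hs] := rpoly_relabel (good_crit_inj gc0) (esym c1E).
  have [s' ss' s's] := injF_bij si.
  rewrite (_ : c 1 = c0 \o s'); first exact/good_crit_perm/gc0/(can_inj s's).
  by apply/funext => k /=; rewrite hs s's.
pose a t (_ : 'I_1) := (rpoly (Z1 t))`_0.
have hca t : I01 t -> cpoly (c t) (a t ord0) = rpoly (Z1 t).
  by move=> t01; rewrite [RHS](cpoly_unique (cPE t t01)).
have ac : cpath a by move=> k; apply: coefc.
have [d d0 hd] := nearby_roots cc_ ac Z1c Z1i hca.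
have gc0' : good_crit (c 0) by rewrite c00.
have [c2 [c2c c20 c21 hc2]] := avoid_path (@good_crit_upd R m) cc_ gc0' gc1 d0.
have [||||||||z [zc z0 z1 zh hz]] := hd c2 a => //.
- by move=> t k t01; apply: ltW; apply: (hc2 t t01).2.
- by move=> t t01; rewrite subrr nrm0 ltW.
exists c2, a, z; split.
- split => // t t01; have [h1 h2] := hz t; rewrite clamp_id // in h2.
  by split => //; apply: (hc2 t t01).1.
- apply: (hom_trans zh); apply: (@hom_disc R m.+1 Z Z1 Z (e / 4)) => //.
  + by move=> t t01 i j ij; have := he t (to01 t t01) i j ij; lra.
  + by move=> t t01 j; apply/ltW/Z1near.
  + by move=> t t01 j; rewrite subrr nrm0 ltW // divr_gt0.
- by rewrite c20.
- by rewrite c21.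
- by split; apply/funext => k; rewrite /a ?Z10 ?Z11 ?Z01 -hc0 cpoly0.
Qed.

(** The constant term moves along a ray whose slope differs from that of all
    critical values, so that no critical value vanishes on the way. *)
Lemma ray_out (c0 : 'I_m -> C) (a0 : C) (z0 : 'I_m.+1 -> C) :
  good_crit c0 -> injective z0 -> cpoly c0 a0 = rpoly z0 ->
  exists2 d : C, d != 0 & forall L : R, 0 <= L ->
    exists z, poly_path (fun=> c0) (fun t _ => a0 + (t * L)%:C%C * d) z /\ z 0 = z0.
Proof.
move=> gc zi hz.
pose w k := (cpoly c0 a0).[c0 k].
have w0 k : w k != 0 by apply: cpoly_roots_neq0 zi hz.
have [|k hk] := @inj_avoid _ (fun k : nat => 1 / k.+1%:R : R)
  [seq complex.Im (w k) / complex.Re (w k) | k <- enum 'I_m].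
  exact/harm_inj/oner_neq0.
set eta := 1 / k.+1%:R in hk; pose d : C := Complex 1 eta.
have d0 : d != 0 by rewrite eq_complex /= negb_and oner_eq0.
have ray j (x : R) : w j + x%:C%C * d != 0.
  apply/eqP => E; move: hk => /negP; apply; apply/mapP; exists j; first by rewrite mem_enum.
  have := congr1 (@complex.Re R) E; have := congr1 (@complex.Im R) E.
  rewrite cReD cImD cReZ cImZ /= mulr1 => e1 e2.
  have x0 : complex.Re (w j) != 0.
    apply: contra (w0 j) => /eqP r0; have x0 : x = 0 by move: e2; rewrite r0 add0r.
    by apply/eqP/complex_ext => //=; move: e1; rewrite x0 mul0r addr0.
  have -> : complex.Im (w j) = eta * complex.Re (w j).
    have -> : complex.Re (w j) = - x by apply/eqP; rewrite -addr_eq0 e2.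
    by apply/eqP; rewrite mulrN mulrC -addr_eq0 e1.
  by rewrite mulfK.
exists d => // L L0.
pose a t (_ : 'I_1) : C := a0 + (t * L)%:C%C * d.
have ac : cpath a.
  move=> k'; have fa := @cc_falg R R; apply: (falg_add fa); first exact: (falg_cst fa).
  by apply: (falg_mul fa); [apply: cc_real; cont|exact: (falg_cst fa)].
have simple t : exists2 x : 'I_m.+1 -> C, injective x & cpoly c0 (a t ord0) = rpoly x.
  apply: cpoly_simple_roots => j; rewrite cpolyD /a addrA -cpolyD.
  exact: ray.
have [|||z [zc z00 zP]] := @lift_roots R m.+1 (fun t => cpoly c0 (a t ord0)) z0.
- move=> i; apply: (falg_cpoly (@cc_falg R R) (c := fun=> c0)) => [j|]; last exact: ac.
  exact: (falg_cst (@cc_falg R R)).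
- by move=> t _; apply: simple.
- by rewrite /a mul0r mul0r addr0.
exists z; split => //; split => //; first exact: cpath_cst.
move=> t t01; split => //; last exact: zP.
have [x xi hx] := simple t; apply: (rpoly_inj xi).
by rewrite -hx zP.
Qed.

(** When the constant term is large, the critical points can run along a given
    path almost without moving the roots, which stay close to those of X^(m + 1)
    + L d. Scaling the plane down turns a large constant term and bounded
    critical points into a bounded constant term and small critical points. *)
Lemma large_constant (c : ccrits) (a0 d : C) : cpath c ->
  (forall t, I01 t -> good_crit (c t)) -> rpoly (c 1) = rpoly (c 0) -> d != 0 ->
  exists2 L : R, 0 <= L & forall z0 : 'I_m.+1 -> C, injective z0 ->
    cpoly (c 0) (a0 + L%:C%C * d) = rpoly z0 ->
    exists z, [/\ poly_path c (fun _ _ => a0 + L%:C%C * d) z, z 0 = z0, z 1 = z0 &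
      homotopic z (fun=> z0)].
Proof.
move=> pc gc c01 d0.
have K01 := @segment_compact R 0 1.
have to01 (t : R) : I01 t -> `[0, 1]%classic t by rewrite /= in_itv.
pose o : 'I_m -> C := fun=> 0.
have [|rho rhoi hrho] := @cpoly_simple_roots R m o d.
  by move=> k; rewrite /o horner_coef0 cpoly0.
have [e e0 he] := config_sep rhoi.
pose eps := e / 4; have eps0 : 0 < eps by rewrite divr_gt0.
have [dl dl0 hdl] : exists2 dl : R, 0 < dl & forall j (c' : 'I_m -> C) (a' : C),
    (forall k, nrm (c' k) <= dl) -> nrm (a' - d) <= dl ->
    nrm (cpoly c' a').[rho j] < eps ^+ m.+1.
  apply: (@fin_eps R 'I_m.+1 (fun dl j => forall (c' : 'I_m -> C) (a' : C),
    (forall k, nrm (c' k) <= dl) -> nrm (a' - d) <= dl ->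
    nrm (cpoly c' a').[rho j] < eps ^+ m.+1)).
    move=> dl dl' j /andP[_ dd] h c' a' h1 h2; apply: h.
      by move=> k; apply: le_trans (h1 k) dd.
    exact: le_trans h2 dd.
  move=> j; have cst_cc (b : C) : cc (fun _ : R => b) by exact: (falg_cst (@cc_falg R R)).
  have [dl dl0 hdl] := cpoly_tube (c := fun=> o) K01 (fun k => cst_cc (o k)) (cst_cc d)
    (cst_cc (rho j)) (exprn_gt0 m.+1 eps0).
  exists dl => // c' a' h1 h2; have := hdl 0 c' a' (to01 0 (I01_0 R)).
  rewrite hrho [(rpoly rho).[rho j]](_ : _ = 0) ?subr0; last first.
    by apply/root_rpolyP; exists j.
  by apply => // k; rewrite /o subr0.
have [M M0 hM] : exists2 M : R, 0 < M & forall k (t : R), I01 t -> nrm (c t k) <= M^-1.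
  apply: (@fin_eps R 'I_m (fun M k => forall t : R, I01 t -> nrm (c t k) <= M^-1)).
    move=> M M' k /andP[M'0 M'M] h t /h /le_trans; apply.
    by rewrite lef_pV2 // posrE (lt_le_trans M'0).
  move=> k; have [M M0 hM] := cc_bounded K01 (pc k).
  by exists M^-1; rewrite ?invr_gt0 // => t /to01/hM; rewrite invrK.
pose l : R := 1 + M^-1 / dl + nrm a0 / dl.
have l1 : 1 <= l by rewrite /l -addrA lerDl addr_ge0 // divr_ge0 ?nrm_ge0 ?invr_ge0 // ltW.
have l0 : 0 < l by apply: lt_le_trans l1.
have dlE : dl * l = dl + M^-1 + nrm a0.
  have K x : dl * (x / dl) = x by rewrite mulrCA divff ?mulr1 // gt_eqF.
  by rewrite /l !mulrDr mulr1 !K.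
have lM : M^-1 <= dl * l.
  rewrite dlE.
  by have := nrm_ge0 a0; lra.
have la : nrm a0 <= dl * l.
  rewrite dlE.
  have Mi0 : 0 < M^-1 by rewrite invr_gt0.
  by lra.
have lC0 : l%:C%C != 0 :> C by rewrite eq_complex /= gt_eqF.
have nl : nrm (l%:C%C : C) = l by rewrite nrmR gtr0_norm.
exists (l ^+ m.+1); first by rewrite exprn_ge0 // ltW.
move=> z0 z0i hz0; set A := a0 + _ in hz0 *.
have AE : A = (l%:C%C) ^+ m.+1 * (a0 / (l%:C%C) ^+ m.+1 + d).
  by rewrite /A rmorphXn mulrDr mulrCA divff ?mulr1 // expf_neq0.
have small (c' : 'I_m -> C) j : (forall k, nrm (c' k) <= M^-1) ->
    nrm (cpoly c' A).[l%:C%C * rho j] < (l * eps) ^+ m.+1.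
  move=> hc'.
  have -> : cpoly c' A = cpoly (fun k => l%:C%C * (c' k / l%:C%C)) A.
    by apply: cpoly_eq => k; rewrite mulrCA divff ?mulr1.
  rewrite AE cpoly_scale nrmM nrmX nl exprMn ltr_pM2l ?exprn_gt0 //.
  apply: hdl => [k|].
    by rewrite nrmM nrmV nl ler_pdivrMr //; apply: le_trans (hc' k) lM.
  rewrite addrK nrmM nrmV nrmX nl ler_pdivrMr ?exprn_gt0 //.
  apply: le_trans la _; rewrite ler_pM2l //.
  by rewrite exprS ler_peMr ?exprn_ege1 // ltW.
have le0 : 0 < l * eps by rewrite mulr_gt0.
have sep i j : i != j -> 4 * (l * eps) <= nrm (l%:C%C * rho i - l%:C%C * rho j).
  move=> ij; rewrite -mulrBr nrmM nl mulrCA ler_pM2l //.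
  by have := he i j ij; rewrite /eps; lra.
have [|||||| y [yc yP yz]] := @track_roots R m.+1 R (fun _ j => l%:C%C * rho j)
  (fun t => cpoly (c (clamp 0 1 t)) A) (l * eps) le0.
- by move=> j; exact: (falg_cst (@cc_falg R R)).
- apply: (falg_cpoly (@cc_falg R R)) => [k|]; first exact: (cpath_clamp pc).
  exact: (falg_cst (@cc_falg R R)).
- by move=> t; apply: monic_cpoly.
- by move=> t; apply: size_cpoly.
- by move=> _ i j; exact: sep.
- by move=> t j; apply: small => k; apply: hM; exact: I01_clamp.
have y0E : rpoly (y 0) = rpoly z0 by rewrite -yP clamp_id ?I01_0 // -hz0.
have [s si hs] := rpoly_relabel z0i (esym y0E).
have yi t : injective (y t).
  move=> i j yij; apply/eqP; apply: contraT => /sep.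
  have := nrm_trans (l%:C%C * rho i) (y t i) (l%:C%C * rho j).
  have := yz t i; have := yz t j.
  by rewrite (nrm_distC (l%:C%C * rho i) (y t i)) yij; lra.
have y01 : y 1 = y 0.
  apply: (@rpoly_disc_eq R m.+1 (fun j => l%:C%C * rho j) _ _ (l * eps)) => //.
    by move=> i j /sep; lra.
  by rewrite -!yP !clamp_id ?I01_0 ?I01_1 //; apply: cpoly_rpoly.
pose z t j := y t (s j).
have z00 : z 0 = z0 by apply/funext => j; rewrite /z hs.
have zc : cpath z by move=> j; apply: yc.
exists z; split => //.
- split => //; first exact: cpath_cst.
  move=> t t01; split; first exact: gc.
    by move=> i j /yi/si.
  rewrite -[z t]/(y t \o s) rpoly_perm // -yP clamp_id //.
- by rewrite -z00; apply/funext => j; rewrite /z y01.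
- apply: (@hom_disc R m.+1 (fun _ j => l%:C%C * rho (s j)) z (fun=> z0) (l * eps)) => //.
  + exact: cpath_cst.
  + by rewrite -z00; apply/funext => j; rewrite /z y01.
  + move=> t t01 i j ij; have := sep (s i) (s j).
    rewrite (inj_eq si) => /(_ ij); lra.
  + by move=> t t01 j; apply/ltW/yz.
  + by move=> t t01 j; rewrite -z00; apply/ltW/yz.
Qed.

Lemma poly_path_const (c0 c1 : 'I_m -> C) a z : rpoly c0 = rpoly c1 -> good_crit c1 ->
  poly_path (fun=> c0) a z -> poly_path (fun=> c1) a z.
Proof.
move=> E gc1 [_ ac zc h]; split => //; first exact: cpath_cst.
move=> t t01; have [_ zi hz] := h t t01; split => //.
by rewrite -hz; apply/esym/cpoly_rpoly.
Qed.

(** A path realising Z by its roots has some path c1 of critical points. From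
    its end, the constant term is made large along a ray; then the critical
    points run back along c1 and forth along W, the roots being nearly at rest;
    finally the constant term returns along the ray. The roots cancel the way
    out and back and form Z, while the critical points form c1, its reverse and
    W. *)
Lemma realize_both (Z : croots) (W : ccrits) (a0 : C) :
  cpath Z -> ipath Z -> rpoly (Z 1) = rpoly (Z 0) ->
  cpath W -> ipath W -> rpoly (W 1) = rpoly (W 0) ->
  good_crit (W 0) -> cpoly (W 0) a0 = rpoly (Z 0) ->
  exists c a z, [/\ poly_path c a z, homotopic z Z, homotopic c W &
    rpoly (z 1) = rpoly (z 0) /\ a 1 = a 0].
Proof.
move=> Zc Zi Z01 Wc Wi W01 gW0 hW0.
have K01 := @segment_compact R 0 1.
have in01 (t : R) : `[0, 1]%classic t -> I01 t by rewrite /= in_itv.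
have to01 (t : R) : I01 t -> `[0, 1]%classic t by rewrite /= in_itv.
have good_of (c : 'I_m -> C) : rpoly c = rpoly (W 0) -> good_crit c.
  move=> cE; have [s si hs] := rpoly_relabel (good_crit_inj gW0) (esym cE).
  have [s' ss' s's] := injF_bij si.
  rewrite (_ : c = W 0 \o s'); first exact/good_crit_perm/gW0/(can_inj s's).
  by apply/funext => k /=; rewrite hs s's.
have [c1 [a1 [z1 [p1 hz1 c10 c11 [a10 a11]]]]] := realize_roots Zc Zi Z01 gW0 hW0.
have [c1c a1c z1c h1] := p1.
have gc11 : good_crit (c1 1) by apply: good_of.
have [_ z11i z11E] := h1 1 (I01_1 R).
(* the target braid of critical points, made generic *)
have [t /in01|e e0 he] := path_sep K01 Wc; first exact: Wi.
have [W2 [W2c W20 W21 hW2]] := avoid_path (@good_crit_upd R m) Wc gW0 (good_of _ W01)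
  (quarter_gt0 e0).
have hW : homotopic W2 W.
  apply: (@hom_disc R m W W2 W (e / 4)) => //.
  + by move=> t t01 i j ij; have := he t (to01 t t01) i j ij; lra.
  + by move=> t t01 j; apply/ltW/(hW2 t t01).2.
  + by move=> t t01 j; rewrite subrr nrm0 ltW // divr_gt0.
have c1i : ipath c1 by move=> t t01; apply: good_crit_inj; have [] := h1 t t01.
have W2i : ipath W2 by move=> t t01; apply: good_crit_inj; have [] := hW2 t t01.
pose c3 := pcat (backward c1) W2.
have e3 : backward c1 1 = W2 0 by rewrite /backward subrr c10 W20.
have c3c : cpath c3 by apply: cpath_cat => //; exact: cpath_backward.
have gc3 t : I01 t -> good_crit (c3 t).
  apply: (pcat_all (P := @good_crit R m)) => // u u01; last exact: (hW2 u u01).1.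
  have u01' : I01 (1 - u) by lra.
  by have [] := h1 _ u01'.
have c30 : c3 0 = c1 1 by rewrite /c3 pcat0 /backward subr0.
have c31 : c3 1 = W 1 by rewrite /c3 pcat1.
have c301 : rpoly (c3 1) = rpoly (c3 0) by rewrite c30 c31 c11 W01.
have z11E' : cpoly (c1 1) a0 = rpoly (z1 1) by rewrite -z11E a11.
have [d d0 ray] := ray_out gc11 z11i z11E'.
have [L L0 far] := large_constant a0 c3c gc3 c301 d0.
have [z2 [p2 z20]] := ray L L0.
have [_ a2c z2c h2] := p2.
have [_ z21i z21E] := h2 1 (I01_1 R).
have far1 : cpoly (c3 0) (a0 + L%:C%C * d) = rpoly (z2 1) by rewrite -z21E mul1r c30.
have [z3 [p3 z30 z31 hz3]] := far (z2 1) z21i far1.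
have [_ _ z3c h3] := p3.
have p4 : poly_path (fun=> c3 1) (backward (fun t _ => a0 + (t * L)%:C%C * d)) (backward z2).
  apply: (poly_path_backward (c := fun=> c3 1)).
  apply: (poly_path_const _ _ p2); first by rewrite -c30.
  exact/gc3/I01_1.
have z2i : ipath z2 by move=> t t01; have [] := h2 t t01.
have z1i : ipath z1 by move=> t t01; have [] := h1 t t01.
set a2 : cval0 := (fun t _ => a0 + (t * L)%:C%C * d) in p2 a2c h2 z21E p4.
pose a3 : cval0 := fun _ _ => a0 + L%:C%C * d.
have a20 : a2 0 = fun=> a0 by apply/funext => k; rewrite /a2 mul0r mul0r addr0.
have a21 : a2 1 = a3 1 by apply/funext => k; rewrite /a2 /a3 mul1r.
have b20 : backward a2 0 = a3 1 by rewrite /backward subr0 a21.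
have zb0 : backward z2 0 = z2 1 by rewrite /backward subr0.
have p34 := poly_path_cat p3 p4 erefl (esym b20) (etrans z31 (esym zb0)).
have p234 : poly_path (pcat (fun=> c1 1) (pcat c3 (fun=> c3 1)))
    (pcat a2 (pcat a3 (backward a2))) (pcat z2 (pcat z3 (backward z2))).
  by apply: poly_path_cat p2 p34 _ _ _; rewrite pcat0.
have p1234 : poly_path (pcat c1 (pcat (fun=> c1 1) (pcat c3 (fun=> c3 1))))
    (pcat a1 (pcat a2 (pcat a3 (backward a2)))) (pcat z1 (pcat z2 (pcat z3 (backward z2)))).
  by apply: poly_path_cat p1 p234 _ _ _; rewrite pcat0 ?a20.
have c3i : ipath c3 by move=> t t01; apply/good_crit_inj/gc3.
have zz : z3 1 = backward z2 0 by rewrite z31 zb0.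
have bz2c : cpath (backward z2) by exact: cpath_backward.
have bz2i : ipath (backward z2) by move=> t t01; apply: z2i; lra.
exists (pcat c1 (pcat (fun=> c1 1) (pcat c3 (fun=> c3 1)))),
  (pcat a1 (pcat a2 (pcat a3 (backward a2)))), (pcat z1 (pcat z2 (pcat z3 (backward z2)))).
split => //.
- apply: hom_trans hz1.
  apply: hom_trans (hom_cat_cst_r z1c z1i).
  apply: hom_cat; [by rewrite pcat0|exact: hom_refl|].
  rewrite -z20; apply: hom_trans (hom_cat_backward z2c z2i).
  apply: hom_cat; [by rewrite pcat0|exact: hom_refl|].
  apply: hom_trans (hom_cat_cst_l bz2c bz2i).
  by apply: hom_cat; rewrite ?zb0 //; exact: hom_refl.
- apply: hom_trans hW; apply: (@hom_trans _ _ _ (pcat c1 c3)).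
    apply: hom_cat; [by rewrite pcat0|exact: hom_refl|].
    apply: (@hom_trans _ _ _ (pcat (fun=> c1 1) c3)).
      apply: hom_cat; [by rewrite pcat0|apply: hom_refl|exact: hom_cat_cst_r].
        exact: cpath_cst.
      by move=> t t01; apply: c1i; rewrite I01_1.
    by rewrite -c30; exact: hom_cat_cst_l.
  by apply: hom_cancel => //; rewrite c10 W20.
- split.
    rewrite pcat0 !pcat1 ?pcat0 //.
    have z10E : rpoly (z1 0) = rpoly (Z 0) by have [-> _] := hom_endpoints hz1.
    rewrite z10E.
    by rewrite /backward subrr z20 -z11E' -hW0; apply: cpoly_rpoly.
  by rewrite pcat0 !pcat1 ?pcat0 ?a20 // /backward subrr a20 a10.
Qed.
End Loops.

(** * Smooth loops *)

Section Smoothing.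
Variables (R : realType) (m : nat).
Local Notation C := R[i].

Lemma interp_unif n (z : R -> 'I_n -> C) (e : R) : cpath z -> 0 < e ->
  exists2 N, (0 < N)%N & forall t j, I01 t -> nrm (interp N z t j - z t j) <= e.
Proof.
move=> zc e0.
have [|N N0 hN] := @mesh R n (fun x : R * R => z x.2) e _ e0.
  by move=> j; apply: (cc_comp (f := z^~ j)) (zc j); cont.
exists N => // t j t01; apply: interp_near => // t' _ tt'.
by apply/ltW/(hN j 0 t t' (I01_0 R)).
Qed.

(** Interpolating the critical points and the constant term makes them smooth
    without leaving the good configurations. The roots are simple roots of a
    smooth family of polynomials, hence smooth. *)
Lemma smooth_poly_path (c : R -> 'I_m -> C) a z : poly_path c a z ->
  exists (c' : R -> 'I_m -> C) (a' : R -> C) z', [/\ homotopic c' c, homotopic z' z,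
    [/\ forall k, csmooth (c'^~ k), csmooth a' & forall j, csmooth (z'^~ j)] &
    forall t : R, [/\ good_crit (c' t), injective (z' t) &
      cpoly (c' t) (a' t) = rpoly (z' t)]].
Proof.
move=> [cc_ ac zc h].
have K01 := @segment_compact R 0 1.
have in01 (t : R) : `[0, 1]%classic t -> I01 t by rewrite /= in_itv.
have to01 (t : R) : I01 t -> `[0, 1]%classic t by rewrite /= in_itv.
have zi : ipath z by move=> t /h[].
have ci : ipath c by move=> t /h[/good_crit_inj].
have hz t : I01 t -> cpoly (c t) (a t ord0) = rpoly (z t) by move=> /h[].
have [d1 d10 hd1] := nearby_roots cc_ ac zc zi hz.
have [t /in01/h[]//|d2 d20 hd2] := good_crit_tube K01 cc_.
have [t /in01/ci//|e e0 he] := path_sep K01 cc_.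
pose d := Num.min d1 (Num.min d2 (e / 4)).
have d0 : 0 < d by rewrite !lt_min d10 d20 divr_gt0.
have [N N0 hN] := interp_unif cc_ d0.
have [M M0 hM] := interp_unif ac d0.
have [dd1 dd2 dde] : [/\ d <= d1, d <= d2 & d <= e / 4].
  by rewrite /d !ge_min !lexx !orbT.
have clc t : interp N c (clamp 0 1 t) = interp N c t by rewrite /interp -vpath_clamp.
have cla t : interp M a (clamp 0 1 t) = interp M a t by rewrite /interp -vpath_clamp.
have [||||||||z' [zc' z0 z1 zh hz']] := hd1 (interp N c) (interp M a).
- exact: vpath_cpath.
- exact: vpath_cpath.
- by move=> t k t01; apply: le_trans dd1; apply: hN.
- by move=> t t01; apply: le_trans dd1; apply: hM.
- by rewrite interp0.
- by rewrite interp1.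
- by rewrite interp0.
- by rewrite interp1.
have hz'E t : cpoly (interp N c t) (interp M a t ord0) = rpoly (z' t).
  by have [_ <-] := hz' t; rewrite clc cla.
exists (interp N c), (fun t => interp M a t ord0), z'; split => //.
- apply: (@hom_disc R m c (interp N c) c (e / 4)) => //.
  + exact: vpath_cpath.
  + by rewrite interp0.
  + by rewrite interp1.
  + by move=> t t01 i j ij; have := he t (to01 t t01) i j ij; lra.
  + by move=> t t01 j; apply: le_trans dde; apply: hN.
  + by move=> t t01 j; rewrite subrr nrm0 ltW // divr_gt0.
- split; [exact: vpath_csmooth|exact: vpath_csmooth|move=> j].
  apply: (@root_smooth R (fun t => rpoly (z' t)) m.+1) => //.
  + by move=> t; rewrite size_rpoly.
  + move=> i; rewrite (_ : (fun _ => _) =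
      fun t => (cpoly (interp N c t) (interp M a t ord0))`_i).
      by apply: (falg_cpoly (@csmooth_falg R)) => [k|]; exact: vpath_csmooth.
    by apply/funext => t; rewrite hz'E.
  + by move=> t; apply/root_rpolyP; exists j.
  + by move=> t; apply: deriv_rpoly_root; have [] := hz' t.
- move=> t; split; [|by have [] := hz' t|exact: hz'E].
  rewrite -clc; apply: (hd2 (clamp 0 1 t)); first exact/to01/I01_clamp.
  by move=> k; apply: le_trans dd2; apply/hN/I01_clamp.
Qed.

End Smoothing.

(** ** Braids with other endpoints *)
Section Matching.
Variables (R : realType) (n : nat).
Local Notation C := R[i].
Local Notation cRe := (@complex.Re R).

Lemma segment_same_order (p q : 'I_n -> C) : injective (cRe \o p) ->
  (forall j k, cRe (p j) < cRe (p k) -> cRe (q j) < cRe (q k)) ->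
  readable_segment p q [::].
Proof.
move=> pi pq; split; last exact: segment_word_same.
move=> u u01.
have lt j k : cRe (p j) < cRe (p k) ->
    cRe (segment_point p q u j) < cRe (segment_point p q u k).
  move=> h; have := pq j k h; rewrite /segment_point !cReD !cReZ !cReD !cReN.
  move=> h'; have [u2|u2] := leP u (1 / 2); nra.
move=> j k E; apply: pi => /=; apply/eqP; rewrite eq_le !leNgt.
by apply/andP; split; apply/negP => /lt; rewrite E ltxx.
Qed.

(** The identification of the braid groups of different endpoint sets becomes
    concrete: an edge between two configurations ordered alike carries the empty
    word, so adding such an edge at both ends of a polygon changes its endpoints
    but not its word. *)
Lemma matched_polygon (B : geometric_braid R n) : distinct_real_parts B 0 ->
  exists2 w, represents B w & forall p : 'I_n -> C,
    (forall j k, cRe (B j 0) < cRe (B k 0) -> cRe (p j) < cRe (p k)) ->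
    exists N v (ws : nat -> artin_word n), [/\ (0 < N)%N, v 0%N = p, rpoly (v N) = rpoly p,
      forall i, (i < N)%N -> readable_segment (v i) (v i.+1) (ws i) &
      w = flatten [seq ws i | i <- iota 0 N]].
Proof.
move=> hB; set z := braid_path B.
have z0E j : z 0 j = B j 0 by rewrite /z braid_pathE ?I01_0 // mulr0.
have z1E j : z 1 j = B j (2 * pi) by rewrite /z braid_pathE ?I01_1 // mulr1.
have z0i : injective (cRe \o z 0) by move=> j k; rewrite /= !z0E => /hB.
have /choice[s hs] := @strand_closed R n B.
have si : injective s by move=> i j E; apply: hB; rewrite /= !hs E.
have [s' ss' s's] := injF_bij si.
have s'i : injective s' := can_inj s's.
have z10 : z 1 = z 0 \o s' by apply/funext => j; rewrite /= z0E hs s's z1E.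
have z1i : injective (cRe \o z 1) by rewrite z10 => j k /z0i/s'i.
have [N [v [ws [N0 v0 vN hv hz]]]] :=
  polygon_of_braid (braid_path_cpath B) (@braid_path_ipath R n B) z0i z1i.
exists (flatten [seq ws i | i <- iota 0 N]).
  exact: represents_polygon hz hv.
move=> p hp.
have hp' j k : cRe (p j) < cRe (p k) -> cRe (z 0 j) < cRe (z 0 k).
  move=> h; rewrite ltNge le_eqVlt; apply/negP => /orP[/eqP E|].
    by move: h; rewrite (z0i k j E) ltxx.
  by rewrite !z0E => /hp; rewrite ltNge (ltW h).
have pi : injective (cRe \o p).
  move=> j k /= E; apply: z0i => /=; rewrite !z0E; apply/eqP; rewrite eq_le !leNgt.
  by apply/andP; split; apply/negP => /hp; rewrite E ltxx.
(* at the end, the strands have been permuted by s' *)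
pose v' i := if i is i'.+1 then if (i' <= N)%N then v i' else p \o s' else p.
pose ws' i := if i is i'.+1 then if (i' < N)%N then ws i' else [::] else [::].
exists N.+2, v', ws'; split => //.
- by rewrite /v' ltnn; exact: rpoly_perm.
- move=> [_|i]; first by rewrite /v' v0; exact: segment_same_order.
  rewrite ltnS => iN; have iN' : (i <= N)%N by [].
  rewrite /v' /ws' iN'; have [lt|ge] := ltnP i N; first exact: hv.
  have -> : i = N by lia.
  rewrite vN; apply: (segment_same_order z1i) => j k.
  by rewrite z10 /= !z0E; exact: hp.
- have -> : iota 0 N.+2 = 0%N :: rcons (map S (iota 0 N)) N.+1.
    by rewrite -[RHS]/(0%N :: _) -map_rcons -cats1 -(iotaD 0 N 1) addn1 -(iotaDl 1 0).
  rewrite /= map_rcons -cats1 flatten_cat /= ltnn !cats0 -map_comp.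
  by congr flatten; apply/eq_in_map => i; rewrite mem_iota /ws' /= => ->.
Qed.
End Matching.

(** ** Loops of polynomials from pairs of braids *)
Section Realization.
Variables (R : realType) (m : nat).
Local Notation C := R[i].
Local Notation tau := (2 * pi : R).

Lemma forms_of_path n (z : R -> 'I_n -> C) (p : nat -> 'I_n -> C) N ws w (S : set (C * R))
    (B : geometric_braid R n) :
  (forall j, csmooth (z^~ j)) -> (forall t, injective (z t)) ->
  homotopic z (vpath N p) -> (0 < N)%N -> rpoly (p N) = rpoly (p 0%N) ->
  (forall i, (i < N)%N -> readable_segment (p i) (p i.+1) (ws i)) ->
  w = flatten [seq ws i | i <- iota 0 N] -> represents B w ->
  (forall u t, S (u, t) <-> 0 <= t <= tau /\ exists j, u = z (t / tau) j) ->
  forms_braid S B.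
Proof.
move=> zs zi hz N0 p01 hp we Bw hS.
have [] := hom_endpoints hz; rewrite vpath0 // vpath1 // => z0 z1.
have [|||b hb] := @geometric_of R n (fun j t => z (t / tau) j).
- by move=> j; exists (fun t => z (t / tau) j) => //; exact: csmooth_rescale (zs j).
- by move=> t _; exact: zi.
- move=> i; have z01 : rpoly (z 0) = rpoly (z 1) by rewrite -z0 -z1.
  have [s _ hs] := rpoly_relabel (zi 0) z01; exists (s i).
  by rewrite mul0r divff ?tau_neq0.
exists b; split.
  apply/seteqP; split=> -[u t] /=; first by move=> /hS[ht [j ->]]; split=> //; exists j.
  move=> [ht [j hj]]; apply/hS; split; first exact: ht.
  by exists j; rewrite -hb.
exists w; split => //; rewrite we; apply: represents_polygon N0 _ hp.
apply: hom_ext hz => // t t01; apply/funext => j.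
by rewrite braid_pathE // hb mulrC mulKf // tau_neq0.
Qed.

Lemma cpoly_Xhat (c : 'I_m -> C) a (z : 'I_m.+1 -> C) : good_crit c -> injective z ->
  cpoly c a = rpoly z -> Xhat m.+1 (cpoly c a).
Proof.
move=> gc zi E; have [ci c0] := gc; split.
- exact: monic_cpoly.
- exact: size_cpoly.
- exists [seq z j | j <- enum 'I_m.+1]; first by rewrite -rpolyE.
  by rewrite map_inj_uniq ?enum_uniq.
exists [seq c k | k <- enum 'I_m]; first by rewrite -rpolyE deriv_cpoly.
rewrite -map_comp; split.
  rewrite map_inj_uniq ?enum_uniq // => k l /=.
  by rewrite cpolyD [in RHS]cpolyD => /addIr/ci.
apply/mapP => -[k _ /=]; rewrite cpoly0 cpolyD => /eqP.
by rewrite -subr_eq subrr eq_sym (negPf (c0 k)).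
Qed.

Lemma realize_braids (B : geometric_braid R m.+1) (B' : geometric_braid R m) :
  distinct_real_parts B 0 -> distinct_real_parts B' 0 ->
  exists g : R -> {poly C},
    [/\ loop_in_Xhat m.+1 g,
        forms_braid [set ut : C * R | 0 <= ut.2 <= tau /\ (g ut.2).[ut.1] = 0] B
      & forms_braid [set ut : C * R | 0 <= ut.2 <= tau /\ (g ut.2)^`().[ut.1] = 0] B'].
Proof.
move=> hB hB'.
have [w Bw hw] := matched_polygon hB.
have [w' Bw' hw'] := matched_polygon hB'.
have [p [q [a0 [E gq op qi oq]]]] := base_configuration hB hB'.
have [N [v [ws [N0 v0 vN hv we]]]] := hw p op.
have [N' [v' [ws' [N'0 v'0 v'N hv' we']]]] := hw' q oq.
have vi : ipath (vpath N v) by apply: vpath_ipath => // i /hv[].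
have v'i : ipath (vpath N' v') by apply: vpath_ipath => // i /hv'[].
have [||||c [a [z [pp hz hc [z01 a01]]]]] := realize_both (vpath_cpath N v) vi _
  (vpath_cpath N' v') v'i (a0 := a0).
- by rewrite (vpath1 _ _ (lexx 1)) (vpath0 _ _ (lexx 0)) v0.
- by rewrite (vpath1 _ _ (lexx 1)) (vpath0 _ _ (lexx 0)) v'0.
- by rewrite vpath0 // v'0.
- by rewrite !vpath0 // v0 v'0.
have [c' [a' [z' [hc' hz' [cs as_ zs] h]]]] := smooth_poly_path pp.
have ci t : injective (c' t) by have [/good_crit_inj] := h t.
have zi t : injective (z' t) by have [] := h t.
pose g t := cpoly (c' (t / tau)) (a' (t / tau)).
have gE t : g t = rpoly (z' (t / tau)) by have [] := h (t / tau).
exists g; split.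
- split.
  + by move=> t _; have [gc _ hE] := h (t / tau); exact: cpoly_Xhat gc (zi _) hE.
  + move=> k; have [c1 c2] : cc (fun t => (g t)`_k).
      apply: csmooth_cc; apply: (falg_cpoly (@csmooth_falg R)) => [j|].
        exact: csmooth_rescale (cs j).
      exact: csmooth_rescale as_.
    by split; apply: continuous_subspaceT.
  + rewrite !gE mul0r divff ?tau_neq0 //.
    have [z0 z1] := hom_endpoints hz'.
    by rewrite -z0 -z1.
- apply: (forms_of_path zs zi (hom_trans hz' hz) N0 _ hv we Bw); first by rewrite v0.
  by move=> u t /=; rewrite gE; split=> -[ht] => [/root_rpolyP|/root_rpolyP]; split.
- apply: (forms_of_path cs ci (hom_trans hc' hc) N'0 _ hv' we' Bw'); first by rewrite v'0.
  have root0 u t : (g t)^`().[u] = 0 <-> exists j, u = c' (t / tau) j.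
    rewrite -root_rpolyP deriv_cpoly hornerZ; split=> [/eqP|->]; last by rewrite mulr0.
    by rewrite mulf_eq0 (negPf (natC_neq0 _ _)) => /eqP.
  by move=> u t /=; split=> -[ht] => [/root0|/root0]; split.
Qed.
End Realization.

Theorem theorem1p2 (R : realType) (n : nat) (hn : (0 < n)%N)
    (B : geometric_braid R n) (hB : distinct_real_parts B 0)
    (B' : geometric_braid R n.-1) (hB' : distinct_real_parts B' 0) :
  exists g : R -> {poly R[i]},
    [/\ loop_in_Xhat n g,
        forms_braid
          [set ut : R[i] * R | 0 <= ut.2 <= 2 * pi /\ (g ut.2).[ut.1] = 0] B
      & forms_braid
          [set ut : R[i] * R | 0 <= ut.2 <= 2 * pi /\ (g ut.2)^`().[ut.1] = 0]
          B'].
Proof.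
case: n hn B hB B' hB' => [|m] // _ B hB B' hB'.
exact: realize_braids.
Qed.
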